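(* Let $k$ be an algebraically closed field and let $v$ be a discrete rank two valuation of $k((X_1,X_2))/k$ with value group $\mathbf Z^2$ (ordered lexicographically), whose ring contains $k[[X_1,X_2]]$ and whose center in $k[[X_1,X_2]]$ is the maximal ideal. Then $v$ is zero-dimensional (that is, its residue field has transcendence degree $0$ over $k$), and either $v$ is a monomial valuation, or $v$ can be reduced to a monomial valuation by a (possibly infinite) sequence of blowing-ups and coordinate changes.
   Context: $k((X_1,X_2))$ denotes the quotient field of $k[[X_1,X_2]]$. Valuations are trivial on $k$. Monomial valuation: let $L=\{B_1,B_2\}\subset\mathbf Z_{\ge 0}^2\setminus\{\mathbf 0\}$ be a system of generators of $\mathbf Z^2$. The monomial valuation of $k((y_1,y_2))$ ($y_1,y_2$ formally independent over $k$) associated to $L$ is the extension to the quotient field of the function sending $0\neq f=\sum f_{a_1a_2}y_1^{a_1}y_2^{a_2}\in k[[y_1,y_2]]$ to $\min_{\mathrm{lex}}\{a_1B_1+a_2B_2\mid f_{a_1a_2}\ne 0\}$ and $0$ to $\infty$. Blowing-up: passing from $k[[y_1,y_2]]$ to $k[[y_1,y_2/y_1]]\supset k[[y_1,y_2]]$ (or with the roles of $y_1,y_2$ exchanged), where the divided element has value at least that of the divisor. Coordinate change: replacing $y_2$ by $y_2-\alpha y_1^r$ with $\alpha\in k$, $r\ge1$ (or with roles exchanged). ''Reduced to a monomial valuation'' means that, starting from $(X_1,X_2)$, the sequence of steps leads to a pair $(y_1,y_2)$ with $k[[X_1,X_2]]\subset k[[y_1,y_2]]$ such that $v$ is the restriction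 of a valuation of $k((y_1,y_2))$ which is monomial in $(y_1,y_2)$; the values of $y_1,y_2$ then generate $\mathbf Z^2$. An infinite succession of steps subtracting terms $\alpha_i y_1^{i}$ from $y_2$ (interspersed with blowing-ups dividing by $y_1$) is understood as producing the element $y_2-\sum_i\alpha_i y_1^i$.
   Formalization: Valuations are identified up to an automorphism of the ordered group Z^2; read literally, with B_1, B_2 in Z_{>=0}^2, the claim fails for the valuation with v(X_1)=(0,1), v(X_2)=(1,-1). *)

(* Defs.v *)
From HB Require Import structures.
From mathcomp Require Import all_boot all_order all_algebra.
From mathcomp Require Import boolp.

Set Implicit Arguments.
Unset Strict Implicit.
Unset Printing Implicit Defensive.

Import Order.TTheory GRing.Theory Num.Theory.

Local Open Scope ring_scope.
Local Open Scope quotient_scope.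

Record pseries (R : Type) := PSeries { coefs : nat -> R }.

Lemma pseriesP (R : Type) (f g : pseries R) : coefs f =1 coefs g -> f = g.
Proof. by case: f g => [f] [g] /= /funext ->. Qed.

HB.instance Definition _ (R : Type) := gen_eqMixin (pseries R).
HB.instance Definition _ (R : Type) := gen_choiceMixin (pseries R).

Section PSeriesRing.
Variable R : comNzRingType.
Implicit Types f g h : pseries R.

Definition pser0 : pseries R := PSeries (fun=> 0).
Definition pserC (c : R) : pseries R :=
  PSeries (fun n => if n == 0%N then c else 0).
Definition pser_opp f : pseries R := PSeries (fun n => - coefs f n).
Definition pser_add f g : pseries R := PSeries (fun n => coefs f n + coefs g n).
Definition pser_mul f g : pseries R :=
  PSeries (fun n => \sum_(i < n.+1) coefs f i * coefs g (n - i)).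

Fact pser_addA : associative pser_add.
Proof. by move=> f g h; apply: pseriesP => n /=; rewrite addrA. Qed.
Fact pser_addC : commutative pser_add.
Proof. by move=> f g; apply: pseriesP => n /=; rewrite addrC. Qed.
Fact pser_add0 : left_id pser0 pser_add.
Proof. by move=> f; apply: pseriesP => n /=; rewrite add0r. Qed.
Fact pser_addN : left_inverse pser0 pser_opp pser_add.
Proof. by move=> f; apply: pseriesP => n /=; rewrite addNr. Qed.

HB.instance Definition _ := GRing.isZmodule.Build (pseries R)
  pser_addA pser_addC pser_add0 pser_addN.

Let trunc N f : {poly R} := \poly_(i < N) coefs f i.

Let truncM N f g n : (n < N)%N ->
  coefs (pser_mul f g) n = (trunc N f * trunc N g)`_n.
Proof.
move=> nN; rewrite coefM /=; apply: eq_bigr => i _; rewrite !coef_poly.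
by rewrite (leq_ltn_trans (leq_subr i n) nN) (leq_ltn_trans _ nN) // -ltnS.
Qed.

Let coef_trunc N f n : (n < N)%N -> (trunc N f)`_n = coefs f n.
Proof. by move=> nN; rewrite coef_poly nN. Qed.

Fact pser_mulA : associative pser_mul.
Proof.
move=> f g h; apply: pseriesP => n.
transitivity (trunc n.+1 f * (trunc n.+1 g * trunc n.+1 h))`_n.
  rewrite coefM; apply: eq_bigr => i _; rewrite (@truncM n.+1) ?ltnS ?leq_subr //.
  by rewrite coef_trunc.
rewrite mulrA coefM; apply: eq_bigr => i _; rewrite (@truncM n.+1) //.
by rewrite coef_trunc // ltnS leq_subr.
Qed.

Fact pser_mulC : commutative pser_mul.
Proof.
by move=> f g; apply: pseriesP => n; rewrite !(@truncM n.+1) // mulrC.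
Qed.

Fact pser_mul1 : left_id (pserC 1) pser_mul.
Proof.
move=> f; apply: pseriesP => n /=.
by rewrite big_ord_recl /= mul1r subn0 big1 ?addr0 // => i _; rewrite mul0r.
Qed.

Fact pser_mulDl : left_distributive pser_mul pser_add.
Proof.
move=> f g h; apply: pseriesP => n /=; rewrite -big_split /=.
by apply: eq_bigr => i _; rewrite mulrDl.
Qed.

Fact pser_1neq0 : pserC 1 != 0 :> pseries R.
Proof.
apply/eqP => /(congr1 (fun f => coefs f 0)) /= /eqP.
by rewrite oner_eq0.
Qed.

HB.instance Definition _ := GRing.Zmodule_isComNzRing.Build (pseries R)
  pser_mulA pser_mulC pser_mul1 pser_mulDl pser_1neq0.

Definition pser_unit : {pred pseries R} := fun f => `[< exists g, g * f = 1 >].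
Definition pser_inv f : pseries R :=
  if pselect (exists g, g * f = 1) is left e then projT1 (cid e) else f.

Fact pser_mulVx : {in pser_unit, left_inverse 1 pser_inv *%R}.
Proof.
move=> f /asboolP uf; rewrite /pser_inv; case: pselect => // e.
exact: projT2 (cid e).
Qed.
Fact pser_unitPl f g : g * f = 1 -> pser_unit f.
Proof. by move=> gf; apply/asboolP; exists g. Qed.
Fact pser_invr_out : {in [predC pser_unit], pser_inv =1 id}.
Proof.
move=> f /negP nf; rewrite /pser_inv; case: pselect => // e.
by case: nf; apply/asboolP.
Qed.

HB.instance Definition _ := GRing.ComNzRing_hasMulInverse.Build (pseries R)
  pser_mulVx pser_unitPl pser_invr_out.

End PSeriesRing.

Section PSeriesDomain.
Variable R : idomainType.
Implicit Types f g : pseries R.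

Let order_ex f : f != 0 ->
  exists2 m, coefs f m != 0 & forall i, (i < m)%N -> coefs f i = 0.
Proof.
move=> f0; have ex : exists m, coefs f m != 0.
  apply: contrapT => nex; case/eqP: f0; apply: pseriesP => n /=.
  by apply/eqP; apply: contrapT => /negP fn; case: nex; exists n.
case: (ex_minnP ex) => m fm minm; exists m => // i im.
by apply/eqP; apply: contraTT im => /minm; rewrite -leqNgt.
Qed.

Fact pser_integral f g : f * g = 0 -> (f == 0) || (g == 0).
Proof.
move=> fg0; apply: contrapT => /negP; rewrite negb_or => /andP[f0 g0].
have [m fm mf] := order_ex f0; have [n gn mg] := order_ex g0.
have /eqP : coefs (f * g) (m + n) = 0 by rewrite fg0.
have mlt : (m < (m + n).+1)%N by rewrite ltnS leq_addr.
rewrite /= (bigD1 (Ordinal mlt)) //= addKn big1 ?addr0.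
  by rewrite mulf_eq0 (negPf fm) (negPf gn).
move=> i; rewrite -val_eqE /= neq_ltn => /orP[im|mi].
  by rewrite mf ?mul0r.
have [?|] := leqP i (m + n); last by rewrite ltnNge -ltnS ltn_ord.
by rewrite mg ?mulr0 // ltn_subLR // ltn_add2r.
Qed.

HB.instance Definition _ := GRing.ComUnitRing_isIntegral.Build (pseries R)
  pser_integral.

End PSeriesDomain.

(* [k[[X1,X2]]], realised as [k[[X2]][[X1]]], and its quotient field. *)
Notation ser2 k := (pseries (pseries k)).
Notation qser2 k := {fraction ser2 k}.

Section Series2.
Variable k : fieldType.
Implicit Types f g : ser2 k.

(* The coefficient of [X1^a X2^b]. *)
Definition coef2 f (a b : nat) : k := coefs (coefs f a) b.

Definition mkser2 (c : nat -> nat -> k) : ser2 k :=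
  PSeries (fun a => PSeries (c a)).

Definition cst2 (c : k) : ser2 k := pserC (pserC c).

Definition X1 : ser2 k := mkser2 (fun a b => ((a == 1%N) && (b == 0%N))%:R).
Definition X2 : ser2 k := mkser2 (fun a b => ((a == 0%N) && (b == 1%N))%:R).

Definition qcst (c : k) : qser2 k := tofrac (cst2 c).

(* Coefficientwise [sum_(i,j) f_ij g1^i g2^j], for [g1], [g2] in the maximal
   ideal: the bounds are harmless since [g1^i g2^j] has order at least
   [i + j]. *)
Definition subst2 (g1 g2 f : ser2 k) : ser2 k :=
  mkser2 (fun a b => \sum_(i < (a + b).+1) \sum_(j < (a + b).+1)
     coef2 f i j * coef2 (g1 ^+ i * g2 ^+ j) a b).

(* [sum_(i >= 1) alpha_i X1^i], resp. [sum_(i >= 1) alpha_i X2^i]. *)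
Definition tail1 (alpha : nat -> k) : ser2 k :=
  mkser2 (fun a b => if (0 < a)%N && (b == 0%N) then alpha a else 0).
Definition tail2 (alpha : nat -> k) : ser2 k :=
  mkser2 (fun a b => if (a == 0%N) && (0 < b)%N then alpha b else 0).

End Series2.

Arguments X1 {k}.
Arguments X2 {k}.

Notation Z2 := (int * int)%type.

Definition lexle (x y : Z2) : bool := ((x : int *l int) <= (y : int *l int))%O.

(* [None] is the value oo of 0. *)
Definition vle (x y : option Z2) : bool :=
  match x, y with
  | _, None => true
  | None, Some _ => false
  | Some a, Some b => lexle a b
  end.
Definition vlt (x y : option Z2) : bool := ~~ vle y x.
Definition vmin (x y : option Z2) : option Z2 := if vle x y then x else y.
Definition vadd (x y : option Z2) : option Z2 :=
  match x, y with Some a, Some b => Some (a + b) | _, _ => None end.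

Record valuation (k : fieldType) := Valuation {
  vfun :> qser2 k -> option Z2;
  val_oo : forall x, vfun x = None <-> x = 0;
  valM : forall x y, vfun (x * y) = vadd (vfun x) (vfun y);
  valD : forall x y, vle (vmin (vfun x) (vfun y)) (vfun (x + y));
  val_cst : forall c : k, c != 0 -> vfun (qcst c) = Some 0
}.

Section ResidueField.
Variables (k : fieldType) (v : valuation k).

Lemma vle_refl a : vle a a. Proof. by case: a => //= a; exact: lexx. Qed.
Lemma vle_trans b a c : vle a b -> vle b c -> vle a c.
Proof. by case: a b c => [a|] [b|] [c|] //=; exact: le_trans. Qed.
Lemma vle_total a b : vle a b || vle b a.
Proof. by case: a b => [a|] [b|] //=; exact: le_total. Qed.
Lemma vle_anti a b : vle a b -> vle b a -> a = b.
Proof.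
case: a b => [a|] [b|] //= ab ba; congr Some; apply: (@le_anti _ (int *l int)).
exact/andP.
Qed.
Lemma vle_min c a b : vle c a -> vle c b -> vle c (vmin a b).
Proof. by rewrite /vmin; case: ifP. Qed.
Lemma lexleD (a b c d : Z2) : lexle a b -> lexle c d -> lexle (a + c) (b + d).
Proof.
case: a b c d => [a1 a2] [b1 b2] [c1 c2] [d1 d2].
rewrite /lexle !leEprodlexi /= => /andP[h1 h2] /andP[h3 h4].
rewrite lerD //=; apply/implyP => h.
have e1 : b1 <= a1 by rewrite -(lerD2r c1) (le_trans _ h) // lerD2l.
have e2 : d1 <= c1 by rewrite -(lerD2l a1) (le_trans _ h) // lerD2r.
by rewrite lerD ?(implyP h2) ?(implyP h4).
Qed.
Lemma vleD a b c d : vle a b -> vle c d -> vle (vadd a c) (vadd b d).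
Proof.
by case: a b c d => [a|] [b|] [c|] [d|] //=; apply: lexleD.
Qed.

Lemma val0 : v 0 = None. Proof. exact/val_oo. Qed.
Lemma cst2_1 : cst2 1 = 1 :> ser2 k. Proof. by []. Qed.
Lemma cst2_N1 : cst2 (-1) = -1 :> ser2 k.
Proof.
apply: pseriesP => a; apply: pseriesP => b /=.
by case: a => [|a] /=; case: b => [|b] /=; rewrite ?oppr0.
Qed.
Lemma qcst1 : qcst 1 = 1 :> qser2 k.
Proof. by rewrite /qcst cst2_1 tofrac1. Qed.
Lemma qcstN1 : qcst (-1) = -1 :> qser2 k.
Proof. by rewrite /qcst cst2_N1 tofracN tofrac1. Qed.

Lemma val1 : v 1 = Some 0.
Proof. by have := @val_cst _ v 1 (oner_neq0 _); rewrite qcst1. Qed.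
Lemma valN1 : v (-1) = Some 0.
Proof.
have N1 : -1 != 0 :> k by rewrite oppr_eq0 oner_neq0.
by have := val_cst v N1; rewrite qcstN1.
Qed.
Lemma valN x : v (- x) = v x.
Proof.
by rewrite -mulN1r valM valN1; case: (v x) => //= a; rewrite add0r.
Qed.

Definition vring : {pred qser2 k} := fun x => vle (Some 0) (v x).

Fact vring_subring_closed : subring_closed vring.
Proof.
split=> [|x y|x y]; rewrite !unfold_in.
- by rewrite val1 vle_refl.
- move=> vx vy; apply: vle_trans (valD v x (- y)).
  by rewrite vle_min // valN.
- by move=> vx vy; rewrite valM -[0]addr0; apply: (vleD vx vy).
Qed.
HB.instance Definition _ :=
  GRing.isSubringClosed.Build (qser2 k) vring vring_subring_closed.

Record valring := ValRing { vrval : qser2 k; _ : vrval \in vring }.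
HB.instance Definition _ := [isSub for vrval].
HB.instance Definition _ := [Choice of valring by <:].
HB.instance Definition _ := [SubChoice_isSubComNzRing of valring by <:].

Definition vmax : {pred valring} := fun x => vlt (Some 0) (v (vrval x)).

Lemma vrval0 : vrval 0 = 0.
Proof. exact: (rmorph0 (val : valring -> qser2 k)). Qed.
Lemma vrval1 : vrval 1 = 1.
Proof. exact: (rmorph1 (val : valring -> qser2 k)). Qed.
Lemma vrvalD : {morph vrval : x y / x + y}.
Proof. exact: (rmorphD (val : valring -> qser2 k)). Qed.
Lemma vrvalM : {morph vrval : x y / x * y}.
Proof. exact: (rmorphM (val : valring -> qser2 k)). Qed.

Fact vmax_idealr_closed : idealr_closed vmax.
Proof.
split; rewrite ?unfold_in /vlt ?vrval0 ?vrval1 ?val0 ?val1 ?vle_refl //.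
move=> a x y; rewrite !unfold_in /vlt vrvalD vrvalM => vx vy.
apply/negP => h; have := vle_trans (valD v _ _) h.
rewrite /vmin; case: ifP => _; apply/negP => //.
rewrite valM; apply: contra vx => h1; apply: vle_trans h1.
have -> : v (vrval x) = vadd (Some 0) (v (vrval x)).
  by case: (v _) => //= c; rewrite add0r.
apply: vleD; last first.
  by case: (v (vrval x)) => //= c; rewrite add0r; exact: (vle_refl (Some c)).
by case: (a).
Qed.
HB.instance Definition _ := isIdealr.Build valring vmax vmax_idealr_closed.

Definition residue : Type := {ideal_quot vmax}.
HB.instance Definition _ := GRing.ComNzRing.on residue.
Definition res (x : valring) : residue := \pi_{ideal_quot vmax}x.

Fact res_mulV (x : residue) : x != 0 -> exists y : residue, y * x = 1.
Proof.
have [a ->] : exists a, x = res a by exists (repr x); rewrite /res reprK.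
have -> : 0 = res 0 by rewrite /res rmorph0.
rewrite /res -Quotient.idealrBE subr0 => na.
have va : v (vrval a) = Some 0.
  apply: vle_anti; last by case: (a).
  by apply: contraNT na; rewrite unfold_in.
have a0 : vrval a != 0 by apply/eqP => e; move: va; rewrite e val0.
have vi : (vrval a)^-1 \in vring.
  rewrite unfold_in; have := val1; rewrite -(mulVf a0) valM va.
  case: (v _) => // -[c1 c2] [] /=; rewrite !addr0 => -> ->.
  exact: (vle_refl (Some 0)).
exists (res (ValRing vi)); rewrite /res -rmorphM.
rewrite -(rmorph1 (\pi_{ideal_quot vmax})); congr (\pi_{ideal_quot vmax} _); apply: val_inj.
by rewrite -[LHS]/(vrval _) vrvalM mulVf.
Qed.

Definition res_inv (x : residue) : residue :=
  if pselect (exists y, y * x = 1) is left e then projT1 (cid e) else 0.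

Fact res_mulVf (x : residue) : x != 0 -> res_inv x * x = 1.
Proof.
move=> /res_mulV ex; rewrite /res_inv; case: pselect => // e.
exact: projT2 (cid e).
Qed.
Fact res_inv0 : res_inv 0 = 0.
Proof.
rewrite /res_inv; case: pselect => // e; exfalso; case: e => y.
by rewrite mulr0 => /esym/eqP; rewrite oner_eq0.
Qed.
HB.instance Definition _ :=
  GRing.ComNzRing_isField.Build residue res_mulVf res_inv0.

Fact qcst_vring (c : k) : qcst c \in vring.
Proof.
rewrite unfold_in; have [->|c0] := eqVneq c 0; last by rewrite val_cst // vle_refl.
suff -> : qcst 0 = 0 :> qser2 k by rewrite val0.
rewrite /qcst (_ : cst2 0 = 0) ?tofrac0 //.
by apply: pseriesP => -[|a]; apply: pseriesP => -[|b].
Qed.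

Definition res_cst (c : k) : residue := res (ValRing (qcst_vring c)).

End ResidueField.

(* Transcendence degree 0 over [k]: the residue field is algebraic over [k]. *)
Definition zero_dimensional (k : fieldType) (v : valuation k) : Prop :=
  forall x : residue v, algebraicOver (@res_cst k v) x.

Section Reduction.
Variable k : fieldType.
Implicit Types (v w : valuation k) (f : ser2 k).

Definition value_group_Z2 v : Prop := forall c : Z2, exists x, v x = Some c.

Definition ring_contains_series v : Prop :=
  forall f, vle (Some 0) (v (tofrac f)).

(* The maximal ideal of [k[[X1,X2]]] consists of the series without constant
   term. *)
Definition center_is_maximal v : Prop :=
  forall f, vlt (Some 0) (v (tofrac f)) <-> coef2 f 0 0 = 0.

Definition nonneg_nonzero (B : Z2) : Prop := [/\ 0 <= B.1, 0 <= B.2 & B != 0].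

Definition generates (B1 B2 : Z2) : Prop :=
  forall c : Z2, exists m n : int, c = B1 *~ m + B2 *~ n.

(* [c] is the lexicographic minimum of the [a B1 + b B2], for [X1^a X2^b] in
   the support of [f]. *)
Definition is_lexmin (B1 B2 : Z2) f (c : Z2) : Prop :=
  (exists a b, coef2 f a b != 0 /\ c = B1 *+ a + B2 *+ b) /\
  (forall a b, coef2 f a b != 0 -> lexle c (B1 *+ a + B2 *+ b)).

Definition monomial w : Prop :=
  exists B1 B2 : Z2,
    [/\ nonneg_nonzero B1, nonneg_nonzero B2, generates B1 B2 &
        forall f c, w (tofrac f) = Some c <-> is_lexmin B1 B2 f c].

(* Valuations are identified when they differ by an automorphism of the
   ordered group [Z^2].  Without this identification there would be no
   monomial valuation, even after reduction, for the (surjective, centred) [v]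
   with [v X1 = (0,1)], [v X2 = (1,-1)], which takes values outside [N^2] on
   [k[[X1,X2]]]. *)
Definition order_auto (s : Z2 -> Z2) : Prop :=
  [/\ bijective s, {morph s : c d / c + d} & {mono s : c d / lexle c d}].

Definition same_valuation (v w : qser2 k -> option Z2) : Prop :=
  exists2 s, order_auto s & forall x, v x = omap s (w x).

Definition is_monomial v : Prop := exists2 w, monomial w & same_valuation v w.

(* A pair [(y1, y2)], together with the series [f1], [f2] such that
   [X1 = f1(y1,y2)] and [X2 = f2(y1,y2)]; the latter determine the inclusion
   of [k[[X1,X2]]] in [k[[y1,y2]]], in which [X1] and [X2] stand for [y1] and
   [y2]. *)
Record stage := Stage {
  y1 : qser2 k; y2 : qser2 k;
  f1 : ser2 k; f2 : ser2 k
}.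

Definition stage0 := Stage (tofrac X1) (tofrac X2) X1 X2.

(* [change s z1 z2 g1 g2] passes from [(y1,y2)] to [(z1,z2)], where
   [y1 = g1(z1,z2)] and [y2 = g2(z1,z2)]. *)
Definition change (s : stage) (z1 z2 : qser2 k) (g1 g2 : ser2 k) :=
  Stage z1 z2 (subst2 g1 g2 (f1 s)) (subst2 g1 g2 (f2 s)).

Inductive step v (s : stage) : stage -> Prop :=
| BlowUp1 : vle (v (y1 s)) (v (y2 s)) ->
    step v s (change s (y1 s) (y2 s / y1 s) X1 (X1 * X2))
| BlowUp2 : vle (v (y2 s)) (v (y1 s)) ->
    step v s (change s (y1 s / y2 s) (y2 s) (X1 * X2) X2)
| Coord2 (alpha : k) (r : nat) : (1 <= r)%N ->
    step v s (change s (y1 s) (y2 s - qcst alpha * y1 s ^+ r)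
                       X1 (X2 + cst2 alpha * X1 ^+ r))
| Coord1 (alpha : k) (r : nat) : (1 <= r)%N ->
    step v s (change s (y1 s - qcst alpha * y2 s ^+ r) (y2 s)
                       (X1 + cst2 alpha * X2 ^+ r) X2).

Inductive finitely_reached v : stage -> Prop :=
| Reached0 : finitely_reached v stage0
| ReachedS s t : finitely_reached v s -> step v s t -> finitely_reached v t.

(* [reached v g1 g2]: a finite or infinite sequence of steps leads to a pair
   [(y1,y2)] with [X1 = g1(y1,y2)] and [X2 = g2(y1,y2)].  An infinite sequence
   ends with an infinite succession of subtractions of [alpha_i y1^i] from
   [y2], which produces [y2 - sum_(i >= 1) alpha_i y1^i] (or with [y1] and
   [y2] exchanged).  This element is in general not in [k((X1,X2))], so that
   only the two series are recorded.  Interspersed blowing-ups dividing by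
   [y1] lead to an element of the same form, since subtracting
   [alpha y1^r] from [(y2 - p(y1)) / y1^d] amounts to subtracting
   [alpha y1^(r+d)] from [y2 - p(y1)]. *)
Inductive reached v : ser2 k -> ser2 k -> Prop :=
| ReachedFinite s : finitely_reached v s -> reached v (f1 s) (f2 s)
| ReachedInfinite2 s (alpha : nat -> k) : finitely_reached v s ->
    reached v (subst2 X1 (X2 + tail1 alpha) (f1 s))
              (subst2 X1 (X2 + tail1 alpha) (f2 s))
| ReachedInfinite1 s (alpha : nat -> k) : finitely_reached v s ->
    reached v (subst2 (X1 + tail2 alpha) X2 (f1 s))
              (subst2 (X1 + tail2 alpha) X2 (f2 s)).

(* [iota] is the inclusion of [k((X1,X2))] in [k((y1,y2))]. *)
Definition reduces_to_monomial v : Prop :=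
  exists g1 g2, reached v g1 g2 /\
  exists (iota : {rmorphism qser2 k -> qser2 k}) (w : valuation k),
    [/\ forall f, iota (tofrac f) = tofrac (subst2 g1 g2 f),
        monomial w & same_valuation v (w \o iota)].

End Reduction.

(* Main.v *)
(* The values of the pair [(y1, y2)] are run through Euclid's algorithm:
   blowing-ups subtract the smaller value from the larger one and, when the two
   values agree, the residue of [y2 / y1] lies in [k] (if it were transcendental,
   [v] would be a multiple of the order at the origin and its value group
   cyclic), so that a coordinate change increases the value of [y2].  Among the
   pairs obtained, choose one with [g = v y1] minimal on its ray; from then on
   only terms [alpha_i y1^i] are subtracted.

   If [v X1] and [v X2] have positive first components, every series agrees with
   a polynomial up to an error of arbitrarily large value; [v] is therefore
   determined by its values on polynomials, the process cannot go on forever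
   (all values would be multiples of [g]), and it stops at a pair with linearly
   independent values, in which [v] is monomial.

   Otherwise [g = (0, c)].  The limit [Y = y2 - sum_i alpha_i y1^i] is such that
   [f |-> f mod Y] in [k[[y1]]] computes [v f] outside the prime
   [p = {f | 0 < (v f).1}] of [k[[X1,X2]]].  This prime is principal by
   Weierstrass division; the values of its generator under [v] and under the
   monomial valuation in [(y1, Y)] both complete [(0, 1)] to a basis of [Z^2],
   whence the two valuations agree up to a shear.

   In both cases the residue field of the monomial valuation is [k], so [v] is
   zero-dimensional. *)
Require Import Defs.
From HB Require Import structures.
From mathcomp Require Import all_boot all_order all_algebra.
From mathcomp Require Import boolp zify ring.
Import Defs.

Set Implicit Arguments.
Unset Strict Implicit.
Unset Printing Implicit Defensive.

Import Order.TTheory GRing.Theory Num.Theory.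
Local Open Scope ring_scope.
Local Open Scope quotient_scope.

(** * Values in [Z^2] and valuations *)

(** The obstacle is that [v] is given on [k((X1,X2))], where a series in a later pair [(y1, y2)]
    cannot be evaluated, whereas a monomial valuation lives on such series. Polynomials make sense
    on both sides, so each stage carries the fact that a polynomial in [X1], [X2] is one and the
    same polynomial in [y1], [y2] in the field and in the series ring. Series are then reached by
    truncation: if [lam] bounds the values of [X1] and [X2] from below, an error of order [M] has
    value at least [lam *+ M]. When [lam.1 = 0] these bounds never exceed a value with positive
    first component, so truncation only computes values outside the prime [p], and the generator of
    [p] must supply the rest. In that case the generator of [p] might a priori have order greater
    than 1 in the limit [Y], because [k((X1,X2))] is not all of [k((y1,Y))]. This is excluded
    because every nonzero series in [(y1, Y)] is, up to a unit, a quotient of images of series in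
    [(X1, X2)]: for a blowing-up, Weierstrass preparation leaves a polynomial in the second
    variable, and a power of the first clears the denominators. *)

Section Values.
Implicit Types (a b c d : Z2) (x y z : option Z2).

Lemma lexleE a b : lexle a b = (a.1 < b.1) || ((a.1 == b.1) && (a.2 <= b.2)).
Proof.
case: a b => [a1 a2] [b1 b2]; rewrite /lexle leEprodlexi /=.
by case: (ltgtP a1 b1).
Qed.

Lemma vltNge x y : vlt x y = ~~ vle y x. Proof. by []. Qed.

Lemma vltW x y : vlt x y -> vle x y.
Proof. by move=> xy; have := vle_total x y; rewrite (negPf xy) orbF. Qed.

Lemma vle_lt_trans y x z : vle x y -> vlt y z -> vlt x z.
Proof. by move=> xy; apply: contra => zx; apply: vle_trans zx xy. Qed.

Lemma vlt_le_trans y x z : vlt x y -> vle y z -> vlt x z.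
Proof. by move=> xy yz; apply: contra xy => zx; apply: vle_trans yz zx. Qed.

Lemma vle_None x : vle x None. Proof. by case: x. Qed.

Lemma vle_eqVlt x y : vle x y -> x = y \/ vlt x y.
Proof.
move=> xy; case E: (vle y x); first by left; apply: vle_anti.
by right; rewrite /vlt E.
Qed.

Lemma vlt_minr z x y : vlt z x -> vlt z y -> vlt z (vmin x y).
Proof. by rewrite /vmin; case: ifP. Qed.

Lemma vmin_lel x y : vle (vmin x y) x.
Proof.
rewrite /vmin; case: ifP => [_|xy]; first exact: vle_refl.
by have := vle_total x y; rewrite xy.
Qed.

Lemma vmin_ler x y : vle (vmin x y) y.
Proof. by rewrite /vmin; case: ifP => // _; apply: vle_refl. Qed.

Lemma vadd0 x : vadd (Some 0) x = x.
Proof. by case: x => //= a; rewrite add0r. Qed.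

Lemma vaddC x y : vadd x y = vadd y x.
Proof. by case: x y => [a|] [b|] //=; rewrite addrC. Qed.

Lemma lexle_add2r c a b : lexle (a + c) (b + c) = lexle a b.
Proof. by rewrite !lexleE; case: a b c => [? ?] [? ?] [? ?] /=; lia. Qed.

Lemma Z2mulrn a n : a *+ n = (a.1 * n%:Z, a.2 * n%:Z).
Proof.
elim: n => [|n IH]; first by rewrite mulr0n !mulr0.
by rewrite mulrS IH; case: a {IH} => a b; congr pair => /=; lia.
Qed.

Lemma Z2mulrz a (n : int) : a *~ n = (a.1 * n, a.2 * n).
Proof.
case: n => n; first by rewrite -Z2mulrn.
by rewrite NegzE mulrNz -[a *~ _]/(a *+ n.+1) Z2mulrn; congr pair => /=; ring.
Qed.

Lemma lexle_muln c a n : vlt (Some 0) (Some c) -> lexle a 0 -> lexle a (c *+ n).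
Proof.
rewrite vltNge /= !lexleE Z2mulrn; case: a c => [a1 a2] [c1 c2] /= hc ha.
have [c10|c1p] : c1 = 0 \/ 0 < c1 by lia.
  have h : 0 <= c2 * n by apply: mulr_ge0; lia.
  by rewrite c10 mul0r; lia.
have h : 0 <= c1 * n by apply: mulr_ge0; lia.
case: n h => [|n] h; first by rewrite !mulr0; lia.
have : 0 < c1 * n.+1 by apply: mulr_gt0.
lia.
Qed.

End Values.

Section ValuationTheory.
Variables (k : fieldType) (v : valuation k).
Implicit Types (x y : qser2 k) (c : option Z2).

Lemma val_eq0 x : v x = None -> x = 0. Proof. by move/val_oo. Qed.

Lemma val_neq0 x : x != 0 -> exists a, v x = Some a.
Proof. by case E: (v x) => [a|]; [exists a | rewrite (val_eq0 E) eqxx]. Qed.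

Lemma val_geD c x y : vle c (v x) -> vle c (v y) -> vle c (v (x + y)).
Proof. by move=> cx cy; apply: vle_trans (valD v x y); apply: vle_min. Qed.

Lemma val_gtD c x y : vlt c (v x) -> vlt c (v y) -> vlt c (v (x + y)).
Proof. by move=> cx cy; apply: vlt_le_trans (valD v x y); apply: vlt_minr. Qed.

Lemma val_geB c x y : vle c (v x) -> vle c (v y) -> vle c (v (x - y)).
Proof. by move=> cx cy; apply: val_geD => //; rewrite valN. Qed.

Lemma val_gtB c x y : vlt c (v x) -> vlt c (v y) -> vlt c (v (x - y)).
Proof. by move=> cx cy; apply: val_gtD => //; rewrite valN. Qed.

Lemma val_ge_sum (I : Type) (r : seq I) (P : pred I) (F : I -> qser2 k) c :
  (forall i, P i -> vle c (v (F i))) -> vle c (v (\sum_(i <- r | P i) F i)).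
Proof.
move=> H; elim/big_ind: _ => //; first by rewrite val0 vle_None.
exact: val_geD.
Qed.

Lemma val_gt_sum (I : Type) (r : seq I) (P : pred I) (F : I -> qser2 k) a :
  (forall i, P i -> vlt (Some a) (v (F i))) ->
  vlt (Some a) (v (\sum_(i <- r | P i) F i)).
Proof.
move=> H; elim/big_ind: _ => //; first by rewrite val0.
exact: val_gtD.
Qed.

Lemma val_addl x y : vlt (v x) (v y) -> v (x + y) = v x.
Proof.
move=> xy; apply: vle_anti; last first.
  by apply: vle_trans (valD v x y); apply: vle_min; [apply: vle_refl|apply: vltW].
case E: (vle _ _) => //.
have h : vlt (v x) (v (x + y)) by rewrite /vlt E.
have := val_gtB h xy; rewrite addrK vltNge.
by rewrite vle_refl.
Qed.

Lemma valXn x n a : v x = Some a -> v (x ^+ n) = Some (a *+ n).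
Proof.
move=> xa; elim: n => [|n IH]; first by rewrite expr0 val1.
by rewrite exprS valM xa IH /= mulrS.
Qed.

Lemma valV x a : v x = Some a -> v x^-1 = Some (- a).
Proof.
move=> xa; have x0 : x != 0 by apply/eqP => x0; rewrite x0 val0 in xa.
have := valM v x x^-1; rewrite divff // val1 xa.
case: (v x^-1) => //= b /(congr1 (odflt 0)) /= ab; congr Some; apply/eqP.
by rewrite -addr_eq0 addrC -ab.
Qed.

Lemma val_div x y a b : v x = Some a -> v y = Some b -> v (x / y) = Some (a - b).
Proof. by move=> xa yb; rewrite valM xa (valV yb). Qed.

Lemma val_qcst_ge0 (c : k) : vle (Some 0) (v (qcst c)).
Proof. exact: (qcst_vring v c). Qed.

Lemma val_ge0M x y : vle (Some 0) (v x) -> vle (Some 0) (v y) ->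
  vle (Some 0) (v (x * y)).
Proof. by move=> hx hy; rewrite valM -[X in Some X]addr0; apply: (vleD hx hy). Qed.

Lemma val_geMl c x y : vle c (v x) -> vle (Some 0) (v y) -> vle c (v (x * y)).
Proof.
move=> hx hy; rewrite valM.
have -> : c = vadd c (Some 0) by rewrite vaddC vadd0.
exact: vleD.
Qed.

Lemma val_ge0X x n : vle (Some 0) (v x) -> vle (Some 0) (v (x ^+ n)).
Proof.
by move=> hx; elim: n => [|n IH]; rewrite ?expr0 ?val1 // exprS val_ge0M.
Qed.

End ValuationTheory.

(** * Power series *)

Section PSeries.
Variable R : comNzRingType.
Implicit Types f g : pseries R.

Lemma coefsD f g n : coefs (f + g) n = coefs f n + coefs g n.
Proof. by []. Qed.
Lemma coefs1 n : coefs (1 : pseries R) n = (n == 0%N)%:R.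
Proof. by case: n. Qed.
Lemma coefsM f g n : coefs (f * g) n = \sum_(i < n.+1) coefs f i * coefs g (n - i).
Proof. by []. Qed.
Lemma coefs_sum (I : Type) (r : seq I) (P : pred I) (F : I -> pseries R) n :
  coefs (\sum_(i <- r | P i) F i) n = \sum_(i <- r | P i) coefs (F i) n.
Proof. by elim/big_rec2: _ => // i x y _ <-. Qed.

Lemma coefs_CM (c : R) f n : coefs (pserC c * f) n = c * coefs f n.
Proof.
rewrite coefsM big_ord_recl /= subn0 big1 ?addr0 // => i _.
by rewrite mul0r.
Qed.

Fact pserC_zmod : zmod_morphism (@pserC R).
Proof. by move=> a b; apply: pseriesP => -[|n] //=; rewrite ?oppr0 ?addr0. Qed.
HB.instance Definition _ := GRing.isZmodMorphism.Build R (pseries R)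
  (@pserC R) pserC_zmod.
Fact pserC_monoid : monoid_morphism (@pserC R).
Proof.
split=> // a b; apply: pseriesP => n; rewrite coefs_CM /=.
by case: ifP => // _; rewrite mulr0.
Qed.
HB.instance Definition _ := GRing.isMonoidMorphism.Build R (pseries R)
  (@pserC R) pserC_monoid.

Definition pserX : pseries R := PSeries (fun n => (n == 1%N)%:R).

Lemma coefs_XM f n : coefs (pserX * f) n = if n is m.+1 then coefs f m else 0.
Proof.
rewrite coefsM; case: n => [|n]; first by rewrite big_ord1 /= mul0r.
rewrite big_ord_recl big_ord_recl /= mul0r add0r mul1r subSS subn0.
by rewrite big1 ?addr0 // => i _; rewrite mul0r.
Qed.

End PSeries.

(** Course-of-values recursion: [L n] is the list of the first [n] values, and [F] reads it through
    [nth]. The default [x0] beyond its end is harmless since [F n] depends only on earlier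
    values. *)
Lemma course_rec (T : Type) (x0 : T) (F : nat -> (nat -> T) -> T) :
  (forall n u u', (forall i, (i < n)%N -> u i = u' i) -> F n u = F n u') ->
  exists u, forall n, u n = F n u.
Proof.
move=> Fext; pose L n := iter n (fun s => rcons s (F (size s) (nth x0 s))) [::].
have szL n : size (L n) = n by elim: n => //= n; rewrite size_rcons => ->.
have nthL n m : (n < m)%N -> nth x0 (L m) n = F n (nth x0 (L n)).
  elim: m => // m IH; rewrite ltnS leq_eqVlt => /predU1P [->|nm].
    by rewrite /= nth_rcons szL ltnn eqxx.
  by rewrite /= nth_rcons szL nm IH.
exists (fun n => F n (nth x0 (L n))) => n; apply: Fext => i ni.
by rewrite nthL.
Qed.

(** The coefficients of the inverse solve a triangular system. It is stated over a ring because it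
    is applied twice, to [k] and to [pseries k]. *)
Lemma pser_inv_ex (R : comNzRingType) (f : pseries R) (c : R) :
  c * coefs f 0 = 1 -> exists g, g * f = 1.
Proof.
move=> cf.
have [|u uE] := @course_rec R 0 (fun n u => c * ((n == 0%N)%:R -
    \sum_(i < n) u i * coefs f (n - i))).
  by move=> n u u' uu'; congr (_ * (_ - _)); apply: eq_bigr => i _; rewrite uu'.
exists (PSeries u); apply: pseriesP => n.
rewrite coefsM coefs1 big_ord_recr /= subnn uE mulrAC cf mul1r.
by rewrite addrC subrK.
Qed.

Section Series2.
Variable k : fieldType.
Implicit Types (f g r : ser2 k) (c : k).

Lemma ser2P f g : (forall a b, coef2 f a b = coef2 g a b) -> f = g.
Proof. by move=> fg; apply: pseriesP => a; apply: pseriesP => b; apply: fg. Qed.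

Lemma coef2D f g a b : coef2 (f + g) a b = coef2 f a b + coef2 g a b.
Proof. by []. Qed.
Lemma coef2N f a b : coef2 (- f) a b = - coef2 f a b. Proof. by []. Qed.
Lemma coef2B f g a b : coef2 (f - g) a b = coef2 f a b - coef2 g a b.
Proof. by []. Qed.
Lemma coef20 a b : coef2 (0 : ser2 k) a b = 0. Proof. by []. Qed.
Lemma coef2_sum (I : Type) (s : seq I) (P : pred I) (F : I -> ser2 k) a b :
  coef2 (\sum_(i <- s | P i) F i) a b = \sum_(i <- s | P i) coef2 (F i) a b.
Proof. by elim/big_rec2: _ => // i x y _ <-. Qed.
Lemma coef2M f g a b : coef2 (f * g) a b =
  \sum_(i < a.+1) \sum_(j < b.+1) coef2 f i j * coef2 g (a - i) (b - j).
Proof. by rewrite /coef2 coefsM coefs_sum; apply: eq_bigr => i _; rewrite coefsM. Qed.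

Fact cst2_zmod : zmod_morphism (@cst2 k).
Proof. by move=> a b; rewrite /cst2 !rmorphB. Qed.
HB.instance Definition _ := GRing.isZmodMorphism.Build k (ser2 k)
  (@cst2 k) cst2_zmod.
Fact cst2_monoid : monoid_morphism (@cst2 k).
Proof. by split=> [|a b]; rewrite /cst2 ?rmorph1 // !rmorphM. Qed.
HB.instance Definition _ := GRing.isMonoidMorphism.Build k (ser2 k)
  (@cst2 k) cst2_monoid.

Fact qcst_zmod : zmod_morphism (@qcst k).
Proof. by move=> a b; rewrite /qcst !rmorphB. Qed.
HB.instance Definition _ := GRing.isZmodMorphism.Build k (qser2 k)
  (@qcst k) qcst_zmod.
Fact qcst_monoid : monoid_morphism (@qcst k).
Proof. by split=> [|a b]; rewrite /qcst ?rmorph1 // !rmorphM. Qed.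
HB.instance Definition _ := GRing.isMonoidMorphism.Build k (qser2 k)
  (@qcst k) qcst_monoid.

Lemma coef2_cstM c f a b : coef2 (cst2 c * f) a b = c * coef2 f a b.
Proof. by rewrite /coef2 coefs_CM coefs_CM. Qed.

Lemma coef2_cst c a b : coef2 (cst2 c) a b = c *+ ((a == 0%N) && (b == 0%N)).
Proof. by case: a b => [|a] [|b]. Qed.

Lemma coef2_X1M f a b : coef2 (X1 * f) a b = if a is a'.+1 then coef2 f a' b else 0.
Proof.
have -> : X1 = @pserX (pseries k).
  by apply: ser2P => -[|[|i]] [|j].
by rewrite /coef2 coefs_XM; case: a.
Qed.

Lemma coef2_X2M f a b : coef2 (X2 * f) a b = if b is b'.+1 then coef2 f a b' else 0.
Proof.
have -> : X2 = pserC (@pserX k).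
  by apply: ser2P => -[|i] [|[|j]].
by rewrite /coef2 coefs_CM coefs_XM; case: b.
Qed.

Lemma coef2_X1XM f n a b :
  coef2 (X1 ^+ n * f) a b = if (n <= a)%N then coef2 f (a - n) b else 0.
Proof.
elim: n a => [|n IH] a; first by rewrite mul1r subn0.
by rewrite exprS -mulrA coef2_X1M; case: a => // a; rewrite IH.
Qed.

Lemma coef2_X2XM f n a b :
  coef2 (X2 ^+ n * f) a b = if (n <= b)%N then coef2 f a (b - n) else 0.
Proof.
elim: n b => [|n IH] b; first by rewrite mul1r subn0.
by rewrite exprS -mulrA coef2_X2M; case: b => // b; rewrite IH.
Qed.

Lemma coef2_1 a b : coef2 (1 : ser2 k) a b = ((a == 0%N) && (b == 0%N))%:R.
Proof. by rewrite -(rmorph1 (@cst2 k)) coef2_cst. Qed.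

Lemma coef2_mon i j a b :
  coef2 (X1 ^+ i * X2 ^+ j : ser2 k) a b = ((a == i) && (b == j))%:R.
Proof.
rewrite coef2_X1XM -[X2 ^+ j]mulr1 coef2_X2XM coef2_1.
by rewrite !subn_eq0 (eqn_leq a) (eqn_leq b); do 4! case: (_ <= _)%N.
Qed.

Lemma ser2_inv_ex f : coef2 f 0 0 != 0 -> exists g, g * f = 1.
Proof.
move=> f0.
have [|g gf] := @pser_inv_ex k (coefs f 0) (coef2 f 0 0)^-1.
  by rewrite mulVf.
exact: pser_inv_ex gf.
Qed.

(** Membership in the [n]-th power of the maximal ideal, the measure of every truncation error
    below. *)
Definition ordge n f := forall a b, (a + b < n)%N -> coef2 f a b = 0.

Lemma ordge_leq n m f : (n <= m)%N -> ordge m f -> ordge n f.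
Proof. by move=> nm mf a b ab; apply: mf; apply: leq_trans ab nm. Qed.
Lemma ordge_zero n : ordge n 0. Proof. by []. Qed.
Lemma ordgeD n f g : ordge n f -> ordge n g -> ordge n (f + g).
Proof. by move=> nf ng a b ab; rewrite coef2D nf ?ng ?addr0. Qed.
Lemma ordgeN n f : ordge n f -> ordge n (- f).
Proof. by move=> nf a b ab; rewrite coef2N nf ?oppr0. Qed.
Lemma ordgeB n f g : ordge n f -> ordge n g -> ordge n (f - g).
Proof. by move=> nf ng; apply: ordgeD => //; apply: ordgeN. Qed.
Lemma ordge_sum (I : Type) (s : seq I) (P : pred I) (F : I -> ser2 k) n :
  (forall i, P i -> ordge n (F i)) -> ordge n (\sum_(i <- s | P i) F i).
Proof. by move=> H; elim/big_ind: _ => //; apply: ordgeD. Qed.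
Lemma ordgeM m n f g : ordge m f -> ordge n g -> ordge (m + n) (f * g).
Proof.
move=> mf ng a b ab; rewrite coef2M big1 // => i _; rewrite big1 // => j _.
have [?|?] := ltnP (i + j) m; first by rewrite mf ?mul0r.
by rewrite ng ?mulr0 //; have := ltn_ord i; have := ltn_ord j; lia.
Qed.
Lemma ordgeMl n f g : ordge n f -> ordge n (f * g).
Proof. by move=> nf; rewrite -[n]addn0; apply: ordgeM. Qed.
Lemma ordgeMr n f g : ordge n f -> ordge n (g * f).
Proof. by rewrite mulrC; apply: ordgeMl. Qed.
Lemma ordgeX n f : ordge 1 f -> ordge n (f ^+ n).
Proof.
by move=> f1; elim: n => // n IH; rewrite exprS -add1n; apply: ordgeM.
Qed.
Lemma ordge_X1 : ordge 1 (X1 : ser2 k). Proof. by move=> [|a] [|b]. Qed.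
Lemma ordge_X2 : ordge 1 (X2 : ser2 k). Proof. by move=> [|a] [|b]. Qed.
Lemma ordge_eq f g : (forall n, ordge n (f - g)) -> f = g.
Proof.
move=> H; apply: ser2P => a b; apply/eqP; rewrite -subr_eq0 -coef2B.
by rewrite (H (a + b).+1).
Qed.

(** Monomials divisible by [X1] go to [r1], pure powers of [X2] to [r2]. Induction along this
    splitting bounds the image of an error from the images of [X1] and [X2] alone, with no
    continuity assumption. *)
Lemma ordge_split n r : ordge n.+1 r ->
  exists r1 r2, [/\ ordge n r1, ordge n r2 & r = X1 * r1 + X2 * r2].
Proof.
move=> nr; exists (mkser2 (fun a b => coef2 r a.+1 b)).
exists (mkser2 (fun a b => if a is 0%N then coef2 r 0 b.+1 else 0)); split.
- by move=> a b ab; rewrite /coef2 /= -[LHS]/(coef2 r _ _) nr.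
- by move=> [|a] b ab; rewrite /coef2 //= -[LHS]/(coef2 r _ _) nr.
apply: ser2P => a b; rewrite coef2D coef2_X1M coef2_X2M.
by case: a b => [|a] [|b]; rewrite ?addr0 ?add0r //; apply: nr.
Qed.

End Series2.

Notation bipoly k := {poly {poly k}}.

(** * Polynomials and substitutions *)

Section Evaluation.
Variables (k : fieldType) (A : comNzRingType) (c : {rmorphism k -> A}) (x y : A).

Definition ev1 : {poly k} -> A := horner_morph (fun a => mulrC y (c a)).
HB.instance Definition _ := GRing.RMorphism.on ev1.
(** The outer variable is evaluated at [x], the inner one at [y]. The target is left free so that
    one polynomial can be evaluated in [ser2 k], in [qser2 k] and, for composition, in
    polynomials. *)
Definition ev : bipoly k -> A := horner_morph (fun p => mulrC x (ev1 p)).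
HB.instance Definition _ := GRing.RMorphism.on ev.

Lemma evC a : ev a%:P%:P = c a.
Proof. by rewrite /ev horner_morphC /= /ev1 horner_morphC. Qed.
Lemma evX : ev 'X = x. Proof. by rewrite /ev horner_morphX. Qed.
Lemma evY : ev 'X%:P = y.
Proof. by rewrite /ev horner_morphC /= /ev1 horner_morphX. Qed.

Lemma ev1E (p : {poly k}) : ev1 p = \sum_(i < size p) c p`_i * y ^+ i.
Proof.
rewrite /ev1 /horner_morph (@horner_coef_wide _ (size p)) ?size_poly //.
by apply: eq_bigr => i _; rewrite coef_map.
Qed.
Lemma ev1C a : ev1 a%:P = c a.
Proof. by rewrite /ev1 horner_morphC. Qed.
Lemma ev1X : ev1 'X = y.
Proof. by rewrite /ev1 horner_morphX. Qed.
Lemma ev_ev1 (P : bipoly k) : ev P = \sum_(i < size P) ev1 P`_i * x ^+ i.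
Proof.
rewrite /ev /horner_morph (@horner_coef_wide _ (size P)) ?size_poly //.
by apply: eq_bigr => i _; rewrite coef_map.
Qed.

Lemma evE N M (P : bipoly k) :
  (forall i j, (N <= i)%N || (M <= j)%N -> P`_i`_j = 0) ->
  ev P = \sum_(i < N) \sum_(j < M) c P`_i`_j * (x ^+ i * y ^+ j).
Proof.
move=> H; rewrite /ev /horner_morph (@horner_coef_wide _ N); last first.
  apply: leq_trans (size_poly _ _) _; apply/leq_sizeP => i Ni.
  by apply/polyP => j; rewrite coef0 H // Ni.
apply: eq_bigr => i _; rewrite coef_map /= /ev1 /horner_morph.
rewrite (@horner_coef_wide _ M) ?mulr_suml.
  by apply: eq_bigr => j _; rewrite coef_map /=; ring.
apply: leq_trans (size_poly _ _) _; apply/leq_sizeP => j Mj.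
by rewrite H // Mj orbT.
Qed.

End Evaluation.

Lemma bipoly_ind (k : fieldType) (Q : bipoly k -> Prop) :
  (forall a, Q a%:P%:P) -> Q 'X -> Q 'X%:P ->
  (forall P P', Q P -> Q P' -> Q (P + P')) ->
  (forall P P', Q P -> Q P' -> Q (P * P')) -> forall P, Q P.
Proof.
move=> QC QX QY QD QM; elim/poly_ind => [|P p QP].
  by have := QC 0; rewrite !rmorph0.
apply: (QD); first exact: QM.
elim/poly_ind: p => [|p a Qp]; first by have := QC 0; rewrite !rmorph0.
by rewrite rmorphD rmorphM /=; apply: QD => //; apply: QM.
Qed.

Lemma ev_morph (k : fieldType) (A B : comNzRingType) (c : {rmorphism k -> A})
    (c' : {rmorphism k -> B}) (phi : {rmorphism A -> B}) x y P :
  (forall a, phi (c a) = c' a) -> phi (ev c x y P) = ev c' (phi x) (phi y) P.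
Proof.
move=> phic; elim/bipoly_ind: P => [a|||P P' IH IH'|P P' IH IH'].
- by rewrite !evC.
- by rewrite !evX.
- by rewrite !evY.
- by rewrite !rmorphD IH IH'.
by rewrite !rmorphM IH IH'.
Qed.

Lemma mulr_defect (A : comNzRingType) (s f g e p q : A) :
  s - f * g = (s - e) + (e - p * q) - (f - p) * g - p * (g - q).
Proof. by ring. Qed.

Lemma ev_comp (k : fieldType) (A : comNzRingType) (c : {rmorphism k -> A}) x y
    (Q1 Q2 P : bipoly k) :
  ev c x y (ev (@polyC {poly k} \o @polyC k) Q1 Q2 P) =
  ev c (ev c x y Q1) (ev c x y Q2) P.
Proof.
elim/bipoly_ind: P => [a|||P P' IH IH'|P P' IH IH'].
- by rewrite evC [RHS]evC; apply: evC.
- by rewrite evX [RHS]evX.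
- by rewrite evY [RHS]evY.
- by rewrite rmorphD [LHS]rmorphD [RHS]rmorphD; congr (_ + _).
by rewrite rmorphM [LHS]rmorphM [RHS]rmorphM; congr (_ * _).
Qed.

(** [J] only has to absorb values of polynomials, not all of [A]: besides a power of the maximal
    ideal it will be a set of large value in the field [qser2 k], which is no ideal there. *)
Lemma ev_congr (k : fieldType) (A : comNzRingType) (c : {rmorphism k -> A})
    (x y y' : A) (J : A -> Prop) (P : bipoly k) :
  J 0 -> (forall a b, J a -> J b -> J (a + b)) ->
  (forall Q a, J a -> J (ev c x y Q * a)) ->
  (forall Q a, J a -> J (ev c x y' Q * a)) ->
  J (y - y') -> J (ev c x y P - ev c x y' P).
Proof.
move=> J0 JD JM JM' Jy; elim/bipoly_ind: P => [a|||P P' IH IH'|P P' IH IH'].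
- by rewrite !evC subrr.
- by rewrite !evX subrr.
- by rewrite !evY.
- by rewrite !rmorphD opprD addrACA; apply: JD.
rewrite !rmorphM /=; set p := ev _ _ _ P; set p' := ev _ _ _ P'.
have -> : p * p' - ev c x y' P * ev c x y' P' =
  p * (p' - ev c x y' P') + ev c x y' P' * (p - ev c x y' P) by ring.
by apply: (JD); [apply: (JM)|apply: (JM')].
Qed.

Lemma ev_poly (k : fieldType) (A : comNzRingType) (c : {rmorphism k -> A}) x
    (a : {poly k}) (P : bipoly k) :
  ev c x (ev1 c x a) P = ev1 c x (ev (@polyC k) 'X a P).
Proof.
elim/bipoly_ind: P => [b|||P P' IH IH'|P P' IH IH'].
- by rewrite !evC; symmetry; apply: ev1C.
- by rewrite !evX; symmetry; apply: ev1X.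
- by rewrite !evY.
- by rewrite [LHS]rmorphD [in RHS]rmorphD [RHS]rmorphD; congr (_ + _).
by rewrite [LHS]rmorphM [in RHS]rmorphM [RHS]rmorphM; congr (_ * _).
Qed.

#[global] Opaque ev ev1.

Section Substitution.
Variable k : fieldType.
Implicit Types (f g r : ser2 k) (P : bipoly k).

Notation evs := (ev (@cst2 k)).

Lemma evsM g1 g2 P Q : evs g1 g2 (P * Q) = evs g1 g2 P * evs g1 g2 Q.
Proof. exact: rmorphM. Qed.
Lemma evsD g1 g2 P Q : evs g1 g2 (P + Q) = evs g1 g2 P + evs g1 g2 Q.
Proof. exact: rmorphD. Qed.
Lemma evsB g1 g2 P Q : evs g1 g2 (P - Q) = evs g1 g2 P - evs g1 g2 Q.
Proof. by apply/eqP; rewrite eq_sym subr_eq -evsD subrK. Qed.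
Lemma evs_comp g1 g2 Q1 Q2 P :
  evs g1 g2 (ev (@polyC {poly k} \o @polyC k) Q1 Q2 P) =
  evs (evs g1 g2 Q1) (evs g1 g2 Q2) P.
Proof. exact: ev_comp. Qed.

Lemma ser2_defect (s f g e p q : ser2 k) :
  s - f * g = (s - e) + (e - p * q) - (f - p) * g - p * (g - q).
Proof. exact: mulr_defect. Qed.

Definition trunc2 N f : bipoly k := \poly_(i < N) \poly_(j < N) coef2 f i j.

Lemma coef_trunc2 N f i j :
  (trunc2 N f)`_i`_j = if (i < N)%N && (j < N)%N then coef2 f i j else 0.
Proof. by rewrite coef_poly; case: ifP; rewrite ?coef0 // coef_poly. Qed.

Lemma bipoly_bound P :
  exists N, forall i j, (N <= i)%N || (N <= j)%N -> P`_i`_j = 0.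
Proof.
pose N := maxn (size P) (\max_(i < size P) size (P`_i)%R); exists N => i j.
have [iP|Pi] := ltnP i (size P); last by rewrite (nth_default 0 Pi) coef0.
move=> /orP [|] Nj; first by rewrite leqNgt (leq_trans iP) ?leq_maxl in Nj.
rewrite nth_default // (leq_trans _ Nj) // leq_max; apply/orP; right.
exact: (@leq_bigmax _ (fun i : 'I_(size P) => size P`_i) (Ordinal iP)).
Qed.

Lemma evs_bound N M g1 g2 P :
  (forall i j, (N <= i)%N || (M <= j)%N -> P`_i`_j = 0) ->
  evs g1 g2 P = \sum_(i < N) \sum_(j < M) cst2 P`_i`_j * (g1 ^+ i * g2 ^+ j).
Proof. exact: evE. Qed.

Lemma evsE g1 g2 P : exists N, evs g1 g2 P =
  \sum_(i < N) \sum_(j < N) cst2 P`_i`_j * (g1 ^+ i * g2 ^+ j).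
Proof. by have [N HN] := bipoly_bound P; exists N; apply: evs_bound. Qed.

Lemma coef2_evX P a b : coef2 (evs X1 X2 P) a b = P`_a`_b.
Proof.
have [N HN] := bipoly_bound P; rewrite (evs_bound _ _ HN) coef2_sum.
under eq_bigr do rewrite coef2_sum.
under eq_bigr do under eq_bigr do rewrite coef2_cstM coef2_mon.
have [aN|Na] := ltnP a N; last first.
  rewrite HN ?Na // big1 // => i _; rewrite big1 // => j _.
  by rewrite gtn_eqF ?mulr0 //; apply: leq_trans (ltn_ord i) Na.
rewrite (bigD1 (Ordinal aN)) //= [X in _ + X]big1 ?addr0; last first.
  move=> i ia; rewrite big1 // => j _; rewrite eq_sym.
  by rewrite -val_eqE /= in ia; rewrite (negPf ia) mulr0.
have [bN|Nb] := ltnP b N; last first.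
  rewrite HN ?Nb ?orbT // big1 // => j _.
  by rewrite eqxx gtn_eqF ?mulr0 //; apply: leq_trans (ltn_ord j) Nb.
rewrite (bigD1 (Ordinal bN)) //= !eqxx mulr1 big1 ?addr0 // => j jb.
by rewrite -val_eqE /= in jb; rewrite [b == _]eq_sym (negPf jb) mulr0.
Qed.

Lemma ordge_trunc2 N f : ordge N (f - evs X1 X2 (trunc2 N f)).
Proof.
move=> a b ab; rewrite coef2B coef2_evX coef_trunc2.
by rewrite !(leq_ltn_trans _ ab) ?leq_addr ?leq_addl // subrr.
Qed.

Section Local.
Variables g1 g2 : ser2 k.
Hypotheses (g1_1 : ordge 1 g1) (g2_1 : ordge 1 g2).

Lemma ordge_mon i j : ordge (i + j) (g1 ^+ i * g2 ^+ j).
Proof. by apply: ordgeM; apply: ordgeX. Qed.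

Lemma ordge_ev N P : (forall i j, (i + j < N)%N -> P`_i`_j = 0) ->
  ordge N (evs g1 g2 P).
Proof.
move=> H; have [M ->] := evsE g1 g2 P.
apply: ordge_sum => i _; apply: ordge_sum => j _.
have [ij|ij] := ltnP (i + j) N; first by rewrite H // rmorph0 mul0r.
by apply: ordgeMr; apply: ordge_leq ij _; apply: ordge_mon.
Qed.

Lemma coef2_subst2 f a b : coef2 (subst2 g1 g2 f) a b =
  \sum_(i < (a + b).+1) \sum_(j < (a + b).+1)
     coef2 f i j * coef2 (g1 ^+ i * g2 ^+ j) a b.
Proof. by []. Qed.

(** Since [g1 ^+ i * g2 ^+ j] has order at least [i + j], the sum defining a coefficient in total
    degree below [N] may be widened to all [i, j < N], and then it is the one for the truncated
    polynomial. *)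
Lemma ordge_subst2 N f : ordge N (subst2 g1 g2 f - evs g1 g2 (trunc2 N f)).
Proof.
move=> a b ab; rewrite coef2B (@evs_bound N N); last first.
  by move=> i j; rewrite coef_trunc2 (leqNgt N i) (leqNgt N j) -negb_and => /negPf ->.
rewrite coef2_subst2 coef2_sum.
under [X in _ - X]eq_bigr do rewrite coef2_sum.
apply/eqP; rewrite subr_eq0; apply/eqP.
have mon0 i j : (a + b < i + j)%N -> coef2 (g1 ^+ i * g2 ^+ j) a b = 0.
  exact: ordge_mon.
pose G i j := coef2 f i j * coef2 (g1 ^+ i * g2 ^+ j) a b.
rewrite (big_ord_widen N (fun i => \sum_(j < (a + b).+1) G i j) ab) big_mkcond /=.
apply: eq_bigr => i _; case: ltnP => [_|ni]; last first.
  by rewrite big1 // => j _; rewrite coef2_cstM mon0 ?mulr0 // ltn_addr.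
rewrite (big_ord_widen N (G i) ab) big_mkcond /=; apply: eq_bigr => j _.
rewrite coef2_cstM coef_trunc2 !ltn_ord /=; case: ltnP => // nj.
by rewrite mon0 ?mulr0 // ltn_addl.
Qed.

Lemma trunc2M N f g i j : (i < N)%N -> (j < N)%N ->
  (trunc2 N (f * g))`_i`_j = (trunc2 N f * trunc2 N g)`_i`_j.
Proof.
move=> iN jN; rewrite coef_trunc2 iN jN /= coefM coef_sum coef2M.
apply: eq_bigr => a _; rewrite coefM; apply: eq_bigr => b _.
have aN : (a < N)%N by apply: leq_ltn_trans iN; rewrite -ltnS.
have bN : (b < N)%N by apply: leq_ltn_trans jN; rewrite -ltnS.
by rewrite !coef_trunc2 aN bN !(leq_ltn_trans (leq_subr _ _)).
Qed.

(** The two proofs are arguments so that the ring morphism structure can be attached: [subst2] is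
    multiplicative only for series without constant term. *)
Definition substm (_ : ordge 1 g1) (_ : ordge 1 g2) := subst2 g1 g2.

Fact subst2_zmod : zmod_morphism (substm g1_1 g2_1).
Proof.
move=> f g; apply: ser2P => a b; rewrite coef2B /substm !coef2_subst2.
rewrite -sumrB; apply: eq_bigr => i _; rewrite -sumrB; apply: eq_bigr => j _.
by rewrite coef2B mulrBl.
Qed.
HB.instance Definition _ := GRing.isZmodMorphism.Build _ _
  (substm g1_1 g2_1) subst2_zmod.

Fact subst2_monoid : monoid_morphism (substm g1_1 g2_1).
Proof.
split=> [|f g]; apply: ordge_eq => N; rewrite /substm.
  have h := @ordge_subst2 N.+1 1.
  suff e : trunc2 N.+1 1 = 1 by rewrite e rmorph1 in h; apply: ordge_leq h.
  apply/polyP => i; apply/polyP => j; rewrite coef_trunc2 coef2_1 coef1.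
  by case: i j => [|i] [|j]; rewrite ?coef1 ?coef0 // ?if_same // !ltnS ?andbF.
(* The truncation of a product and the product of the truncations have the same coefficients for
   [i, j < N], so their difference only involves monomials of total degree at least [N]. *)
have hfg : ordge N (evs g1 g2 (trunc2 N (f * g)) -
    evs g1 g2 (trunc2 N f) * evs g1 g2 (trunc2 N g)).
  rewrite -evsM -evsB.
  by apply: ordge_ev => i j ij; rewrite !coefB trunc2M ?subrr //; lia.
rewrite (ser2_defect _ _ _ (evs g1 g2 (trunc2 N (f * g))) (evs g1 g2 (trunc2 N f)) (evs g1 g2 (trunc2 N g))).
apply: ordgeB; last by apply: ordgeMr; apply: ordge_subst2.
apply: ordgeB; last by apply: ordgeMl; apply: ordge_subst2.
by apply: ordgeD => //; apply: ordge_subst2.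
Qed.
HB.instance Definition _ := GRing.isMonoidMorphism.Build _ _
  (substm g1_1 g2_1) subst2_monoid.

Lemma subst2_ev f N : exists2 r, ordge N r &
  subst2 g1 g2 f = evs g1 g2 (trunc2 N f) + r.
Proof.
exists (subst2 g1 g2 f - evs g1 g2 (trunc2 N f)); first exact: ordge_subst2.
by rewrite addrC subrK.
Qed.

Lemma subst2_cst c : subst2 g1 g2 (cst2 c) = cst2 c.
Proof.
apply: ordge_eq => N; have h := @ordge_subst2 N.+1 (cst2 c).
suff e : trunc2 N.+1 (cst2 c) = c%:P%:P.
  by rewrite e evC in h; apply: ordge_leq h.
apply/polyP => i; apply/polyP => j; rewrite coef_trunc2 coef2_cst.
by case: i j => [|i] [|j]; rewrite !coefC /= ?coefC ?coef0 //= ?if_same.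
Qed.

Lemma subst2_X1 : subst2 g1 g2 X1 = g1.
Proof.
apply: ordge_eq => N; have h := @ordge_subst2 N.+2 X1.
suff e : trunc2 N.+2 X1 = 'X :> bipoly k.
  by rewrite e evX in h; apply: ordge_leq h; rewrite leqW.
apply/polyP => i; apply/polyP => j; rewrite coef_trunc2 coefX.
by case: i j => [|[|i]] [|j]; rewrite /= ?coef0 ?coef1 /coef2 //= ?if_same ?andbF.
Qed.

Lemma subst2_X2 : subst2 g1 g2 X2 = g2.
Proof.
apply: ordge_eq => N; have h := @ordge_subst2 N.+2 X2.
suff e : trunc2 N.+2 X2 = 'X%:P :> bipoly k.
  by rewrite e evY in h; apply: ordge_leq h; rewrite leqW.
apply/polyP => i; apply/polyP => j; rewrite coef_trunc2 coefC.
by case: i j => [|i] [|[|j]]; rewrite /= ?coefX ?coef0 /coef2 //= ?if_same.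
Qed.

End Local.

#[local] Opaque subst2 X1 X2 cst2.

Lemma morph_ordge (phi : {rmorphism ser2 k -> ser2 k}) n r :
  ordge 1 (phi X1) -> ordge 1 (phi X2) -> ordge n r -> ordge n (phi r).
Proof.
move=> h1 h2; elim: n r => // n IH r /ordge_split [r1 [r2 [/IH hr1 /IH hr2 ->]]].
by rewrite rmorphD !rmorphM -add1n; apply: ordgeD; apply: ordgeM.
Qed.

(** Both sides agree on polynomials, and [morph_ordge] makes [phi] automatically continuous, so they
    agree modulo every power of the maximal ideal. *)
Lemma subst2_uniq (phi : {rmorphism ser2 k -> ser2 k}) g1 g2 f :
  (forall c, phi (cst2 c) = cst2 c) -> phi X1 = g1 -> phi X2 = g2 ->
  ordge 1 g1 -> ordge 1 g2 -> phi f = subst2 g1 g2 f.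
Proof.
move=> phic e1 e2 h1 h2; apply: ordge_eq => N.
have [r Nr ->] := subst2_ev h1 h2 f N.
have := ev_morph X1 X2 (trunc2 N f) phic; rewrite e1 e2 => <-.
rewrite opprD addrA; apply: ordgeB => //.
have <- : phi (f - evs X1 X2 (trunc2 N f)) = phi f - phi (evs X1 X2 (trunc2 N f)).
  exact: raddfB.
by apply: morph_ordge; rewrite ?e1 ?e2 //; apply: ordge_trunc2.
Qed.

Lemma subst2_id f : subst2 X1 X2 f = f.
Proof.
symmetry; apply: (@subst2_uniq idfun) => //.
  exact: ordge_X1.
exact: ordge_X2.
Qed.

Section Morphism.
Variables g1 g2 : ser2 k.
Hypotheses (h1 : ordge 1 g1) (h2 : ordge 1 g2).

Lemma substD f g : subst2 g1 g2 (f + g) = subst2 g1 g2 f + subst2 g1 g2 g.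
Proof. exact: (raddfD (substm h1 h2)). Qed.
Lemma subst0 : subst2 g1 g2 0 = 0.
Proof. exact: (raddf0 (substm h1 h2)). Qed.
Lemma substN f : subst2 g1 g2 (- f) = - subst2 g1 g2 f.
Proof. by apply/eqP; rewrite -addr_eq0 -substD addNr subst0. Qed.
Lemma substB f g : subst2 g1 g2 (f - g) = subst2 g1 g2 f - subst2 g1 g2 g.
Proof. by rewrite substD substN. Qed.
Lemma substM f g : subst2 g1 g2 (f * g) = subst2 g1 g2 f * subst2 g1 g2 g.
Proof. exact: (rmorphM (substm h1 h2)). Qed.
Lemma subst_1 : subst2 g1 g2 1 = 1.
Proof. exact: (rmorph1 (substm h1 h2)). Qed.
Lemma substX f n : subst2 g1 g2 (f ^+ n) = subst2 g1 g2 f ^+ n.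
Proof. by elim: n => [|n IH]; rewrite ?subst_1 // !exprS substM IH. Qed.

Lemma ordge_subst n r : ordge n r -> ordge n (subst2 g1 g2 r).
Proof.
by apply: (@morph_ordge (substm h1 h2)); rewrite /= /substm ?subst2_X1 ?subst2_X2.
Qed.

Lemma subst2_evs a b P :
  subst2 g1 g2 (evs a b P) = evs (subst2 g1 g2 a) (subst2 g1 g2 b) P.
Proof.
by apply: (ev_morph (phi := substm h1 h2)) => c; apply: subst2_cst.
Qed.

End Morphism.

Lemma subst2_comp a b g1 g2 f :
  ordge 1 a -> ordge 1 b -> ordge 1 g1 -> ordge 1 g2 ->
  subst2 a b (subst2 g1 g2 f) = subst2 (subst2 a b g1) (subst2 a b g2) f.
Proof.
move=> ha hb h1 h2.
apply: (@subst2_uniq (substm ha hb \o substm h1 h2)).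
- by move=> c; rewrite /= /substm !subst2_cst.
- by rewrite -[LHS]/(subst2 a b (subst2 g1 g2 X1)) subst2_X1.
- by rewrite -[LHS]/(subst2 a b (subst2 g1 g2 X2)) subst2_X2.
- exact: ordge_subst.
exact: ordge_subst.
Qed.

End Substitution.

(** * The lexicographic minimum as a function on series *)

Definition lexpos (B : Z2) : bool := vlt (Some 0) (Some B).

Lemma lexposE B : lexpos B = (0 < B.1) || ((B.1 == 0) && (0 < B.2)).
Proof. by rewrite /lexpos vltNge /= lexleE; case: B => a b /=; lia. Qed.

Lemma lexpos_ge0 B n : lexpos B -> lexle 0 (B *+ n).
Proof. by move=> Bp; apply: lexle_muln. Qed.

Section LexMin.
Variables (k : fieldType) (B1 B2 : Z2).
Implicit Types (f g : ser2 k) (c : Z2) (x : option Z2).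

Definition lm f : option Z2 :=
  if pselect (exists c, is_lexmin B1 B2 f c) is left e
  then Some (projT1 (cid e)) else None.

Lemma lmP f c : lm f = Some c <-> is_lexmin B1 B2 f c.
Proof.
have uniq c1 c2 : is_lexmin B1 B2 f c1 -> is_lexmin B1 B2 f c2 -> c1 = c2.
  move=> [[a1 [b1 [n1 e1]]] m1] [[a2 [b2 [n2 e2]]] m2].
  have l1 := m1 _ _ n2; have l2 := m2 _ _ n1; rewrite -e2 in l1; rewrite -e1 in l2.
  exact: (congr1 (odflt 0) (@vle_anti (Some c1) (Some c2) l1 l2)).
rewrite /lm; case: pselect => [e|ne]; last by split=> // h; case: ne; exists c.
split=> [/(congr1 (odflt 0)) /= <-|h]; first exact: projT2 (cid e).
by congr Some; apply: uniq h; apply: projT2 (cid e).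
Qed.

Hypotheses (B1pos : lexpos B1) (B2pos : lexpos B2).

(** [Z2] is not well ordered and the second components may be negative, so the minimum is taken in
    two rounds: first the nonnegative first component, then, at that level, the second component
    shifted to be nonnegative. *)
Lemma lexmin_ex f : f != 0 -> exists c, is_lexmin B1 B2 f c.
Proof.
move=> f0; pose V a b := B1 *+ a + B2 *+ b.
have [a0 [b0 ab0]] : exists a b, coef2 f a b != 0.
  apply: contrapT => h; case/eqP: f0; apply: ser2P => a b; rewrite coef20.
  by apply: contrapT => /eqP ab; apply: h; exists a, b.
have VE a b : V a b = (B1.1 * a + B2.1 * b, B1.2 * a + B2.2 * b).
  by rewrite /V !Z2mulrn.
(* With this [N] both [B1.2 + N * B1.1] and [B2.2 + N * B2.1] are nonnegative, which bounds the
   second component from below once the first is fixed. *)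
pose N : int := `|B1.2| + `|B2.2|.
have [V1 V2] : (forall a b, 0 <= (V a b).1) /\
    (forall a b, 0 <= (V a b).2 + N * (V a b).1).
  move: B1pos B2pos; rewrite !lexposE => p1 p2; split=> a b; rewrite VE /=.
    by apply: addr_ge0; apply: mulr_ge0; lia.
  have -> : B1.2 * a + B2.2 * b + N * (B1.1 * a + B2.1 * b) =
    (B1.2 + N * B1.1) * a + (B2.2 + N * B2.1) * b by ring.
  have N0 : 0 <= N by rewrite addr_ge0 ?normr_ge0.
  have aux (x y : int) : `|y| <= N -> (0 < x) || ((x == 0) && (0 < y)) ->
      0 <= y + N * x.
    move=> yN /orP [x0|/andP [/eqP -> y0]]; last by rewrite mulr0; lia.
    have : N <= N * x by rewrite ler_peMr //; lia.
    by lia.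
  by apply: addr_ge0; apply: mulr_ge0 => //; apply: aux => //; rewrite /N; lia.
pose Q1 n := `[< exists a b, coef2 f a b != 0 /\ (V a b).1 = n%:Z >].
have ex1 : exists n, Q1 n.
  exists `|(V a0 b0).1|%N; apply/asboolP; exists a0, b0; split=> //.
  by rewrite gez0_abs.
case: (ex_minnP ex1) => n1 /asboolP [a1 [b1 [ab1 n1E]]] min1.
pose Q2 n := `[< exists a b, [/\ coef2 f a b != 0, (V a b).1 = n1%:Z &
  (V a b).2 + N * (V a b).1 = n%:Z] >].
have ex2 : exists n, Q2 n.
  exists `|((V a1 b1).2 + N * (V a1 b1).1)%R|%N; apply/asboolP; exists a1, b1.
  by split=> //; rewrite gez0_abs.
case: (ex_minnP ex2) => n2 /asboolP [a2 [b2 [ab2 n1E2 n2E]]] min2.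
exists (V a2 b2); split; first by exists a2, b2.
move=> a b ab; rewrite -/(V a b) lexleE.
have le1 : (n1 <= `|(V a b).1|)%N.
  by apply: min1; apply/asboolP; exists a, b; split=> //; rewrite gez0_abs.
have := V1 a b => Vab.
have [lt1|eq1] : (V a2 b2).1 < (V a b).1 \/ (V a b).1 = n1%:Z by lia.
  by rewrite lt1.
have := min2 `|((V a b).2 + N * (V a b).1)%R|%N; have := V2 a b => V2ab.
have -> : Q2 `|((V a b).2 + N * (V a b).1)%R|%N.
  by apply/asboolP; exists a, b; split=> //; rewrite gez0_abs.
move=> /(_ isT) le2; rewrite n1E2 eq1 eqxx ltxx /=.
rewrite n1E2 in n2E; rewrite eq1 in V2ab le2.
by rewrite -(lerD2r (N * n1)) n2E -[leRHS]gez0_abs // lez_nat.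
Qed.

Lemma lm_neq0 f : f != 0 -> exists c, lm f = Some c.
Proof. by move=> /lexmin_ex [c hc]; exists c; apply/lmP. Qed.

Lemma le_lm x f : vle x (lm f) <->
  forall a b, coef2 f a b != 0 -> vle x (Some (B1 *+ a + B2 *+ b)).
Proof.
split=> [h a b ab|h].
  apply: vle_trans h _; case E: (lm f) => [c|].
    by have /lmP [_] := E; apply.
  have [|c] := @lm_neq0 f; last by rewrite E.
  by apply/eqP => f0; rewrite f0 eqxx in ab.
case E: (lm f) => [c|]; last exact: vle_None.
by have /lmP [[a [b [ab ->]]] _] := E; apply: h.
Qed.

Lemma lm_coef f a b : coef2 f a b != 0 -> vle (lm f) (Some (B1 *+ a + B2 *+ b)).
Proof. by move: a b; apply/le_lm; apply: vle_refl. Qed.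

Lemma lm0 : lm 0 = None.
Proof.
by case E: (lm 0) => [c|] //; have /lmP [[a [b []]]] := E; rewrite coef20 eqxx.
Qed.

Lemma lm_None f : lm f = None <-> f = 0.
Proof.
split=> [h|->]; last exact: lm0.
by apply: contrapT => /eqP /lm_neq0 [c]; rewrite h.
Qed.

Lemma lmN f : lm (- f) = lm f.
Proof.
have H g : vle (lm g) (lm (- g)).
  by apply/le_lm => a b; rewrite coef2N oppr_eq0; apply: lm_coef.
by apply: vle_anti => //; have := H (- f); rewrite opprK.
Qed.

Lemma lmD f g : vle (vmin (lm f) (lm g)) (lm (f + g)).
Proof.
apply/le_lm => a b; have [f0|f0] := eqVneq (coef2 f a b) 0.
  rewrite coef2D f0 add0r => /lm_coef; apply: vle_trans; exact: vmin_ler.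
by move=> _; apply: vle_trans (lm_coef f0); apply: vmin_lel.
Qed.

Lemma lm_geD x f g : vle x (lm f) -> vle x (lm g) -> vle x (lm (f + g)).
Proof. by move=> cx cy; apply: vle_trans (lmD f g); apply: vle_min. Qed.

Lemma lm_addl f g : vlt (lm f) (lm g) -> lm (f + g) = lm f.
Proof.
move=> fg; apply: vle_anti; last first.
  by apply: vle_trans (lmD f g); apply: vle_min; [apply: vle_refl|apply: vltW].
apply: contraT => h; have {}h : vlt (lm f) (lm (f + g)) by [].
have := lmD (f + g) (- g); rewrite addrK lmN => h'.
by have := vlt_le_trans (vlt_minr h fg) h'; rewrite vltNge vle_refl.
Qed.

Lemma lmM_ge f g : vle (vadd (lm f) (lm g)) (lm (f * g)).
Proof.
apply/le_lm => a b ab.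
have [i [j [ij gij]]] : exists (i : 'I_a.+1) (j : 'I_b.+1),
    coef2 f i j != 0 /\ coef2 g (a - i) (b - j) != 0.
  apply: contrapT => h; case/eqP: ab; rewrite coef2M big1 // => i _.
  rewrite big1 // => j _; apply/eqP; rewrite mulf_eq0.
  case: eqVneq => //= f0; case: eqVneq => //= g0.
  by case: h; exists i, j.
have -> : Some (B1 *+ a + B2 *+ b) =
  vadd (Some (B1 *+ i + B2 *+ j)) (Some (B1 *+ (a - i) + B2 *+ (b - j))).
  rewrite /= addrACA -!mulrnDr !subnKC //; rewrite -ltnS //.
by apply: vleD; apply: lm_coef.
Qed.

Lemma lm_ordge lam n f : lexpos lam -> lexle lam B1 -> lexle lam B2 ->
  ordge n f -> vle (Some (lam *+ n)) (lm f).
Proof.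
move=> lp l1 l2 nf; apply/le_lm => a b ab.
have nab : (n <= a + b)%N by rewrite leqNgt; apply: contraNN ab => /nf ->.
have mon c d m : lexle c d -> lexle (c *+ m) (d *+ m).
  move=> cd; elim: m => [|m IH]; first exact: (vle_refl (Some 0)).
  by rewrite !mulrS; apply: lexleD.
rewrite /=; apply: (@vle_trans (Some (lam *+ (a + b))) (Some _) (Some _)).
  rewrite -(subnKC nab) mulrnDr -[X in vle (Some X)]addr0.
  by apply: lexleD; [exact: (vle_refl (Some _))|apply: lexpos_ge0].
by rewrite mulrnDr /=; apply: lexleD; apply: mon.
Qed.

Lemma lm_ge0 f : vle (Some 0) (lm f).
Proof.
apply/le_lm => a b _; rewrite -[X in vle (Some X)]addr0.
by apply: lexleD; apply: lexpos_ge0.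
Qed.

Lemma lm_mon f a b : (forall i j, coef2 f i j != 0 -> i = a /\ j = b) ->
  coef2 f a b != 0 -> lm f = Some (B1 *+ a + B2 *+ b).
Proof.
move=> H ab; apply/lmP; split; first by exists a, b.
move=> i j /H [-> ->]; exact: (vle_refl (Some _)).
Qed.

Lemma lm_cst (c : k) : c != 0 -> lm (cst2 c) = Some 0.
Proof.
move=> c0; rewrite (@lm_mon _ 0 0) ?addr0 ?coef2_cst //.
by move=> [|i] [|j]; rewrite coef2_cst ?mulr0n ?eqxx.
Qed.

Lemma lm_X2 : lm X2 = Some B2.
Proof.
rewrite (@lm_mon _ 0 1) ?add0r // /coef2 /= ?oner_eq0 //.
by move=> [|i] [|[|j]]; rewrite /= ?eqxx.
Qed.

Hypothesis inj : forall a b i j : nat,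
  B1 *+ a + B2 *+ b = B1 *+ i + B2 *+ j -> a = i /\ b = j.

(** By [inj] each factor has a single monomial of minimal value. In the coefficient of the product
    of these two monomials every other term vanishes: its two values would be at least [c] and [d]
    with sum [c + d], hence equal to them. *)
Lemma lmM f g : lm (f * g) = vadd (lm f) (lm g).
Proof.
case Ef: (lm f) => [c|]; last by move/lm_None: Ef => ->; rewrite mul0r lm0.
case Eg: (lm g) => [d|]; last by move/lm_None: Eg => ->; rewrite mulr0 lm0.
apply: vle_anti; last by have := lmM_ge f g; rewrite Ef Eg.
have /lmP [[a [b [fab cE]]] minf] := Ef; have /lmP [[a' [b' [gab dE]]] ming] := Eg.
have -> : vadd (Some c) (Some d) = Some (B1 *+ (a + a') + B2 *+ (b + b')).
  by rewrite /= cE dE addrACA -!mulrnDr.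
apply: lm_coef; rewrite coef2M.
have al : (a < (a + a').+1)%N by rewrite ltnS leq_addr.
have bl : (b < (b + b').+1)%N by rewrite ltnS leq_addr.
have other (i : 'I_(a + a').+1) (j : 'I_(b + b').+1) :
   (i != Ordinal al) || (j != Ordinal bl) ->
   coef2 f i j * coef2 g (a + a' - i) (b + b' - j) = 0.
  rewrite -!val_eqE /= => ij; apply/eqP; rewrite mulf_eq0; apply: contraT.
  rewrite negb_or => /andP [/minf l1 /ming l2].
  have ia : (i <= a + a')%N by rewrite -ltnS.
  have jb : (j <= b + b')%N by rewrite -ltnS.
  have e : (B1 *+ i + B2 *+ j) + (B1 *+ (a + a' - i) + B2 *+ (b + b' - j)) = c + d.
    by rewrite cE dE addrACA [RHS]addrACA -!mulrnDr !subnKC.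
  have [eqc|ltc] := @vle_eqVlt (Some c) (Some _) l1.
    have ec := congr1 (odflt 0) eqc; rewrite /= cE in ec.
    by have [ia' jb'] := inj ec; rewrite -ia' -jb' !eqxx in ij.
  case/negP: (ltc : ~~ vle _ _); rewrite /= -(lexle_add2r (B1 *+ (a + a' - i) + B2 *+ (b + b' - j))) e.
  by apply: lexleD => //; exact: (vle_refl (Some c)).
rewrite (bigD1 (Ordinal al)) //= [X in _ + X]big1 ?addr0; last first.
  by move=> i ia; rewrite big1 // => j _; rewrite other // ia.
rewrite (bigD1 (Ordinal bl)) //= big1 ?addr0; last first.
  by move=> j jb; apply: (other (Ordinal al)); rewrite jb orbT.
by rewrite !addKn mulf_neq0.
Qed.

End LexMin.

(** * Weierstrass preparation *)

Section Weierstrass.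
Variable k : fieldType.
Implicit Types (f g F G : ser2 k) (t : pseries k).

Lemma coefs_XnM (R : comNzRingType) (f : pseries R) n i :
  coefs (pserX R ^+ n * f) i = if (n <= i)%N then coefs f (i - n) else 0.
Proof.
elim: n i => [|n IH] i; first by rewrite mul1r subn0.
by rewrite exprS -mulrA coefs_XM; case: i => // i; rewrite IH.
Qed.

Definition pser_shift d t : pseries k := PSeries (fun n => coefs t (n + d)).
Definition pser_low d t : pseries k :=
  PSeries (fun n => if (n < d)%N then coefs t n else 0).

Lemma pser_splitE d t : t = pserX k ^+ d * pser_shift d t + pser_low d t.
Proof.
apply: pseriesP => n; rewrite coefsD coefs_XnM /=; case: leqP => nd.
  by rewrite subnK // addr0.
by rewrite add0r.
Qed.

Definition X2regular d F :=
  (forall j, (j < d)%N -> coef2 F 0 j = 0) /\ coef2 F 0 d != 0.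

(** Powers of [X1] are treated one at a time, with coefficients in [k[[X2]]]. The coefficient of
    [X1 ^+ 0] in [F] is [X2 ^+ d] times a unit with inverse [e'], so the [n]-th defect determines
    [u n], and its terms of degree below [d] form the remainder. *)
Lemma weierstrass_division d F G : X2regular d F ->
  exists q r, G = q * F + r /\ forall a b, (d <= b)%N -> coef2 r a b = 0.
Proof.
move=> [Flow Fd].
have [|e' e'e] := @pser_inv_ex k (pser_shift d (coefs F 0)) (coef2 F 0 d)^-1.
  by rewrite mulVf.
have F0E : coefs F 0 = pserX k ^+ d * pser_shift d (coefs F 0).
  rewrite {1}[LHS](pser_splitE d) (_ : pser_low d _ = 0) ?addr0 //.
  by apply: pseriesP => j /=; case: ifP => // /Flow.
have [|u uE] := @course_rec (pseries k) 0 (fun n u => e' * pser_shift d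
    (coefs G n - \sum_(i < n) u i * coefs F (n - i))).
  move=> n u u' uu'; congr (_ * pser_shift d (_ - _)).
  by apply: eq_bigr => i _; rewrite uu'.
exists (PSeries u), (PSeries (fun n => pser_low d
  (coefs G n - \sum_(i < n) u i * coefs F (n - i)))); split; last first.
  by move=> a b db; rewrite /coef2 /= ltnNge db.
apply: pseriesP => n; rewrite coefsD coefsM big_ord_recr subnn.
have F0u : pser_shift d (coefs F 0) * (e' * pser_shift d
    (coefs G n - \sum_(i < n) u i * coefs F (n - i))) =
    pser_shift d (coefs G n - \sum_(i < n) u i * coefs F (n - i)).
  by rewrite mulrA [_ * e']mulrC e'e mul1r.
rewrite [coefs (PSeries u) _]uE [X in _ + X + _]mulrC {1}F0E -mulrA F0u.
by rewrite -addrA -[_ + coefs (PSeries _) n]pser_splitE addrC subrK.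
Qed.

(** Extracting the largest power of [X1] leaves a series that is nonzero at [X1 = 0]; no preliminary
    change of coordinates is made. *)
Lemma X2regular_ex F : F != 0 ->
  exists n d F', F = X1 ^+ n * F' /\ X2regular d F'.
Proof.
move=> F0.
have ex : exists n, `[< exists b, coef2 F n b != 0 >].
  apply: contrapT => h; case/eqP: F0; apply: ser2P => a b; rewrite coef20.
  apply: contrapT => /eqP ab; apply: h; exists a; apply/asboolP; by exists b.
case: (ex_minnP ex) => n /asboolP exb minn.
case: (ex_minnP exb) => d nd mind.
exists n, d, (mkser2 (fun a b => coef2 F (a + n) b)); split; last first.
  split=> [j jd|]; rewrite /coef2 /= add0n -/(coef2 _ _ _) //.
  by apply: contraTeq jd => /mind; rewrite leqNgt.
apply: ser2P => a b; rewrite coef2_X1XM; case: leqP => na.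
  by rewrite {2}/coef2 /= subnK.
apply: contraTeq na => ab; rewrite -leqNgt; apply: minn.
by apply/asboolP; exists b.
Qed.

Lemma ser2_unit f : coef2 f 0 0 != 0 -> f \is a GRing.unit.
Proof. by move=> /ser2_inv_ex [g gf]; apply/unitrPr; exists g; rewrite mulrC. Qed.

(* [q * F] is then the Weierstrass polynomial [X2 ^+ d - r] of [F]. *)
Lemma weierstrass_preparation d F : X2regular d F ->
  exists2 q, q \is a GRing.unit &
    forall a b, (d < b)%N -> coef2 (q * F) a b = 0.
Proof.
move=> Freg; have [q [r [dE r0]]] := @weierstrass_division d F (X2 ^+ d) Freg.
have X2dE a b : coef2 (X2 ^+ d : ser2 k) a b = ((a == 0%N) && (b == d))%:R.
  by have := coef2_mon k 0 d a b; rewrite mul1r.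
have [Flow Fd] := Freg.
exists q; last first.
  move=> a b db; have -> : q * F = X2 ^+ d - r by rewrite dE addrK.
  by rewrite coef2B X2dE (gtn_eqF db) andbF r0 ?subr0 // ltnW.
apply: ser2_unit; apply/eqP => q0.
have := X2dE 0%N d; rewrite dE coef2D r0 // addr0 !eqxx coef2M big_ord1.
rewrite big_ord_recl /= q0 mul0r add0r big1 => [/esym/eqP|j _].
  by rewrite oner_eq0.
by rewrite Flow ?mulr0 //= /bump; have := ltn_ord j; lia.
Qed.

End Weierstrass.

(* [phi] induces a map from [Frac R ^*] onto [Frac S ^*] modulo the units of
   [S]. *)
Definition surj_mod_units (R S : idomainType) (phi : R -> S) := forall F : S,
  F != 0 -> exists A B U, [/\ B != 0, U \is a GRing.unit & phi A = F * U * phi B].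

(** Numerator and denominator of [F] are themselves quotients of [iota]-images up to units, and
    [phi] sends units to units. Injectivity keeps the new denominator nonzero. *)
Lemma surj_mod_units_comp (R S T : idomainType) (iota : {rmorphism R -> S})
    (phi : {rmorphism S -> T}) :
  (forall x, iota x = 0 -> x = 0) -> (forall x, phi x = 0 -> x = 0) ->
  surj_mod_units iota -> surj_mod_units phi -> surj_mod_units (phi \o iota).
Proof.
move=> iota0 phi0 Hi Hp F F0; have [G [H [U [H0 Uu GE]]]] := Hp F F0.
have nz (R' S' : idomainType) (f : {rmorphism R' -> S'}) x :
  (forall x, f x = 0 -> x = 0) -> x != 0 -> f x != 0.
  by move=> f0; apply: contra_neq => /f0.
have U0 : U != 0 by apply: contraTneq Uu => ->; rewrite unitr0.
have G0 : G != 0.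
  apply: contra_neq (F0) => G0; move: GE; rewrite G0 rmorph0 => /esym/eqP.
  by rewrite !mulf_eq0 (negPf U0) (negPf (nz _ _ _ _ phi0 H0)) !orbF => /eqP.
have [A [B [U1 [B0 U1u AE]]]] := Hi G G0.
have [A' [B' [U2 [B'0 U2u A'E]]]] := Hi H H0.
have U20 : U2 != 0 by apply: contraTneq U2u => ->; rewrite unitr0.
exists (A * B'), (A' * B), (U * phi U1 / phi U2); split.
- rewrite mulf_neq0 //; apply: contra_neq (H0) => A'0; move: A'E.
  rewrite A'0 rmorph0 => /esym/eqP.
  by rewrite !mulf_eq0 (negPf U20) (negPf (nz _ _ _ _ iota0 B'0)) !orbF => /eqP.
- by rewrite !unitrM Uu unitrV !rmorph_unit.
rewrite /= !rmorphM AE A'E !rmorphM GE /=.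
have pU : phi U2 * (phi U2)^-1 = 1 by rewrite divrr // rmorph_unit.
transitivity (F * U * phi H * phi U1 * phi (iota B) * phi (iota B') *
  (phi U2 * (phi U2)^-1)); first by rewrite pU; ring.
by ring.
Qed.

(** * Blowing-ups and shifts on series *)

Section BlowUp.
Variable k : fieldType.
Implicit Types f g F t G : ser2 k.

Lemma ordge_X1X2 : ordge 1 (X1 * X2 : ser2 k).
Proof. by apply: ordgeMl; apply: ordge_X1. Qed.

Lemma coef2_blow f a b :
  coef2 (subst2 X1 (X1 * X2) f) a b = if (b <= a)%N then coef2 f (a - b) b else 0.
Proof.
rewrite coef2_subst2.
have E i j : coef2 (X1 ^+ i * (X1 * X2) ^+ j : ser2 k) a b =
    ((a == (i + j)%N) && (b == j))%:R.
  by rewrite exprMn mulrA -exprD coef2_mon.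
under eq_bigr do under eq_bigr do rewrite E.
case: leqP => ab; last first.
  rewrite big1 // => i _; rewrite big1 // => j _.
  by case: eqP => /= [aE|]; rewrite ?mulr0 // gtn_eqF ?mulr0 //; lia.
have ia : (a - b < (a + b).+1)%N by lia.
have jb : (b < (a + b).+1)%N by lia.
rewrite (bigD1 (Ordinal ia)) //= [X in _ + X]big1 ?addr0; last first.
  move=> i; rewrite -val_eqE /= => ni; rewrite big1 // => j _.
  case: eqP => /= [aE|]; rewrite ?mulr0 //.
  by case: eqP => [bE|]; rewrite ?mulr0 //; lia.
rewrite (bigD1 (Ordinal jb)) //= subnK // !eqxx mulr1 big1 ?addr0 // => j.
by rewrite -val_eqE /= eq_sym => /negPf ->; rewrite andbF mulr0.
Qed.

Lemma blow_inj f : subst2 X1 (X1 * X2) f = 0 -> f = 0.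
Proof.
move=> f0; apply: ser2P => a b; have := coef2_blow f (a + b) b.
by rewrite f0 leq_addl addnK.
Qed.

(** The image of the substitution consists of the series supported on [b <= a]. Weierstrass
    preparation bounds the degree in [X2] by [d] after multiplication by a unit, and [X1 ^+ d] then
    moves the whole support into that region. *)
Lemma blow_surj : surj_mod_units (subst2 (X1 : ser2 k) (X1 * X2)).
Proof.
move=> F /X2regular_ex [n [d [F' [-> /weierstrass_preparation [q qu qF]]]]].
pose G : ser2 k := mkser2 (fun a b =>
  if (b <= d)%N && (d <= a + b)%N then coef2 (q * F') (a + b - d) b else 0).
have GE : X1 ^+ d * (q * F') = subst2 X1 (X1 * X2) G.
  apply: ser2P => a b; rewrite coef2_X1XM coef2_blow {2}/coef2 /=.
  have [db|bd] := ltnP d b; first by rewrite qF // !if_same.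
  by case: (leqP b a) => ba; [rewrite subnK|case: leqP => //; lia].
have h1 := @ordge_X1 k; have h2 := ordge_X1X2.
exists (X1 ^+ n * G), (X1 ^+ d), q; split=> //.
  by rewrite expf_neq0 //; apply/eqP => /(congr1 (fun f => coef2 f 1 0)) /eqP;
    rewrite coef20 oner_eq0.
rewrite substM // !substX // !subst2_X1 // -GE.
by rewrite -!mulrA; congr (_ * _); rewrite mulrC [q * _]mulrC -mulrA.
Qed.

Lemma cst2_0 : cst2 0 = 0 :> ser2 k. Proof. exact: rmorph0. Qed.

Lemma subst2_X1only t G : (forall a b, (0 < b)%N -> coef2 t a b = 0) ->
  ordge 1 G -> subst2 X1 G t = t.
Proof.
move=> t0 hG; apply: ordge_eq => N; have h1 := @ordge_X1 k.
have [r Nr ->] := subst2_ev h1 hG t N.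
have -> : ev (@cst2 k) X1 G (trunc2 N t) = ev (@cst2 k) X1 X2 (trunc2 N t).
  have bd i j : (N <= i)%N || (N <= j)%N -> (trunc2 N t)`_i`_j = 0.
    by rewrite coef_trunc2 (leqNgt N i) (leqNgt N j) -negb_and => /negPf ->.
  rewrite !(evs_bound _ _ bd); apply: eq_bigr => i _; apply: eq_bigr => j _.
  case: (posnP j) => [->|j0]; first by rewrite !expr0.
  have zero f : cst2 0 * f = 0 :> ser2 k by rewrite cst2_0 mul0r.
  rewrite coef_trunc2 (t0 _ _ j0) if_same.
  by transitivity (0 : ser2 k); [apply: zero|symmetry; apply: zero].
set E := ev _ _ _ _; have -> : E + r - t = r - (t - E).
  by rewrite opprB addrCA addrA.
by apply: ordgeB => //; apply: ordge_trunc2.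
Qed.

Lemma surj_mod_units_bij (phi psi : {rmorphism ser2 k -> ser2 k}) :
  cancel psi phi -> surj_mod_units phi.
Proof.
move=> psiK F F0; exists (psi F), 1, 1.
by rewrite oner_neq0 unitr1 psiK !rmorph1 !mulr1.
Qed.

End BlowUp.

(** * Invariants of stages and the moves between them *)

Section Stages.
Variable k : fieldType.
Notation evs := (ev (@cst2 k)).
Notation evK := (ev (@qcst k)).
Notation iota s := (subst2 (f1 s) (f2 s)).

Lemma tofrac_evs P : tofrac (evs X1 X2 P) = evK (tofrac X1) (tofrac X2) P.
Proof. exact: (ev_morph (phi := @FracField.tofrac (ser2 k))). Qed.

(** A [stage] by itself does not tie [y1], [y2] to [f1], [f2]; [stage_poly] is that tie, with the
    same [Q] in the field and in the series ring. [stage_surj] serves only to exclude ramification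
    at the end. *)
Record stage_inv (s : stage k) : Prop := StageInv {
  stage_ordge1 : ordge 1 (f1 s);
  stage_ordge2 : ordge 1 (f2 s);
  stage_inj : forall f, iota s f = 0 -> f = 0;
  stage_poly : forall P, exists2 Q, tofrac (evs X1 X2 P) = evK (y1 s) (y2 s) Q
    & iota s (evs X1 X2 P) = evs X1 X2 Q;
  stage_surj : surj_mod_units (iota s)
}.

Lemma stage_inv0 : stage_inv (stage0 k).
Proof.
split=> /=; [exact: ordge_X1|exact: ordge_X2|by move=> f; rewrite subst2_id| |].
  by move=> P; exists P; rewrite ?subst2_id // tofrac_evs.
by move=> F F0; exists F, 1, 1; rewrite !subst2_id oner_neq0 unitr1 !mulr1.
Qed.

Lemma stage_inv_change s z1 z2 g1 g2 Q1 Q2 :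
  stage_inv s -> ordge 1 g1 -> ordge 1 g2 ->
  y1 s = evK z1 z2 Q1 -> g1 = evs X1 X2 Q1 ->
  y2 s = evK z1 z2 Q2 -> g2 = evs X1 X2 Q2 ->
  (forall f, subst2 g1 g2 f = 0 -> f = 0) -> surj_mod_units (subst2 g1 g2) ->
  stage_inv (change s z1 z2 g1 g2).
Proof.
move=> [h1 h2 si sp su] hg1 hg2 y1E g1E y2E g2E gi gu.
have comp f : subst2 (subst2 g1 g2 (f1 s)) (subst2 g1 g2 (f2 s)) f =
    subst2 g1 g2 (iota s f) by rewrite subst2_comp.
split=> /=; [exact: ordge_subst|exact: ordge_subst| | |].
- by move=> f; rewrite comp => /gi/si.
- move=> P; have [Q PQ PQ'] := sp P.
  exists (ev (@polyC {poly k} \o @polyC k) Q1 Q2 Q).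
    by rewrite PQ y1E y2E; symmetry; apply: ev_comp.
  rewrite comp PQ' subst2_evs // subst2_X1 // subst2_X2 // {1}g1E {1}g2E.
  by rewrite evs_comp.
have H := @surj_mod_units_comp (ser2 k) (ser2 k) (ser2 k)
  (substm h1 h2) (substm hg1 hg2) si gi su gu.
move=> F F0; have [A [B [U [B0 Uu AE]]]] := H F F0.
exists A, B, U; split; [exact: B0|exact: Uu|].
exact: etrans (comp A) (etrans AE (congr1 (fun x => F * U * x) (esym (comp B)))).
Qed.

End Stages.

Section EvMonomials.
Variables (k : fieldType) (A : comNzRingType) (c : {rmorphism k -> A}) (x y : A).

Lemma ev_blow : ev c x y ('X * 'X%:P) = x * y.
Proof. by rewrite rmorphM /= evX evY. Qed.
Lemma ev_shift2 a r : ev c x y ('X%:P + a%:P%:P * 'X^r) = y + c a * x ^+ r.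
Proof. by rewrite rmorphD rmorphM rmorphXn /= evY evC evX. Qed.
Lemma ev_shift1 a r : ev c x y ('X + a%:P%:P * 'X%:P ^+ r) = x + c a * y ^+ r.
Proof. by rewrite rmorphD rmorphM rmorphXn /= evX evC evY. Qed.
End EvMonomials.

Section Automorphisms.
Variable k : fieldType.
Implicit Types (f g t h G : ser2 k).

Lemma subst2_cancel g1 g2 h1 h2 :
  ordge 1 g1 -> ordge 1 g2 -> ordge 1 h1 -> ordge 1 h2 ->
  subst2 g1 g2 h1 = X1 -> subst2 g1 g2 h2 = X2 ->
  cancel (subst2 h1 h2) (subst2 g1 g2 : ser2 k -> ser2 k).
Proof.
move=> hg1 hg2 hh1 hh2 e1 e2 f.
by have := subst2_comp f hg1 hg2 hh1 hh2; rewrite e1 e2 => ->; apply: subst2_id.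
Qed.

Lemma cancel_subst_inj g1 g2 h1 h2 : ordge 1 h1 -> ordge 1 h2 ->
  cancel (subst2 g1 g2) (subst2 h1 h2 : ser2 k -> ser2 k) ->
  forall f, subst2 g1 g2 f = 0 -> f = 0.
Proof. by move=> hh1 hh2 gK f f0; rewrite -(gK f) f0 subst0. Qed.

Lemma cancel_subst_surj g1 g2 h1 h2 : 
  ordge 1 g1 -> ordge 1 g2 -> ordge 1 h1 -> ordge 1 h2 ->
  cancel (subst2 h1 h2) (subst2 g1 g2 : ser2 k -> ser2 k) ->
  surj_mod_units (subst2 g1 g2 : ser2 k -> ser2 k).
Proof.
move=> hg1 hg2 hh1 hh2.
exact: (@surj_mod_units_bij k (substm hg1 hg2) (substm hh1 hh2)).
Qed.

(** The hypothesis on [subst2 X1 G t] says that [t] does not involve [X2]; hence adding and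
    subtracting [t] are inverse substitutions. *)
Lemma shift2K t : ordge 1 t -> (forall G, ordge 1 G -> subst2 X1 G t = t) ->
  cancel (subst2 X1 (X2 - t)) (subst2 X1 (X2 + t) : ser2 k -> ser2 k) /\
  cancel (subst2 X1 (X2 + t)) (subst2 X1 (X2 - t) : ser2 k -> ser2 k).
Proof.
move=> t1 tG; have h1 := @ordge_X1 k; have h2 := @ordge_X2 k.
have hp : ordge 1 (X2 + t) by apply: ordgeD.
have hm : ordge 1 (X2 - t) by apply: ordgeB.
split; apply: subst2_cancel => //; rewrite ?subst2_X1 //.
  by rewrite substB // subst2_X2 // tG // addrK.
by rewrite substD // subst2_X2 // tG // subrK.
Qed.

Lemma shift1K t : ordge 1 t -> (forall G, ordge 1 G -> subst2 G X2 t = t) ->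
  cancel (subst2 (X1 - t) X2) (subst2 (X1 + t) X2 : ser2 k -> ser2 k) /\
  cancel (subst2 (X1 + t) X2) (subst2 (X1 - t) X2 : ser2 k -> ser2 k).
Proof.
move=> t1 tG; have h1 := @ordge_X1 k; have h2 := @ordge_X2 k.
have hp : ordge 1 (X1 + t) by apply: ordgeD.
have hm : ordge 1 (X1 - t) by apply: ordgeB.
split; apply: subst2_cancel => //; rewrite ?subst2_X2 //.
  by rewrite substB // subst2_X1 // tG // addrK.
by rewrite substD // subst2_X1 // tG // subrK.
Qed.

End Automorphisms.

Section Chains.
Variables (k : fieldType) (v : valuation k).
Implicit Types (s : stage k).

Definition chained s := finitely_reached v s /\ stage_inv s.

Lemma chained0 : chained (stage0 k).
Proof. by split; [apply: Reached0|apply: stage_inv0]. Qed.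

Lemma chained_blow s : chained s -> y1 s != 0 -> vle (v (y1 s)) (v (y2 s)) ->
  chained (change s (y1 s) (y2 s / y1 s) X1 (X1 * X2)).
Proof.
move=> [rs si] y10 y12; split; first by apply: ReachedS rs _; apply: BlowUp1.
apply: (@stage_inv_change _ _ _ _ _ _ 'X ('X * 'X%:P) si).
- exact: ordge_X1.
- exact: ordge_X1X2.
- by rewrite evX.
- by rewrite evX.
- by rewrite ev_blow mulrCA divff // mulr1.
- by rewrite ev_blow.
- exact: blow_inj.
exact: blow_surj.
Qed.

Lemma ordge_cstX (c : k) (x : ser2 k) r : (1 <= r)%N -> ordge 1 x ->
  ordge 1 (cst2 c * x ^+ r).
Proof. by move=> r1 hx; apply: ordgeMr; apply: ordge_leq r1 _; apply: ordgeX. Qed.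

Lemma chained_coord2 s alpha r : chained s -> (1 <= r)%N ->
  chained (change s (y1 s) (y2 s - qcst alpha * y1 s ^+ r)
                  X1 (X2 + cst2 alpha * X1 ^+ r)).
Proof.
move=> [rs si] r1; split; first by apply: ReachedS rs _; apply: Coord2.
have h1 := @ordge_X1 k; have h2 := @ordge_X2 k.
have ht := ordge_cstX alpha r1 h1.
have tG G : ordge 1 G -> subst2 X1 G (cst2 alpha * X1 ^+ r) = cst2 alpha * X1 ^+ r.
  move=> hG; rewrite (substM h1 hG) (subst2_cst h1 hG) (substX h1 hG).
  by rewrite (subst2_X1 h1 hG).
have [pm mp] := shift2K ht tG.
apply: (@stage_inv_change _ _ _ _ _ _ 'X ('X%:P + alpha%:P%:P * 'X^r) si).
- exact: h1.
- exact: ordgeD.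
- by rewrite evX.
- by rewrite evX.
- by rewrite ev_shift2 subrK.
- by rewrite ev_shift2.
- by apply: (cancel_subst_inj _ _ mp) => //; apply: ordgeB.
by apply: (cancel_subst_surj _ _ _ _ pm) => //; [apply: ordgeD|apply: ordgeB].
Qed.

Lemma chained_coord1 s alpha r : chained s -> (1 <= r)%N ->
  chained (change s (y1 s - qcst alpha * y2 s ^+ r) (y2 s)
                  (X1 + cst2 alpha * X2 ^+ r) X2).
Proof.
move=> [rs si] r1; split; first by apply: ReachedS rs _; apply: Coord1.
have h1 := @ordge_X1 k; have h2 := @ordge_X2 k.
have ht := ordge_cstX alpha r1 h2.
have tG G : ordge 1 G -> subst2 G X2 (cst2 alpha * X2 ^+ r) = cst2 alpha * X2 ^+ r.
  move=> hG; rewrite (substM hG h2) (subst2_cst hG h2) (substX hG h2).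
  by rewrite (subst2_X2 hG h2).
have [pm mp] := shift1K ht tG.
apply: (@stage_inv_change _ _ _ _ _ _ ('X + alpha%:P%:P * 'X%:P ^+ r) 'X%:P si).
- exact: ordgeD.
- exact: h2.
- by rewrite ev_shift1 subrK.
- by rewrite ev_shift1.
- by rewrite evY.
- by rewrite evY.
- by apply: (cancel_subst_inj _ _ mp) => //; apply: ordgeB.
by apply: (cancel_subst_surj _ _ _ _ pm) => //; [apply: ordgeD|apply: ordgeB].
Qed.

Definition reaches (x y : qser2 k) := exists s, [/\ chained s, y1 s = x & y2 s = y].

Lemma reaches0 : reaches (tofrac X1) (tofrac X2).
Proof. by exists (stage0 k); split=> //; apply: chained0. Qed.

Lemma reaches_blow x y : reaches x y -> x != 0 -> vle (v x) (v y) ->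
  reaches x (y / x).
Proof.
by move=> [s [sc <- <-]] x0 xy; have := chained_blow sc x0 xy; eexists; split; eauto.
Qed.

Lemma reaches_shift x y alpha r : (1 <= r)%N -> reaches x y ->
  reaches x (y - qcst alpha * x ^+ r).
Proof.
by move=> r1 [s [sc <- <-]]; have := chained_coord2 alpha sc r1; eexists; split; eauto.
Qed.

Lemma reaches_shift1 x y alpha r : (1 <= r)%N -> reaches x y ->
  reaches (x - qcst alpha * y ^+ r) y.
Proof.
by move=> r1 [s [sc <- <-]]; have := chained_coord1 alpha sc r1; eexists; split; eauto.
Qed.

(** There is no exchange among the steps; three elementary shears produce it up to a sign: [(x, y)],
    [(x, y - x)], [(y, y - x)], [(y, - x)]. *)
Lemma reaches_swap x y : reaches x y -> reaches y (- x).
Proof.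
move=> /(@reaches_shift _ _ 1 1 isT) /(@reaches_shift1 _ _ (-1) 1 isT).
move=> /(@reaches_shift _ _ 1 1 isT).
rewrite !expr1 qcst1 qcstN1 !mul1r mulN1r opprK.
by rewrite [x + _]addrC subrK [y - x - y]addrAC subrr add0r.
Qed.

End Chains.

Lemma vlt_lexpos_add (c : Z2) (g : Z2) : lexpos g -> vlt (Some c) (Some (c + g)).
Proof. by rewrite lexposE /vlt /= lexleE; case: c g => [? ?] [? ?] /=; lia. Qed.

Lemma vlt_muln (g : Z2) m n : lexpos g -> (m < n)%N ->
  vlt (Some (g *+ m)) (Some (g *+ n)).
Proof.
move=> gp mn; rewrite -(subnKC mn) addSn mulrS addrC.
apply: vlt_le_trans (vlt_lexpos_add _ gp) _.
rewrite /= lexle_add2r mulrnDr -[X in lexle X]addr0.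
by apply: lexleD; [apply: (vle_refl (Some _))|apply: lexpos_ge0].
Qed.

Lemma vle_muln (g : Z2) m n : lexpos g -> (m <= n)%N ->
  vle (Some (g *+ m)) (Some (g *+ n)).
Proof.
rewrite leq_eqVlt => gp /predU1P [->|/(vlt_muln gp)]; first exact: vle_refl.
exact: vltW.
Qed.

Lemma lexle_muln2 (c d : Z2) m : lexle c d -> lexle (c *+ m) (d *+ m).
Proof.
move=> cd; elim: m => [|m IH]; first exact: (vle_refl (Some 0)).
by rewrite !mulrS; apply: lexleD.
Qed.

Section Dominant.
Variables (k : fieldType) (v : valuation k).

Lemma val_sum_dominant (I : finType) (F : I -> qser2 k) i0 c :
  v (F i0) = Some c -> (forall i, i != i0 -> vlt (Some c) (v (F i))) ->
  v (\sum_i F i) = Some c.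
Proof.
move=> Fc H; rewrite (bigD1 i0) //= val_addl //.
by rewrite Fc; apply: val_gt_sum.
Qed.

Lemma val_ev1_dominant x g (q : {poly k}) d :
  lexpos g -> v x = Some g ->
  q`_d != 0 -> (forall i, (i < d)%N -> q`_i = 0) ->
  v (ev1 (@qcst k) x q) = Some (g *+ d).
Proof.
move=> gp xg qd q0; rewrite ev1E.
have dq : (d < size q)%N by rewrite ltnNge; apply: contra qd => /leq_sizeP ->.
apply: (@val_sum_dominant _ _ (Ordinal dq)) => /=.
  by rewrite valM val_cst // vadd0 (valXn d xg).
move=> i; rewrite -val_eqE /= neq_ltn => /orP [/q0 ->|di].
  by rewrite -[GRing.RMorphism.sort _ _]/(qcst 0) /qcst !rmorph0 mul0r val0.
apply: vlt_le_trans (vlt_muln gp di) _; rewrite -(valXn _ xg) valM -[X in vle X]vadd0.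
by apply: vleD; [apply: val_qcst_ge0|apply: vle_refl].
Qed.

Lemma val_ev1_ge x g (q : {poly k}) d : lexpos g -> v x = Some g ->
  (forall i, (i < d)%N -> q`_i = 0) ->
  vle (Some (g *+ d)) (v (ev1 (@qcst k) x q)).
Proof.
move=> gp xg q0; rewrite ev1E; apply: val_ge_sum => i _.
have [id|di] := ltnP i d.
  rewrite q0 // -[GRing.RMorphism.sort _ _]/(qcst 0) /qcst !rmorph0 mul0r val0.
  exact: vle_None.
apply: vle_trans (vle_muln gp di) _; rewrite -(valXn _ xg) valM -[X in vle X]vadd0.
by apply: vleD; [apply: val_qcst_ge0|apply: vle_refl].
Qed.

Lemma val_ev_ge0 x y P : vle (Some 0) (v x) -> vle (Some 0) (v y) ->
  vle (Some 0) (v (ev (@qcst k) x y P)).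
Proof.
move=> x0 y0; elim/bipoly_ind: P => [a|||P P' IH IH'|P P' IH IH'].
- by rewrite evC; apply: val_qcst_ge0.
- by rewrite evX.
- by rewrite evY.
- by rewrite rmorphD; apply: val_geD.
by rewrite rmorphM; apply: val_ge0M.
Qed.

End Dominant.

(** * From polynomials to series *)

Section Truncation.
Variables (k : fieldType) (v : valuation k) (hring : ring_contains_series v).
Variables (G1 G2 : ser2 k) (hG1 : ordge 1 G1) (hG2 : ordge 1 G2).
Variables (B1 B2 lam : Z2).
Hypotheses (B1p : lexpos B1) (B2p : lexpos B2) (lamp : lexpos lam).
Hypotheses (vX1 : vle (Some lam) (v (tofrac X1)))
  (vX2 : vle (Some lam) (v (tofrac X2)))
  (lG1 : vle (Some lam) (lm B1 B2 G1)) (lG2 : vle (Some lam) (lm B1 B2 G2)).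
Notation evs := (ev (@cst2 k)).
Hypothesis arch : forall a b,
  exists M, vlt (Some (B1 *+ a + B2 *+ b)) (Some (lam *+ M)).
Hypothesis poly_Some : forall (P : bipoly k) c,
  lm B1 B2 (subst2 G1 G2 (evs X1 X2 P)) = Some c ->
  v (tofrac (evs X1 X2 P)) = Some c.
Hypothesis poly_None : forall P : bipoly k,
  lm B1 B2 (subst2 G1 G2 (evs X1 X2 P)) = None ->
  forall M, vle (Some (lam *+ M)) (v (tofrac (evs X1 X2 P))).

Lemma val_ordge n r : ordge n r -> vle (Some (lam *+ n)) (v (tofrac r)).
Proof.
elim: n r => [|n IH] r; first by move=> _; apply: hring.
move=> /ordge_split [r1 [r2 [/IH hr1 /IH hr2 ->]]].
rewrite tofracD !tofracM mulrS -[Some _]/(vadd (Some lam) (Some (lam *+ n))).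
by apply: val_geD; rewrite valM; apply: vleD.
Qed.

Lemma lm_subst_ordge n r : ordge n r ->
  vle (Some (lam *+ n)) (lm B1 B2 (subst2 G1 G2 r)).
Proof.
elim: n r => [|n IH] r; first by move=> _; apply: lm_ge0.
move=> /ordge_split [r1 [r2 [/IH hr1 /IH hr2 ->]]].
rewrite substD // !substM // subst2_X1 // subst2_X2 //.
rewrite mulrS -[Some _]/(vadd (Some lam) (Some (lam *+ n))).
by apply: lm_geD => //; (apply: vle_trans (lmM_ge _ _ _ _) => //); apply: vleD.
Qed.

Lemma series_split M f : exists P r, f = evs X1 X2 P + r /\ ordge M r.
Proof.
exists (trunc2 M f), (f - evs X1 X2 (trunc2 M f)); split.
  by rewrite addrC subrK.
exact: ordge_trunc2.
Qed.

(** By [arch] the truncation can be taken so fine that the error has value above [c] both under [v]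
    and under [lm]; then the polynomial part carries the value on both sides. *)
Lemma val_series_Some f c :
  lm B1 B2 (subst2 G1 G2 f) = Some c -> v (tofrac f) = Some c.
Proof.
move=> fc; have [M cM] : exists M, vlt (Some c) (Some (lam *+ M)).
  by have /lmP [[a [b [_ ->]]] _] := fc.
have [P [r [fE rM]]] := series_split M f.
have sE : subst2 G1 G2 (evs X1 X2 P) = subst2 G1 G2 f + - subst2 G1 G2 r.
  by rewrite fE substD // addrK.
have Pc : lm B1 B2 (subst2 G1 G2 (evs X1 X2 P)) = Some c.
  rewrite sE lm_addl // fc lmN //; apply: vlt_le_trans cM _.
  exact: lm_subst_ordge.
rewrite fE tofracD val_addl (poly_Some Pc) //.
by apply: vlt_le_trans cM _; apply: val_ordge.
Qed.

(** Only a bound by all multiples of [lam] comes out, not [f = 0]: a series may vanish on the limit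
    curve and still have a finite value with larger first component. *)
Lemma val_series_None f M : subst2 G1 G2 f = 0 ->
  vle (Some (lam *+ M)) (v (tofrac f)).
Proof.
move=> f0; have [P [r [fE rM]]] := series_split M f.
have sE : subst2 G1 G2 (evs X1 X2 P) = - subst2 G1 G2 r.
  have := f0; rewrite fE substD // => /eqP; rewrite addr_eq0 => /eqP ->; done.
rewrite fE tofracD; apply: val_geD; last exact: val_ordge.
case E: (lm B1 B2 (subst2 G1 G2 (evs X1 X2 P))) => [c|]; last exact: poly_None.
rewrite (poly_Some E) -E sE lmN //; exact: lm_subst_ordge.
Qed.

End Truncation.

(** * Values of polynomials in a pair *)

Section PolynomialValues.
Variables (k : fieldType) (v : valuation k).
Implicit Types (x y : qser2 k) (Q : bipoly k).
Notation evs := (ev (@cst2 k)).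
Notation evK := (ev (@qcst k)).

Lemma bipoly_eq0 Q : evs X1 X2 Q = 0 -> Q = 0.
Proof.
move=> Q0; apply/polyP => i; apply/polyP => j.
by rewrite -coef2_evX Q0 coef20 !coef0.
Qed.

Lemma qcst0 : qcst 0 = 0 :> qser2 k. Proof. exact: rmorph0. Qed.

Lemma evK_bound N M x y Q :
  (forall i j, (N <= i)%N || (M <= j)%N -> Q`_i`_j = 0) ->
  evK x y Q = \sum_(i < N) \sum_(j < M) qcst Q`_i`_j * (x ^+ i * y ^+ j).
Proof. exact: evE. Qed.

Definition free_pair (V1 V2 : Z2) := forall a b i j : nat,
  V1 *+ a + V2 *+ b = V1 *+ i + V2 *+ j -> a = i /\ b = j.

(** Distinct monomials have distinct values, so a single term dominates the sum. *)
Lemma val_evK_lm x y V1 V2 Q : lexpos V1 -> lexpos V2 -> free_pair V1 V2 ->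
  v x = Some V1 -> v y = Some V2 ->
  v (evK x y Q) = lm V1 V2 (evs X1 X2 Q).
Proof.
move=> V1p V2p inj xV yV; case E: (lm V1 V2 (evs X1 X2 Q)) => [c|]; last first.
  by move/(lm_None V1p V2p): E => /bipoly_eq0 ->; rewrite rmorph0 val0.
have /lmP [[a [b [ab ->]]] minc] := E; rewrite coef2_evX in ab.
have [N HN] := bipoly_bound Q; rewrite (evK_bound _ _ HN) pair_big /=.
have /andP [aN bN] : (a < N)%N && (b < N)%N.
  by rewrite !ltnNge -negb_or; apply: contra ab => /HN ->.
have mon i j : v (x ^+ i * y ^+ j) = Some (V1 *+ i + V2 *+ j).
  by rewrite valM (valXn _ xV) (valXn _ yV).
apply: (@val_sum_dominant _ _ _ _ (Ordinal aN, Ordinal bN)) => /=.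
  by rewrite valM val_cst // vadd0 mon.
move=> [i j]; rewrite xpair_eqE -!val_eqE /= => nij.
have [->|Qij] := eqVneq Q`_i`_j 0; first by rewrite qcst0 mul0r val0.
rewrite valM val_cst // vadd0 mon.
have le := minc i j; rewrite coef2_evX in le; have {}le := le Qij.
have [/(congr1 (odflt 0)) /= e|//] := @vle_eqVlt (Some _) (Some _) le.
by have [ai bj] := inj _ _ _ _ e; rewrite -ai -bj !eqxx in nij.
Qed.

End PolynomialValues.

Section Residue.
Variables (k : closedFieldType) (v : valuation k).
Notation evs := (ev (@cst2 k)).
Notation evK := (ev (@qcst k)).

(** As [k] is algebraically closed, [p] splits into factors ['X - z], each of value 0 at [theta]. *)
Lemma val_ev1_transcendental theta (p : {poly k}) :
  (forall a, v (theta - qcst a) = Some 0) -> p != 0 ->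
  v (ev1 (@qcst k) theta p) = Some 0.
Proof.
move=> Hth p0; have [r ->] := closed_field_poly_normal p.
rewrite -mul_polyC rmorphM /= valM ev1C val_cst ?lead_coef_eq0 // vadd0.
elim: r => [|z r IH]; first by rewrite big_nil rmorph1 val1.
rewrite big_cons rmorphM valM IH rmorphB /= ev1X ev1C.
by rewrite Hth.
Qed.

(** In terms of [x] and [th = y / x], the coefficient of each power of [x] is a polynomial in [th],
    of value 0 unless it vanishes. The lowest power of [x] present therefore dominates, and it is
    the order of [Q] at the origin. *)
Lemma val_evK_order x y g Q c : lexpos g -> v x = Some g -> v y = Some g ->
  (forall a, ~~ vlt (Some g) (v (y - qcst a * x))) ->
  lm g g (evs X1 X2 Q) = Some c -> v (evK x y Q) = Some c.
Proof.
move=> gp xg yg Hy lmc.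
have x0 : x != 0 by apply/eqP => x0; rewrite x0 val0 in xg.
pose th := y / x; have yE : y = x * th by rewrite mulrCA divff // mulr1.
have Hth a : v (th - qcst a) = Some 0.
  have := Hy a; rewrite yE [qcst a * x]mulrC -mulrBr valM xg.
  have : vle (Some 0) (v (th - qcst a)).
    by apply: val_geB; [rewrite (val_div yg xg) subrr|apply: val_qcst_ge0].
  case: (v _) => [b|] //= b0; rewrite /vlt /= negbK => gb.
  have b0' : lexle b 0 by rewrite -(lexle_add2r g) add0r addrC.
  exact: (@vle_anti (Some b) (Some 0)).
pose Q' := ev (@polyC {poly k} \o @polyC k) 'X ('X * 'X%:P) Q.
have QE : evK x y Q = evK x th Q'.
  by rewrite yE /Q' ev_comp evX ev_blow.
have Q'coef i j : Q'`_i`_j = if (j <= i)%N then Q`_(i - j)`_j else 0.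
  rewrite -!coef2_evX -coef2_blow subst2_evs; [|exact: ordge_X1|exact: ordge_X1X2].
  rewrite subst2_X1; [|exact: ordge_X1|exact: ordge_X1X2].
  rewrite subst2_X2; [|exact: ordge_X1|exact: ordge_X1X2].
  by rewrite /Q' evs_comp evX ev_blow.
have /lmP [[a [b [ab cE]]] minc] := lmc; rewrite coef2_evX in ab.
have Q'd : Q'`_(a + b) != 0.
  apply: contra ab => /eqP /(congr1 (fun p : {poly k} => p`_b)).
  by rewrite Q'coef leq_addl addnK coef0 => ->.
have Q'0 i : (i < a + b)%N -> Q'`_i = 0.
  move=> iab; apply/polyP => j; rewrite coef0 Q'coef; case: leqP => // ji.
  apply: contraTeq iab => Qij; have := minc (i - j)%N j; rewrite coef2_evX.
  move=> /(_ Qij); rewrite cE -!mulrnDr subnK // => h.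
  by apply: contraTN h => /(vlt_muln gp).
rewrite QE ev_ev1 cE -mulrnDr.
have ds : (a + b < size Q')%N by rewrite ltnNge; apply: contra Q'd => /leq_sizeP ->.
apply: (@val_sum_dominant _ _ _ _ (Ordinal ds)) => /=.
  by rewrite valM val_ev1_transcendental // vadd0 (valXn _ xg).
move=> i; rewrite -val_eqE /= neq_ltn => /orP [/Q'0 ->|di].
  by rewrite rmorph0 mul0r val0.
have [->|Qi] := eqVneq Q'`_i 0; first by rewrite rmorph0 mul0r val0.
by rewrite valM val_ev1_transcendental // vadd0 (valXn _ xg); apply: vlt_muln.
Qed.

End Residue.

Section Tail.
Variables (k : fieldType) (v : valuation k).
Notation evs := (ev (@cst2 k)).
Notation evK := (ev (@qcst k)).
Variables (x y : qser2 k) (g : Z2) (alpha : nat -> k).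
Hypotheses (gp : lexpos g) (xg : v x = Some g) (y0 : vle (Some 0) (v y)).
Hypothesis Hy : forall n,
  vlt (Some (g *+ n)) (v (y - \sum_(i < n) qcst (alpha i.+1) * x ^+ i.+1)).

Definition tail_poly n : {poly k} := \sum_(i < n) (alpha i.+1)%:P * 'X^(i.+1).

Lemma ev1_tail_poly (A : comNzRingType) (c : {rmorphism k -> A}) z n :
  ev1 c z (tail_poly n) = \sum_(i < n) c (alpha i.+1) * z ^+ i.+1.
Proof.
rewrite /tail_poly rmorph_sum /=; apply: eq_bigr => i _.
by rewrite rmorphM rmorphXn /= ev1C ev1X.
Qed.

Lemma ordge_tail1 : ordge 1 (tail1 alpha).
Proof. by move=> [|a] [|b]. Qed.

Lemma coef2_ev1 (p : {poly k}) a b :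
  coef2 (ev1 (@cst2 k) X1 p) a b = if b == 0%N then p`_a else 0.
Proof.
rewrite ev1E coef2_sum.
have E (i : 'I_(size p)) : coef2 (cst2 p`_i * X1 ^+ i) a b =
    p`_i * ((a == i) && (b == 0%N))%:R.
  by rewrite coef2_cstM -coef2_mon expr0 mulr1.
under eq_bigr do rewrite E.
have [ap|pa] := ltnP a (size p); last first.
  rewrite nth_default // if_same big1 // => i _.
  by rewrite gtn_eqF ?mulr0 //; apply: leq_trans (ltn_ord i) pa.
rewrite (bigD1 (Ordinal ap)) //= eqxx big1 ?addr0.
  by case: (b == _); rewrite ?mulr1 ?mulr0.
by move=> i; rewrite -val_eqE eq_sym /= => /negPf ->; rewrite mulr0.
Qed.

Lemma tail_poly_ordge n : ordge n.+1 (tail1 alpha - ev1 (@cst2 k) X1 (tail_poly n)).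
Proof.
move=> a b ab; rewrite coef2B coef2_ev1.
have -> : coef2 (tail1 alpha) a b = if (0 < a)%N && (b == 0%N) then alpha a else 0.
  by [].
case: (posnP b) => [b0|b0]; last by rewrite andbF subr0.
rewrite b0 addn0 ltnS in ab; rewrite andbT /tail_poly coef_sum.
under eq_bigr do rewrite coefCM coefXn.
case: a ab => [|a] an; first by rewrite big1 ?subr0 // => i _; rewrite mulr0.
rewrite (bigD1 (Ordinal an)) //= eqxx mulr1 big1 ?addr0 ?subrr // => i.
by rewrite -val_eqE /= eqSS eq_sym => /negPf ->; rewrite mulr0.
Qed.

(** Replacing the tail, respectively [y], by the sum of the first [n] terms changes [Q] little on
    either side and leaves the same polynomial in one variable. *)
Lemma tail_evs_congr n Q : exists2 q : {poly k},
  ordge n.+1 (evs X1 (tail1 alpha) Q - ev1 (@cst2 k) X1 q) &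
  vlt (Some (g *+ n)) (v (evK x y Q - ev1 (@qcst k) x q)).
Proof.
exists (ev (@polyC k) 'X (tail_poly n) Q).
  have -> : ev1 (@cst2 k) X1 (ev (@polyC k) 'X (tail_poly n) Q) =
    evs X1 (ev1 (@cst2 k) X1 (tail_poly n)) Q by rewrite -ev_poly.
  apply: (@ev_congr _ _ (@cst2 k) X1 _ _ (ordge n.+1)).
  - exact: ordge_zero.
  - exact: ordgeD.
  - by move=> Q' a; apply: ordgeMr.
  - by move=> Q' a; apply: ordgeMr.
  exact: tail_poly_ordge.
have := Hy n; rewrite -ev1_tail_poly -ev_poly => hn.
have x0 : vle (Some 0) (v x) by rewrite xg; apply: vltW; apply: gp.
have t0 : vle (Some 0) (v (ev1 (@qcst k) x (tail_poly n))).
  rewrite ev1_tail_poly; apply: val_ge_sum => i _.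
  by apply: val_ge0M; [apply: val_qcst_ge0|apply: val_ge0X].
have mulJ a z : vle (Some 0) (v a) -> vlt (Some (g *+ n)) (v z) ->
    vlt (Some (g *+ n)) (v (a * z)).
  move=> a0 z0; apply: vlt_le_trans z0 _.
  by rewrite mulrC; apply: val_geMl => //; apply: vle_refl.
apply: (@ev_congr _ _ (@qcst k) x _ _ (fun z => vlt (Some (g *+ n)) (v z))) => //.
- by rewrite val0.
- by move=> a b; apply: val_gtD.
- by move=> Q' a; apply: mulJ; apply: val_ev_ge0.
by move=> Q' a; apply: mulJ; apply: val_ev_ge0.
Qed.

Lemma tail_val_Some Q c : lm g g (evs X1 (tail1 alpha) Q) = Some c ->
  v (evK x y Q) = Some c.
Proof.
set F := evs X1 _ Q => Fc.
have FX1 a b : (0 < b)%N -> coef2 F a b = 0.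
  move=> b0; have [q hq _] := tail_evs_congr (a + b) Q.
  have := hq a b (leqnn _); rewrite coef2B coef2_ev1 gtn_eqF // subr0.
  exact.
have /lmP [[a [b [ab cE]]] minc] := Fc.
have b0 : b = 0%N by apply: contraNeq ab; rewrite -lt0n => /FX1 ->.
rewrite b0 mulr0n addr0 in ab cE.
(* Cutting at the order [a] of [F] suffices: [q] agrees with [F] through degree [a], and the error
   in the field has value above [g *+ a]. *)
have [q hq vq] := tail_evs_congr a Q.
have coefq i : (i <= a)%N -> coef2 F i 0 = q`_i.
  move=> ia; apply/eqP; rewrite -subr_eq0.
  have := hq i 0%N; rewrite addn0 ltnS coef2B coef2_ev1 /= => ->//.
have -> : evK x y Q = ev1 (@qcst k) x q + (evK x y Q - ev1 (@qcst k) x q).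
  by rewrite addrC subrK.
have vq1 : v (ev1 (@qcst k) x q) = Some c.
  rewrite cE; apply: val_ev1_dominant => //; first by rewrite -coefq.
  move=> i ia; rewrite -coefq 1?ltnW //; apply: contraTeq ia => Fi.
  have := minc i 0%N Fi; rewrite cE mulr0n addr0 => h.
  by apply: contraTN h => /(vlt_muln gp).
by rewrite val_addl vq1 // cE.
Qed.

Lemma tail_val_None Q n : evs X1 (tail1 alpha) Q = 0 ->
  vle (Some (g *+ n)) (v (evK x y Q)).
Proof.
move=> F0; have [q hq vq] := tail_evs_congr n Q.
have -> : evK x y Q = ev1 (@qcst k) x q + (evK x y Q - ev1 (@qcst k) x q).
  by rewrite addrC subrK.
apply: val_geD; last exact: vltW.
apply: val_ev1_ge => // i ni.
have := hq i 0%N; rewrite addn0 F0 sub0r coef2N coef2_ev1 /= => h.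
by apply/eqP; rewrite -oppr_eq0 h // ltnS ltnW.
Qed.

End Tail.

Lemma fracP (R : idomainType) (x : {fraction R}) :
  exists a b, b != 0 /\ x = tofrac a / tofrac b.
Proof.
elim/quotW: x => r; exists (r : R * R).1, (r : R * R).2.
split; first exact: denom_ratioP.
unlock FracField.tofrac.
rewrite -[X in _ * X]FracField.pi_inv -[RHS]FracField.pi_mul.
rewrite /FracField.invf /FracField.mulf !numden_Ratio ?oner_eq0 ?denom_ratioP //.
by rewrite mulr1 mul1r Ratio_numden.
Qed.

(** * Commensurable values *)

Section Commensurable.
Implicit Types g h c d : Z2.

Lemma lexle_pmuln2 c d i : (0 < i)%N -> lexle (c *+ i) (d *+ i) = lexle c d.
Proof.
move=> i0; rewrite !lexleE !Z2mulrn /=.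
have i0' : 0 < i%:Z by [].
by rewrite ltr_pM2r // ler_pM2r // (inj_eq (mulIf _)) // gt_eqF.
Qed.

Lemma lexpos_pmuln c i : (0 < i)%N -> lexpos (c *+ i) = lexpos c.
Proof.
by move=> i0; rewrite /lexpos /vlt /= -[in RHS](lexle_pmuln2 _ _ i0) mul0rn.
Qed.

Definition commens g h := exists i j, [/\ (0 < i)%N, (0 < j)%N & g *+ i = h *+ j].

Lemma commens_refl g : commens g g. Proof. by exists 1%N, 1%N. Qed.
Lemma commens_sym g h : commens g h -> commens h g.
Proof. by move=> [i [j [i0 j0 e]]]; exists j, i. Qed.
Lemma commens_trans g h c : commens g h -> commens h c -> commens g c.
Proof.
move=> [i [j [i0 j0 e]]] [m [n [m0 n0 e']]].
exists (i * m)%N, (n * j)%N; rewrite !muln_gt0 i0 j0 m0 n0; split=> //.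
by rewrite mulrnA e -mulrnA mulnC mulrnA e' -mulrnA.
Qed.

(** On a ray of commensurable positive values this is proportional to the position, hence a natural
    number measure for Euclid's algorithm. *)
Definition Z2size g : nat := `|g.1|%N + `|g.2|%N.

Lemma Z2size_muln g n : Z2size (g *+ n) = (Z2size g * n)%N.
Proof. by rewrite /Z2size Z2mulrn /= !abszM mulnDl. Qed.

Lemma Z2size_gt0 g : lexpos g -> (0 < Z2size g)%N.
Proof. by rewrite lexposE /Z2size; case: g => [a b] /=; lia. Qed.

Variant commens_spec (g h : Z2) : Prop :=
| CommensLt : (Z2size h < Z2size g)%N -> commens_spec g h
| CommensEq : h = g -> commens_spec g h
| CommensGt : lexpos (h - g) -> lexle g h -> commens (h - g) g ->
    (Z2size (h - g)%R < Z2size h)%N -> commens_spec g h.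

Lemma commensP g h : lexpos g -> lexpos h -> commens h g -> commens_spec g h.
Proof.
move=> gp hp [i [j [i0 j0 e]]].
have sg := Z2size_gt0 gp.
have se : (Z2size h * i = Z2size g * j)%N by rewrite -!Z2size_muln e.
have [ji|ij|ij] := ltngtP j i.
- apply: CommensLt; rewrite -(ltn_pmul2r i0) se ltn_pmul2l //.
- have hg : (h - g) *+ i = g *+ (j - i).
    by rewrite mulrnBl e mulrnBr // ltnW.
  have ji0 : (0 < j - i)%N by rewrite subn_gt0.
  apply: CommensGt.
  + by rewrite -(lexpos_pmuln _ i0) hg lexpos_pmuln.
  + by rewrite -(lexle_pmuln2 _ _ i0) e; apply: (vle_muln gp (ltnW ij)).
  + by exists i, (j - i)%N.
  rewrite -(ltn_pmul2r i0) -Z2size_muln hg Z2size_muln se ltn_pmul2l //; lia.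
apply: CommensEq; suff: Some h = Some g by move/(congr1 (odflt 0)).
by apply: vle_anti; rewrite /= -(lexle_pmuln2 _ _ i0) e ij;
  apply: (vle_refl (Some _)).
Qed.

(** A relation between monomials equates a multiple of [g] with one of [h] up to sign. Opposite
    signs contradict positivity, equal signs give commensurability. *)
Lemma free_pair_incommens g h : lexpos g -> lexpos h -> ~ commens h g ->
  free_pair g h.
Proof.
move=> gp hp nc.
have key a b i j : (a <= i)%N -> g *+ a + h *+ b = g *+ i + h *+ j ->
    a = i /\ b = j.
  move=> ai e.
  have {}e : h *+ b = g *+ (i - a) + h *+ j.
    by apply: (addrI (g *+ a)); rewrite e addrA -mulrnDr subnKC.
  have [jb|bj] := leqP j b.
    have {}e : h *+ (b - j) = g *+ (i - a).
      by rewrite mulrnBr // e addrK.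
    have [d0|d0] := posnP (b - j).
      rewrite d0 mulr0n in e.
      have [d1|d1] := posnP (i - a); first by split; lia.
      have := lexpos_pmuln g d1; rewrite -e gp lexposE /=; lia.
    have [d1|d1] := posnP (i - a).
      rewrite d1 mulr0n in e.
      have := lexpos_pmuln h d0; rewrite e hp lexposE /=; lia.
    by case: nc; exists (b - j)%N, (i - a)%N.
  have := vlt_muln hp bj; rewrite e vltNge /= => /negP [].
  rewrite -[X in lexle X _]add0r; apply: lexleD; first exact: lexpos_ge0.
  exact: (vle_refl (Some _)).
move=> a b i j e; case: (leqP a i) => [|/ltnW] ai; first exact: key.
by have [-> ->] := key _ _ _ _ ai (esym e).
Qed.

(** If [g.1 = 0], the least positive element [(0, 1)] works. Otherwise all first components are at
    least 1 and a sufficiently negative second component suffices. *)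
Lemma common_lower_bound (A1 A2 g : Z2) : lexpos A1 -> lexpos A2 -> lexpos g ->
  g.1 = 0 \/ 0 < A1.1 /\ 0 < A2.1 ->
  exists lam, [/\ lexpos lam, lexle lam A1, lexle lam A2, lexle lam g &
    (g.1 = 0 \/ 0 < lam.1)].
Proof.
rewrite !lexposE => p1 p2 pg H.
case: A1 A2 g p1 p2 pg H => [a1 a2] [b1 b2] [c1 c2] /= p1 p2 pg H.
have [c10|c1p] : c1 = 0 \/ 0 < c1 by lia.
  exists (0, 1); rewrite !lexleE lexposE /=; split; try lia; by left.
exists (1, - (`|a2| + `|b2| + `|c2|)).
by rewrite !lexleE lexposE /=; split; try lia; right.
Qed.

End Commensurable.

Lemma val_series_div (k : fieldType) (v : valuation k) x c : v x = Some c -> exists A B a b,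
  [/\ x = tofrac A / tofrac B, v (tofrac A) = Some a, v (tofrac B) = Some b
    & c = a - b].
Proof.
have [A [B [B0 ->]]] := fracP x => xc.
have [b bE] : exists b, v (tofrac B) = Some b by apply: val_neq0; rewrite tofrac_eq0.
case aE: (v (tofrac A)) => [a|].
  exists A, B, a, b; split=> //.
  by have := val_div aE bE; rewrite xc => /(congr1 (odflt 0)).
by rewrite (val_eq0 aE) mul0r val0 in xc.
Qed.

Section Stages.
Variables (k : closedFieldType) (v : valuation k).
Hypotheses (hvg : value_group_Z2 v) (hring : ring_contains_series v)
  (hcenter : center_is_maximal v).
Notation evs := (ev (@cst2 k)).
Notation evK := (ev (@qcst k)).
Implicit Types (x y z : qser2 k) (g h : Z2) (s : stage k).

Lemma val_X1_ex : exists2 A1, lexpos A1 & v (tofrac X1) = Some A1.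
Proof.
have n0 : tofrac X1 != 0 :> qser2 k.
  rewrite tofrac_eq0; apply/eqP => /(congr1 (fun f => coef2 f 1 0)) /eqP.
  by rewrite coef20 oner_eq0.
have [A1 A1E] := val_neq0 v n0; exists A1 => //.
by rewrite /lexpos -A1E; apply/hcenter.
Qed.

Lemma val_X2_ex : exists2 A2, lexpos A2 & v (tofrac X2) = Some A2.
Proof.
have n0 : tofrac X2 != 0 :> qser2 k.
  rewrite tofrac_eq0; apply/eqP => /(congr1 (fun f => coef2 f 0 1)) /eqP.
  by rewrite coef20 oner_eq0.
have [A2 A2E] := val_neq0 v n0; exists A2 => //.
by rewrite /lexpos -A2E; apply/hcenter.
Qed.

(** The form in which rank two is used: [(1, 0)] and [(0, 1)] are not multiples of one element. It
    refutes both a transcendental residue and an endless process with positive first components. *)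
Lemma values_not_cyclic g :
  ~ (forall f : ser2 k, f != 0 -> exists n, v (tofrac f) = Some (g *+ n)).
Proof.
move=> H.
have mult c : exists m : int, c = g *~ m.
  have [x xc] := hvg c; have [A [B [a [b [_ aE bE ->]]]]] := val_series_div xc.
  have nz f e : v (tofrac f) = Some e -> f != 0.
    by move=> fe; apply/eqP => f0; rewrite f0 tofrac0 val0 in fe.
  have [n nE] := H A (nz _ _ aE); have [m mE] := H B (nz _ _ bE).
  rewrite aE in nE; rewrite bE in mE.
  have /= -> := congr1 (odflt 0) nE; have /= -> := congr1 (odflt 0) mE.
  by exists (n%:Z - m%:Z); rewrite !Z2mulrz !Z2mulrn; congr pair => /=; ring.
have [m mE] := mult (1, 0); have [n nE] := mult (0, 1).
rewrite Z2mulrz in mE; rewrite Z2mulrz in nE.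
case: mE => m1 m2; case: nE => n1 n2.
have g20 : g.2 = 0.
  apply/eqP; move/esym/eqP: m2; rewrite mulf_eq0 => /orP [//|/eqP m0].
  by move: m1; rewrite m0 mulr0.
by move: n2; rewrite g20 mul0r.
Qed.

(** The condition under which a lower bound for the values of [X1] and [X2] has multiples exceeding
    every multiple of [g], so that truncation can compute values on the ray. *)
Definition bounded_ray g := forall A1 A2,
  v (tofrac X1) = Some A1 -> v (tofrac X2) = Some A2 ->
  g.1 = 0 \/ 0 < A1.1 /\ 0 < A2.1.

Lemma ray_lower_bound g : lexpos g -> bounded_ray g -> exists lam,
  [/\ lexpos lam, vle (Some lam) (v (tofrac X1)), vle (Some lam) (v (tofrac X2)),
      lexle lam g & g.1 = 0 \/ 0 < lam.1].
Proof.
move=> gp bg; have [A1 p1 E1] := val_X1_ex; have [A2 p2 E2] := val_X2_ex.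
have [lam [l0 l1 l2 lg larch]] := common_lower_bound p1 p2 gp (bg _ _ E1 E2).
by exists lam; rewrite E1 E2.
Qed.

Lemma ray_arch g lam : lexpos lam -> lexpos g -> g.1 = 0 \/ 0 < lam.1 ->
  lexle lam g ->
  forall a b, exists M, vlt (Some (g *+ a + g *+ b)) (Some (lam *+ M)).
Proof.
move=> lp gp H lg a b; rewrite -mulrnDr.
(* Both components of [g *+ (a + b)] are at most [Z2size g * (a + b)], while the leading component
   of [lam] is at least 1. *)
exists (Z2size g * (a + b)).+1.
rewrite vltNge /= lexleE !Z2mulrn; move: lp gp H lg; rewrite !lexposE lexleE.
rewrite /Z2size; case: g lam => [g1 g2] [l1 l2] /=.
set m := (a + b)%N; move=> lp gp H lg.
have bound (x y : int) (s : nat) : 0 < y -> x <= s%:Z -> x * m%:Z < y * (s * m).+1%:Z.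
  move=> y0 xs; have h1 : x * m%:Z <= s%:Z * m%:Z by apply: ler_wpM2r.
  have h2 : (s * m).+1%:Z <= y * (s * m).+1%:Z by rewrite ler_peMl //; lia.
  lia.
have [[g10 l1p]|l1p] : (g1 = 0 /\ l1 = 0 /\ 0 < l2) \/ 0 < l1 by lia.
  case: l1p => -> l2p; rewrite g10 !mul0r ltxx eqxx /= -ltNge.
  by apply: bound => //; lia.
have := @bound g1 l1 (`|g1| + `|g2|)%N l1p; lia.
Qed.

End Stages.

Lemma factor_shift (F : fieldType) (x z a : F) n : x != 0 ->
  z - a * x ^+ n.+1 = x * (z / x - a * x ^+ n).
Proof. by move=> x0; rewrite mulrBr mulrCA divff // mulr1 mulrCA -exprS. Qed.

(** * Euclid's algorithm on values *)

Section Process.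
Variables (k : closedFieldType) (v : valuation k).
Hypotheses (hvg : value_group_Z2 v) (hring : ring_contains_series v)
  (hcenter : center_is_maximal v).
Notation evs := (ev (@cst2 k)).
Notation evK := (ev (@qcst k)).
Implicit Types (x y z : qser2 k) (g h : Z2) (s : stage k).

Lemma lm_ordge1 g lam (G : ser2 k) : lexpos g -> lexpos lam -> lexle lam g ->
  ordge 1 G -> vle (Some lam) (lm g g G).
Proof. by move=> gp lp lg G1; have := lm_ordge gp gp lp lg lg G1; rewrite mulr1n. Qed.

(* Otherwise [y / x] has a transcendental residue, and then [v] is [g] times
   the order of a series at the origin. *)
Lemma residue_ex x y g : reaches v x y -> v x = Some g -> v y = Some g ->
  lexpos g -> bounded_ray v g ->
  exists a, vlt (Some g) (v (y - qcst a * x)).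
Proof.
move=> [s [[_ si] xE yE]] xg yg gp bg.
apply: contrapT => nex.
have Hy a : ~~ vlt (Some g) (v (y - qcst a * x)).
  by apply/negP => h; apply: nex; exists a.
have [lam [lp l1 l2 lg larch]] := ray_lower_bound hcenter gp bg.
apply: (values_not_cyclic hvg (g := g)) => f f0.
have h1 := stage_ordge1 si; have h2 := stage_ordge2 si.
have [c fc] : exists c, lm g g (subst2 (f1 s) (f2 s) f) = Some c.
  by apply: lm_neq0 => //; apply: contra_neq f0 => /(stage_inj si).
have /lmP [[a [b [_ cE]]] _] := fc.
exists (a + b)%N; rewrite mulrnDr -cE.
apply: (val_series_Some (B1 := g) (B2 := g) (lam := lam) hring h1 h2) fc => //.
- exact: lm_ordge1.
- exact: lm_ordge1.
- exact: ray_arch.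
move=> P d; have [Q -> ->] := stage_poly si P.
by rewrite xE yE; apply: val_evK_order.
Qed.

(** Dividing [z] by [x] lowers the exponent until [residue_ex] applies. These blowing-ups only serve
    to find [a]: the term is then subtracted from [z] itself, so that the process stays on the same
    [x]. *)
Lemma residue_pow_ex q x z g : reaches v x z -> v x = Some g ->
  v z = Some (g *+ q.+1) -> lexpos g -> bounded_ray v g ->
  exists a, vlt (Some (g *+ q.+1)) (v (z - qcst a * x ^+ q.+1)).
Proof.
elim: q z => [|q IH] z rz xg zg gp bg.
  by rewrite expr1 mulr1n in zg *; apply: residue_ex.
have x0 : x != 0 by apply/eqP => x0; rewrite x0 val0 in xg.
have xz : vle (v x) (v z).
  by rewrite xg zg -[g in Some g]mulr1n; apply: vle_muln.
have vzx : v (z / x) = Some (g *+ q.+1) by rewrite (val_div zg xg) mulrSr addrK.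
have [a ha] := IH _ (reaches_blow rz x0 xz) xg vzx gp bg.
exists a; rewrite (factor_shift z (qcst a) q.+1 x0).
rewrite valM xg mulrS -[Some _]/(vadd (Some g) (Some (g *+ q.+1))).
case E: (v _) ha => [c|] //; rewrite /vlt /= => h.
by rewrite ![g + _]addrC lexle_add2r.
Qed.

Definition good x y g :=
  [/\ reaches v x y, v x = Some g, lexpos g & vlt (Some 0) (v y)].

(** Only partners of the same [x] are considered, since the subtraction process never changes
    [x]. *)
Definition ray_generator x g := forall z h, reaches v x z -> v z = Some h ->
  lexpos h -> commens h g -> exists2 q, (0 < q)%N & h = g *+ q.

(* Euclid's algorithm on the values, by blowing-ups, from a stage minimising
   the value of [y1] on a ray. *)
Lemma ray_generator_ex x0 y0 g0 : good x0 y0 g0 ->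
  exists x y g, [/\ good x y g, commens g g0 & ray_generator x g].
Proof.
move=> good0.
pose Q n := `[< exists x y g, [/\ good x y g, commens g g0 & Z2size g = n] >].
have exQ : exists n, Q n.
  exists (Z2size g0); apply/asboolP; exists x0, y0, g0; split=> //.
  exact: commens_refl.
case: (ex_minnP exQ) => n /asboolP [x [y [g [gxy gc gn]]]] minn.
exists x, y, g; split=> // z h.
have [_ xg gp _] := gxy.
have x_neq0 : x != 0 by apply/eqP => x0'; rewrite x0' val0 in xg.
have [m] := ubnP (Z2size h); elim: m z h => // m IH z h hm rz zh hp hc.
case: (commensP gp hp hc) => [lt|e|hgp gh hgc lt].
- have : (n <= Z2size h)%N.
    apply: minn; apply/asboolP; exists z, (- x), h; split=> //; last first.
      exact: commens_trans hc gc.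
    by split=> //; [apply: reaches_swap|rewrite valN xg].
  by rewrite -gn leqNgt lt.
- by exists 1%N.
have rz' : reaches v x (z / x) by apply: reaches_blow; rewrite // xg zh.
have [|q q0 hq] := IH _ (h - g) _ rz' (val_div zh xg) hgp hgc.
  exact: leq_trans lt hm.
by exists q.+1 => //; rewrite mulrSr -hq subrK.
Qed.

(** If the current value is [g *+ n.+1], the residue term raises it; if it is a larger multiple of
    [g], or beyond all multiples, the coefficient 0 will do. By [ray_generator] no other value
    commensurable with [g] can occur. *)
Lemma tail_ex x y g : good x y g -> bounded_ray v g -> ray_generator x g ->
  (forall z, reaches v x z -> vlt (Some 0) (v z) ->
    (exists2 h, v z = Some h & commens h g) \/
    (forall n, vlt (Some (g *+ n)) (v z))) ->
  exists alpha : nat -> k, forall n,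
    vlt (Some (g *+ n)) (v (y - \sum_(i < n) qcst (alpha i.+1) * x ^+ i.+1)).
Proof.
move=> [rxy xg gp y0] bg gen dich.
pose P n z := reaches v x z /\ vlt (Some (g *+ n)) (v z).
(* Stated for every pair, with the dummy coefficient 0 where [P] fails, so that [choice] yields one
   function to iterate. *)
have step (nz : nat * qser2 k) : exists a,
    P nz.1 nz.2 -> P nz.1.+1 (nz.2 - qcst a * x ^+ nz.1.+1).
  case: nz => n z /=; have [[rz zn]|nP] := pselect (P n z); last by exists 0.
  suff [a ha] : exists a, vlt (Some (g *+ n.+1)) (v (z - qcst a * x ^+ n.+1)).
    by exists a => _; split=> //; apply: reaches_shift.
  have z0 : vlt (Some 0) (v z).
    by apply: vle_lt_trans zn; apply: lexpos_ge0.
  have zero : z - qcst 0 * x ^+ n.+1 = z by rewrite qcst0 mul0r subr0.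
  have [[h zh hc]|inf] := dich z rz z0; last by exists 0; rewrite zero.
  have hp : lexpos h by rewrite /lexpos -zh.
  have [q q0 hq] := gen z h rz zh hp hc.
  rewrite zh hq in zn.
  have nq : (n < q)%N by rewrite ltnNge; apply/negP => /(vle_muln gp); apply/negP.
  have [qn|qn] := eqVneq q n.+1.
    by rewrite qn in hq; rewrite hq in zh; apply: residue_pow_ex.
  by exists 0; rewrite zero zh hq; apply: vlt_muln => //; rewrite ltn_neqAle eq_sym qn.
have [f fP] := choice step.
pose Z := fix Z n := if n is m.+1 then Z m - qcst (f (m, Z m)) * x ^+ m.+1 else y.
have ZP n : P n (Z n).
  elim: n => [|n IH] /=; first by split; rewrite ?mulr0n.
  exact: (fP (n, Z n)).
(* The coefficient of [x ^+ m] is chosen from the state after [m.-1] subtractions. *)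
exists (fun m => f (m.-1, Z m.-1)) => n.
have -> : y - \sum_(i < n) qcst (f (i.+1.-1, Z i.+1.-1)) * x ^+ i.+1 = Z n.
  elim: n => [|n IH]; first by rewrite big_ord0 subr0.
  by rewrite big_ord_recr /= opprD addrA IH.
by have [] := ZP n.
Qed.

(** [H f] is the restriction of [f] to the limit curve. Its order gives the value when it is
    nonzero; when it is zero, the value exceeds all multiples of [lam]. *)
Lemma tail_values s g (alpha : nat -> k) : chained v s -> v (y1 s) = Some g ->
  lexpos g -> vle (Some 0) (v (y2 s)) -> bounded_ray v g ->
  (forall n, vlt (Some (g *+ n))
     (v (y2 s - \sum_(i < n) qcst (alpha i.+1) * y1 s ^+ i.+1))) ->
  let H f := subst2 X1 (tail1 alpha) (subst2 (f1 s) (f2 s) f) in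
  (forall f c, lm g g (H f) = Some c -> v (tofrac f) = Some c) /\
  exists lam, [/\ lexpos lam, g.1 = 0 \/ 0 < lam.1 &
    forall f, H f = 0 -> forall M, vle (Some (lam *+ M)) (v (tofrac f))].
Proof.
move=> [_ si] xg gp y0 bg Hy H.
have [lam [lp l1 l2 lg larch]] := ray_lower_bound hcenter gp bg.
have h1 := stage_ordge1 si; have h2 := stage_ordge2 si.
have hX := @ordge_X1 k; have hT := ordge_tail1 alpha.
have e1 := ordge_subst hX hT h1; have e2 := ordge_subst hX hT h2.
have HE f : H f = subst2 (subst2 X1 (tail1 alpha) (f1 s))
    (subst2 X1 (tail1 alpha) (f2 s)) f by apply: subst2_comp.
have HP P : exists2 Q, tofrac (evs X1 X2 P) = evK (y1 s) (y2 s) Q &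
    H (evs X1 X2 P) = evs X1 (tail1 alpha) Q.
  have [Q e e'] := stage_poly si P; exists Q => //; rewrite /H e'.
  by rewrite (subst2_evs hX hT) (subst2_X1 hX hT) (subst2_X2 hX hT).
have poly_Some P c : lm g g (subst2 (subst2 X1 (tail1 alpha) (f1 s))
    (subst2 X1 (tail1 alpha) (f2 s)) (evs X1 X2 P)) = Some c ->
    v (tofrac (evs X1 X2 P)) = Some c.
  by rewrite -HE; have [Q -> ->] := HP P; apply: tail_val_Some.
split.
  move=> f c; rewrite HE.
  apply: (val_series_Some (lam := lam) hring e1 e2) => //.
  - exact: lm_ordge1.
  - exact: lm_ordge1.
  exact: ray_arch.
exists lam; split=> // f; rewrite HE => f0 M.
apply: (val_series_None (B1 := g) (B2 := g) hring e1 e2) f0 => //.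
- exact: lm_ordge1.
- exact: lm_ordge1.
move=> P; rewrite -HE; have [Q -> ->] := HP P => /(lm_None gp gp) Q0 n.
apply: vle_trans (tail_val_None gp xg y0 Hy n Q0).
exact: lexle_muln2.
Qed.

End Process.

(** * Extension of morphisms and valuations to fraction fields *)

Lemma fraction_pairP (R : idomainType) (x : {fraction R}) :
  exists ab : R * R, ab.2 != 0 /\ x = tofrac ab.1 / tofrac ab.2.
Proof. by have [a [b ab]] := fracP x; exists (a, b). Qed.

Section FractionMap.
Variables (R S : idomainType) (phi : {rmorphism R -> S}).
Hypothesis phi0 : forall a, phi a = 0 -> a = 0.

(** A numerator and a denominator are picked by choice; injectivity of [phi], an argument so that
    the morphism structure can be attached, makes the result independent of the pick. *)
Definition frac_map (_ : forall a, phi a = 0 -> a = 0) (x : {fraction R}) :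
    {fraction S} :=
  let ab := projT1 (cid (fraction_pairP x)) in
  tofrac (phi ab.1) / tofrac (phi ab.2).

Lemma frac_mapE a b : b != 0 ->
  frac_map phi0 (tofrac a / tofrac b) = tofrac (phi a) / tofrac (phi b).
Proof.
rewrite /frac_map; case: cid => -[a' b'] /= [b'0 e'] b0.
have nz c : c != 0 -> tofrac (phi c) != 0.
  by move=> c0; rewrite tofrac_eq0; apply: contra_neq c0 => /phi0.
have nz' c : c != 0 -> tofrac c != 0 :> {fraction R} by rewrite tofrac_eq0.
apply/eqP; rewrite eqr_div ?nz // -!tofracM tofrac_eq -!rmorphM.
move/eqP: e'; rewrite eqr_div ?nz' // -!tofracM tofrac_eq => /eqP ->.
by [].
Qed.

Lemma frac_map_tofrac a : frac_map phi0 (tofrac a) = tofrac (phi a).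
Proof.
have := frac_mapE a (oner_neq0 _).
by rewrite !rmorph1 !divr1.
Qed.

Lemma frac_map_zmod : zmod_morphism (frac_map phi0).
Proof.
move=> x y; have [a [b [b0 ->]]] := fracP x; have [c [d [d0 ->]]] := fracP y.
have nz' e : e != 0 -> tofrac e != 0 :> {fraction R} by rewrite tofrac_eq0.
have nz e : e != 0 -> tofrac (phi e) != 0.
  by move=> c0; rewrite tofrac_eq0; apply: contra_neq c0 => /phi0.
rewrite -mulNr addf_div ?nz' // mulNr -!tofracM -tofracB.
rewrite !frac_mapE ?mulf_neq0 // !rmorphB !rmorphM /= -[in RHS]mulNr.
by rewrite addf_div ?nz // mulNr.
Qed.
HB.instance Definition _ := GRing.isZmodMorphism.Build _ _
  (frac_map phi0) frac_map_zmod.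

Lemma frac_map_monoid : monoid_morphism (frac_map phi0).
Proof.
split; first by have := frac_map_tofrac 1; rewrite !rmorph1.
move=> x y; have [a [b [b0 ->]]] := fracP x; have [c [d [d0 ->]]] := fracP y.
rewrite mulf_div -!tofracM !frac_mapE ?mulf_neq0 // mulf_div.
by rewrite -!rmorphM.
Qed.
HB.instance Definition _ := GRing.isMonoidMorphism.Build _ _
  (frac_map phi0) frac_map_monoid.

End FractionMap.

Section FractionValuation.
Variables (k : fieldType) (u : ser2 k -> option Z2).
Hypotheses (u_None : forall f, u f = None <-> f = 0)
  (uM : forall f g, u (f * g) = vadd (u f) (u g))
  (uD : forall f g, vle (vmin (u f) (u g)) (u (f + g)))
  (u_cst : forall c : k, c != 0 -> u (cst2 c) = Some 0).

Definition vsub (x y : option Z2) : option Z2 :=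
  if (x, y) is (Some a, Some b) then Some (a - b) else None.

Definition frac_val (x : qser2 k) : option Z2 :=
  let ab := projT1 (cid (fraction_pairP x)) in vsub (u ab.1) (u ab.2).

Lemma u_neq0 f : f != 0 -> exists c, u f = Some c.
Proof.
by move=> f0; case E: (u f) => [c|]; [exists c|move/u_None: E f0 => ->; rewrite eqxx].
Qed.

Lemma frac_valE a b : b != 0 -> frac_val (tofrac a / tofrac b) = vsub (u a) (u b).
Proof.
rewrite /frac_val; case: cid => -[a' b'] /= [b'0 e'] b0.
have nz' c : c != 0 -> tofrac c != 0 :> qser2 k by rewrite tofrac_eq0.
have {e'} e' : a * b' = a' * b.
  by apply/eqP; move/eqP: e'; rewrite eqr_div ?nz' // -!tofracM tofrac_eq.
have [c cE] := u_neq0 b0; have [c' c'E] := u_neq0 b'0.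
have := congr1 u e'; rewrite !uM cE c'E.
case: (u a) (u a') => [d|] [d'|] //= /(congr1 (odflt 0)) /= e''.
congr Some; apply/eqP; rewrite subr_eq addrAC eq_sym subr_eq; apply/eqP.
by rewrite e''.
Qed.

Lemma frac_val_tofrac a : frac_val (tofrac a) = u a.
Proof.
have u1 : u 1 = Some 0 by have := u_cst (oner_neq0 k); rewrite cst2_1.
have := frac_valE a (oner_neq0 _); rewrite rmorph1 divr1 u1 => ->.
by case: (u a) => // c; rewrite /vsub subr0.
Qed.

Lemma vsub_le c x y : vle x y -> vle (vsub x (Some c)) (vsub y (Some c)).
Proof.
by case: x y => [a|] [b|] //= ab; rewrite lexle_add2r.
Qed.

Lemma frac_val_ex : exists w : valuation k, forall f, w (tofrac f) = u f.
Proof.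
have nz c : c != 0 -> tofrac c != 0 :> qser2 k by rewrite tofrac_eq0.
have w_oo x : frac_val x = None <-> x = 0.
  have [a [b [b0 ->]]] := fracP x; rewrite frac_valE //.
  have [c ->] := u_neq0 b0; split.
    by case E: (u a) => [d|] // _; move/u_None: E => ->; rewrite tofrac0 mul0r.
  move/eqP; rewrite mulf_eq0 invr_eq0 (negPf (nz _ b0)) orbF tofrac_eq0.
  by move/eqP/u_None => ->.
have wM x y : frac_val (x * y) = vadd (frac_val x) (frac_val y).
  have [a [b [b0 ->]]] := fracP x; have [c [d [d0 ->]]] := fracP y.
  rewrite mulf_div -!tofracM !frac_valE ?mulf_neq0 // !uM.
  have [b' ->] := u_neq0 b0; have [d' ->] := u_neq0 d0.
  case: (u a) (u c) => [a'|] [c'|] //.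
  by rewrite /vsub /vadd opprD addrACA.
have wD x y : vle (vmin (frac_val x) (frac_val y)) (frac_val (x + y)).
  have [a [b [b0 ->]]] := fracP x; have [c [d [d0 ->]]] := fracP y.
  rewrite addf_div ?nz // -!tofracM -tofracD.
  have -> : tofrac a / tofrac b = tofrac (a * d) / tofrac (b * d).
    by rewrite !tofracM -mulf_div divff ?nz // mulr1.
  have -> : tofrac c / tofrac d = tofrac (c * b) / tofrac (b * d).
    by rewrite [b * d]mulrC !tofracM -mulf_div divff ?nz // mulr1.
  rewrite !frac_valE ?mulf_neq0 //.
  have [e ->] := u_neq0 (mulf_neq0 b0 d0).
  have := vsub_le e (uD (a * d) (c * b)); apply: vle_trans.
  rewrite [in X in vle _ X]/vmin; case: ifP => _; first exact: vmin_lel.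
  exact: vmin_ler.
have wc c : c != 0 -> frac_val (qcst c) = Some 0.
  by move=> c0; rewrite /qcst frac_val_tofrac u_cst.
by exists (Valuation w_oo wM wD wc) => f; apply: frac_val_tofrac.
Qed.

End FractionValuation.

(** * Monomial valuations and residue fields *)

Section MonomialValuations.
Variable k : fieldType.

Lemma nonneg_nonzero_lexpos B : nonneg_nonzero B -> lexpos B.
Proof.
case: B => [a b] [/= a0 b0 n0]; rewrite lexposE /=.
move: n0; rewrite -[0]/((0 : int), (0 : int)) xpair_eqE; lia.
Qed.

Lemma monomial_ex B1 B2 : nonneg_nonzero B1 -> nonneg_nonzero B2 ->
  generates B1 B2 -> free_pair B1 B2 ->
  exists2 w : valuation k, monomial w & forall f, w (tofrac f) = lm B1 B2 f.
Proof.
move=> n1 n2 gen fr; have p1 := nonneg_nonzero_lexpos n1.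
have p2 := nonneg_nonzero_lexpos n2.
have hcst (c : k) : c != 0 -> lm B1 B2 (cst2 c) = Some 0 by apply: lm_cst.
have [w wE] := @frac_val_ex k (lm B1 B2) (lm_None p1 p2) (lmM p1 p2 fr)
  (lmD p1 p2) hcst.
by exists w => //; exists B1, B2; split=> // f c; rewrite wE; apply: lmP.
Qed.

(** Generation makes the determinant of [B1], [B2] a divisor of 1, and Cramer's rule then separates
    the exponents. *)
Lemma generates_free_pair B1 B2 : generates B1 B2 -> free_pair B1 B2.
Proof.
move=> gen; have [m [n e1]] := gen (1, 0); have [m' [n' e2]] := gen (0, 1).
rewrite !Z2mulrz in e1 e2; case: e1 => e11 e12; case: e2 => e21 e22.
case: B1 B2 e11 e12 e21 e22 {gen} => [a1 a2] [b1 b2] /= e11 e12 e21 e22.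
move=> i j p q; rewrite !Z2mulrn => -[h1 h2].
have det : (a1 * b2 - a2 * b1) * (m * n' - n * m') = 1.
  transitivity ((a1 * m + b1 * n) * (a2 * m' + b2 * n') -
    (a2 * m + b2 * n) * (a1 * m' + b1 * n')); first by ring.
  by rewrite -e11 -e12 -e21 -e22.
have d0 : a1 * b2 - a2 * b1 != 0 by apply/eqP => d0; rewrite d0 mul0r in det.
have hi : (a1 * b2 - a2 * b1) * (i%:Z - p%:Z) = 0.
  transitivity (b2 * ((a1 * i + b1 * j) - (a1 * p + b1 * q))
    - b1 * ((a2 * i + b2 * j) - (a2 * p + b2 * q))); first by ring.
  by rewrite h1 h2 !subrr !mulr0 subrr.
have hj : (a1 * b2 - a2 * b1) * (j%:Z - q%:Z) = 0.
  transitivity (a1 * ((a2 * i + b2 * j) - (a2 * p + b2 * q))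
    - a2 * ((a1 * i + b1 * j) - (a1 * p + b1 * q))); first by ring.
  by rewrite h1 h2 !subrr !mulr0 subrr.
move/eqP: hi; rewrite mulf_eq0 (negPf d0) /= => /eqP hi.
move/eqP: hj; rewrite mulf_eq0 (negPf d0) /= => /eqP hj.
lia.
Qed.

(** At value 0, numerator and denominator have the same initial monomial, because the pair of values
    is free; the residue is the quotient of the two initial coefficients. *)
Lemma monomial_residue (w : valuation k) y : monomial w -> vle (Some 0) (w y) ->
  exists a, vlt (Some 0) (w (y - qcst a)).
Proof.
move=> [B1 [B2 [n1 n2 gen wE]]] y0.
have fr := generates_free_pair gen.
have [y0'|ylt] := vle_eqVlt y0; last by exists 0; rewrite qcst0 subr0.
have y0E : w y = Some (0 : Z2) by rewrite -y0'.
have [F [G [f [g [yE Fw Gw e]]]]] := val_series_div y0E.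
have fg : f = g by apply/eqP; rewrite -subr_eq0 -e.
rewrite fg in Fw.
have [[a [b [Fab gE]]] Fmin] := (wE F g).1 Fw.
have [[a' [b' [Gab gE']]] Gmin] := (wE G g).1 Gw.
have [aa bb] : a = a' /\ b = b' by apply: fr; rewrite -gE -gE'.
rewrite -aa -bb in Gab.
pose al := coef2 F a b / coef2 G a b; exists al.
have G0 : tofrac G != 0 by apply/eqP => G0; rewrite G0 val0 in Gw.
have -> : y - qcst al = tofrac (F - cst2 al * G) / tofrac G.
  by rewrite yE tofracB tofracM mulrBl mulfK.
have lt : vlt (Some g) (w (tofrac (F - cst2 al * G))).
  case E: (w _) => [d|] //.
  have [[i [j [Dij dE]]] _] := (wE _ d).1 E.
  rewrite coef2B coef2_cstM in Dij.
  have gd : lexle g d.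
    rewrite dE; have [F0|] := eqVneq (coef2 F i j) 0; last exact: Fmin.
    apply: Gmin; apply: contra Dij => /eqP ->; by rewrite F0 mulr0 subr0.
  have [/(congr1 (odflt 0)) /= gd'|//] := @vle_eqVlt (Some g) (Some d) gd.
  have [ai bj] : a = i /\ b = j by apply: fr; rewrite -gE -dE.
  by case/eqP: Dij; rewrite -ai -bj /al mulfVK ?subrr.
move: lt; rewrite valM (valV Gw).
case: (w _) => [d|] //; rewrite /vlt /= => h.
by rewrite -(lexle_add2r g) subrK add0r.
Qed.

End MonomialValuations.

Section ZeroDimensional.
Variables (k : fieldType) (v : valuation k).

Fact res_cst_zmod : zmod_morphism (@res_cst k v).
Proof.
move=> a b; rewrite /res_cst /res -rmorphB; congr (\pi_{ideal_quot (@vmax k v)} _).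
apply: val_inj; rewrite [RHS](rmorphB (val : valring v -> qser2 k)).
exact: (rmorphB (@qcst k)).
Qed.
HB.instance Definition _ := GRing.isZmodMorphism.Build k (residue v)
  (@res_cst k v) res_cst_zmod.

Fact res_cst_monoid : monoid_morphism (@res_cst k v).
Proof.
split=> [|a b]; rewrite /res_cst /res.
  rewrite -[RHS](rmorph1 (\pi_{ideal_quot (@vmax k v)})).
  congr (\pi_{ideal_quot (@vmax k v)} _).
  apply: val_inj; rewrite [RHS](rmorph1 (val : valring v -> qser2 k)).
  exact: (rmorph1 (@qcst k)).
rewrite -rmorphM; congr (\pi_{ideal_quot (@vmax k v)} _).
apply: val_inj; rewrite [RHS](rmorphM (val : valring v -> qser2 k)).
exact: (rmorphM (@qcst k)).
Qed.
HB.instance Definition _ := GRing.isMonoidMorphism.Build k (residue v)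
  (@res_cst k v) res_cst_monoid.

Lemma zero_dimensional_of_residues :
  (forall x, vle (Some 0) (v x) -> exists a, vlt (Some 0) (v (x - qcst a))) ->
  zero_dimensional v.
Proof.
move=> H r.
have [x ->] : exists x, r = res x by exists (repr r); rewrite /res reprK.
have x0 : vle (Some 0) (v (vrval x)) by case: (x).
have [a ha] := H _ x0; exists ('X - a%:P); first by rewrite polyXsubC_eq0.
rewrite rmorphB /= map_polyX map_polyC /root hornerD hornerX hornerN hornerC subr_eq0.
rewrite /= /res_cst /res -Quotient.idealrBE.
rewrite unfold_in /vmax.
have -> // : vrval (x - ValRing (qcst_vring v a)) = vrval x - qcst a.
exact: (rmorphB (val : valring v -> qser2 k)).
Qed.

End ZeroDimensional.

(** * Automorphisms of the ordered group, and the common end of both cases *)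

Section OrderAutomorphisms.
Variables (s : Z2 -> Z2) (sa : order_auto s).

Lemma autoD c d : s (c + d) = s c + s d. Proof. by case: sa. Qed.
Lemma auto0 : s 0 = 0.
Proof. by apply: (addrI (s 0)); rewrite -autoD !addr0. Qed.
Lemma autoN c : s (- c) = - s c.
Proof. by apply/eqP; rewrite -addr_eq0 -autoD addNr auto0. Qed.
Lemma autoMn c n : s (c *+ n) = s c *+ n.
Proof. by elim: n => [|n IH]; rewrite ?auto0 // !mulrS autoD IH. Qed.
Lemma auto_le c d : lexle (s c) (s d) = lexle c d.
Proof. by case: sa. Qed.
Lemma auto_inj : injective s.
Proof. by case: sa => /bij_inj. Qed.
Lemma auto_vle x y : vle (omap s x) (omap s y) = vle x y.
Proof. by case: x y => [a|] [b|] //=; rewrite auto_le. Qed.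
Lemma auto_vlt0 x : vlt (Some 0) (omap s x) = vlt (Some 0) x.
Proof. by rewrite /vlt; have := auto_vle x (Some 0); rewrite {1}/omap /= auto0 => ->. Qed.

Lemma lm_auto (k : fieldType) B1 B2 (F : ser2 k) : lexpos B1 -> lexpos B2 ->
  lm (s B1) (s B2) F = omap s (lm B1 B2 F).
Proof.
move=> p1 p2; have vE a b : s B1 *+ a + s B2 *+ b = s (B1 *+ a + B2 *+ b).
  by rewrite autoD !autoMn.
case E: (lm B1 B2 F) => [c|] /=.
  have /lmP [[a [b [ab ->]]] minc] := E; apply/lmP; split.
    by exists a, b.
  by move=> i j ij; rewrite vE auto_le; apply: minc.
by move/(lm_None p1 p2): E => ->; apply: lm0.
Qed.

End OrderAutomorphisms.

(** A shear preserves the lexicographic order. It brings positive values into the quadrant required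
    of a monomial valuation, and later corrects the value of the generator of the prime. *)
Definition shear (n : int) (c : Z2) : Z2 := (c.1, c.2 + n * c.1).

Lemma shearK n : cancel (shear n) (shear (- n)).
Proof. by case=> a b; rewrite /shear /= mulNr addrK. Qed.

Lemma shear_auto n : order_auto (shear n).
Proof.
split.
- exists (shear (- n)); first exact: shearK.
  by have := shearK (- n); rewrite opprK.
- by case=> [a b] [c d]; congr pair => /=; ring.
case=> [a b] [c d]; rewrite !lexleE /=.
by have [] := ltgtP a c => //= ->; rewrite lerD2r.
Qed.

Lemma shear_nonneg_nonzero n (c : Z2) : lexpos c -> `|c.2| <= n ->
  nonneg_nonzero (shear n c).
Proof.
case: c => [a b]; rewrite lexposE /= => p bn.
have [a0|a0] : (a = 0 /\ 0 < b) \/ 0 < a by lia.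
  case: a0 => -> b0; rewrite /shear /= mulr0 addr0; split=> //=; first by lia.
  by apply/eqP => -[bE]; rewrite bE in b0.
have an : n <= n * a by rewrite ler_peMr //; lia.
split=> /=; [lia|lia|].
by apply/eqP => -[aE _]; rewrite aE in a0.
Qed.

Section Conclusion.
Variables (k : fieldType) (v : valuation k).

Lemma val_vsub (w : valuation k) a b : b != 0 ->
  w (a / b) = vsub (w a) (w b).
Proof.
move=> /(val_neq0 w) [d bd]; rewrite bd.
case aE: (w a) => [c|]; first exact: val_div aE bd.
by rewrite (val_eq0 aE) mul0r val0.
Qed.

(** Everything is pulled from the formula for [v] on series: [generates] from surjectivity of [v] on
    values, the inclusion of fields from injectivity, and residues in [k] from the monomial
    valuation. *)
Lemma reduction_of_lexmin g1 g2 B1 B2 s : value_group_Z2 v ->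
  ordge 1 g1 -> ordge 1 g2 -> reached v g1 g2 ->
  nonneg_nonzero B1 -> nonneg_nonzero B2 -> free_pair B1 B2 -> order_auto s ->
  (forall f, v (tofrac f) = omap s (lm B1 B2 (subst2 g1 g2 f))) ->
  zero_dimensional v /\ reduces_to_monomial v.
Proof.
move=> hvg h1 h2 rg n1 n2 fr sa vE.
have p1 := nonneg_nonzero_lexpos n1; have p2 := nonneg_nonzero_lexpos n2.
(* A series in the kernel would have value oo under [v], hence is 0. *)
have ginj f : substm h1 h2 f = 0 -> f = 0.
  move=> f0; apply/eqP; rewrite -tofrac_eq0; apply/eqP; apply: (val_eq0 (v := v)).
  by rewrite vE -[subst2 g1 g2 f]/(substm h1 h2 f) f0 lm0.
have gen : generates B1 B2.
  move=> c; have [x xc] := hvg (s c).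
  have [A [B [a [b [_ aE bE e]]]]] := val_series_div xc.
  rewrite vE in aE; rewrite vE in bE.
  case EA: (lm B1 B2 _) aE => [a'|] //= /(congr1 (odflt 0)) /= aE.
  case EB: (lm B1 B2 _) bE => [b'|] //= /(congr1 (odflt 0)) /= bE.
  have cE : c = a' - b'.
    by apply: (auto_inj sa); rewrite e -aE -bE (autoD sa) (autoN sa).
  have /lmP [[i [j [_ a'E]]] _] := EA; have /lmP [[m [n [_ b'E]]] _] := EB.
  exists (i%:Z - m%:Z), (j%:Z - n%:Z).
  rewrite cE a'E b'E !Z2mulrz !Z2mulrn; congr pair => /=; ring.
have [w wmon wE] := monomial_ex k n1 n2 gen fr.
pose iota : {rmorphism qser2 k -> qser2 k} := frac_map ginj.
have iotaE f : iota (tofrac f) = tofrac (subst2 g1 g2 f) by apply: frac_map_tofrac.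
have same x : v x = omap s (w (iota x)).
  have [A [B [B0 ->]]] := fracP x.
  have B0' : tofrac B != 0 :> qser2 k by rewrite tofrac_eq0.
  have iB0' : tofrac (subst2 g1 g2 B) != 0.
    by rewrite tofrac_eq0; apply: contra_neq B0 => /ginj.
  have e : iota (tofrac A / tofrac B) =
      tofrac (subst2 g1 g2 A) / tofrac (subst2 g1 g2 B) := frac_mapE ginj A B0.
  rewrite e (val_vsub v _ B0') (val_vsub w _ iB0').
  have := vE A; have := vE B; have := wE (subst2 g1 g2 A).
  have := wE (subst2 g1 g2 B) => -> -> -> ->.
  case: (lm _ _ _) (lm _ _ _) => [a|] [b|] //.
  by rewrite /vsub /omap /obind /oapp (autoD sa) (autoN sa).
split; last first.
  exists g1, g2; split=> //; exists iota, w; split=> //.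
  by exists s => // x; apply: same.
apply: zero_dimensional_of_residues => x x0.
have wx0 : vle (Some 0) (w (iota x)).
  by rewrite -(auto_vle sa) /= (auto0 sa) -same.
have [a ha] := monomial_residue wmon wx0; exists a.
have -> : v (x - qcst a) = omap s (w (iota x - qcst a)).
  by rewrite same rmorphB; congr (omap s (w (_ - _)));
    rewrite [LHS]iotaE subst2_cst.
by rewrite (auto_vlt0 sa).
Qed.

End Conclusion.

(** * The process stops: a stage with independent values *)

Section IncommensurableStage.
Variables (k : closedFieldType) (v : valuation k).
Hypotheses (hvg : value_group_Z2 v) (hring : ring_contains_series v).

Lemma incommensurable_stage st g h A1 A2 : chained v st ->
  v (y1 st) = Some g -> v (y2 st) = Some h -> lexpos g -> lexpos h ->
  ~ commens h g -> v (tofrac X1) = Some A1 -> v (tofrac X2) = Some A2 ->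
  0 < A1.1 -> 0 < A2.1 ->
  zero_dimensional v /\ reduces_to_monomial v.
Proof.
move=> [rst si] vg vh gp hp nc E1 E2 A1p A2p.
have fr := free_pair_incommens gp hp nc.
have l1 := stage_ordge1 si; have l2 := stage_ordge2 si.
have polyE P : v (tofrac (ev (@cst2 k) X1 X2 P)) =
    lm g h (subst2 (f1 st) (f2 st) (ev (@cst2 k) X1 X2 P)).
  by have [Q -> ->] := stage_poly si P; apply: val_evK_lm.
have lp1 : lexpos A1 by rewrite lexposE A1p.
have lp2 : lexpos A2 by rewrite lexposE A2p.
have [lam [lp lA1 lA2 _ [lam1|lam1]]] :=
  common_lower_bound lp1 lp2 lp1 (or_intror (conj A1p A2p)).
  by rewrite lam1 in A1p.
(* [X1] and [X2] are polynomials, for which the two values are already known to agree; this bounds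
   [f1 st] and [f2 st]. *)
have lG1 : vle (Some lam) (lm g h (f1 st)).
  have := polyE 'X; rewrite evX E1 subst2_X1 // => <-; exact: lA1.
have lG2 : vle (Some lam) (lm g h (f2 st)).
  have := polyE 'X%:P; rewrite evY E2 subst2_X2 // => <-; exact: lA2.
have arch a b : exists M, vlt (Some (g *+ a + h *+ b)) (Some (lam *+ M)).
  case: (g *+ a + h *+ b) => c d; exists (`|c|%N).+1.
  rewrite vltNge /= lexleE Z2mulrn /=; set m := `|c|%N.
  have : m.+1%:Z <= lam.1 * m.+1%:Z by rewrite ler_peMl //; lia.
  have : c <= m%:Z by rewrite /m; lia.
  lia.
have v1 : vle (Some lam) (v (tofrac X1)) by rewrite E1.
have v2 : vle (Some lam) (v (tofrac X2)) by rewrite E2.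
have vE f : v (tofrac f) = lm g h (subst2 (f1 st) (f2 st) f).
  case E: (lm g h _) => [c|].
    apply: (val_series_Some hring l1 l2 gp hp v1 v2 lG1 lG2 arch _ E).
    by move=> P d; rewrite polyE.
  move/(lm_None gp hp): E => /(stage_inj si) ->; by rewrite tofrac0 val0.
(* Large enough for the shear to make both values nonnegative; the inverse shear is then the
   identification with [v]. *)
pose n : int := `|g.2| + `|h.2|.
apply: (@reduction_of_lexmin k v (f1 st) (f2 st) (shear n g) (shear n h)
  (shear (- n))) => //.
- exact: ReachedFinite.
- by apply: shear_nonneg_nonzero => //; rewrite /n lerDl normr_ge0.
- by apply: shear_nonneg_nonzero => //; rewrite /n lerDr normr_ge0.
- move=> a b i j; rewrite -!(autoMn (shear_auto n)) -!(autoD (shear_auto n)).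
  by move/(auto_inj (shear_auto n))/fr.
- exact: shear_auto.
move=> f; rewrite vE -{1}(shearK n g) -{1}(shearK n h).
by apply: lm_auto; [apply: shear_auto|apply: nonneg_nonzero_lexpos; 
  apply: shear_nonneg_nonzero => //; rewrite /n ?lerDl ?lerDr normr_ge0..].
Qed.

End IncommensurableStage.

(** * Restriction to a curve and its principal kernel *)

Section Restriction.
Variable k : fieldType.

Lemma coef2_restrict (F : ser2 k) a b :
  coef2 (subst2 X1 0 F) a b = if b == 0%N then coef2 F a 0 else 0.
Proof.
rewrite coef2_subst2.
have E (i j : nat) : coef2 (X1 ^+ i * 0 ^+ j : ser2 k) a b =
    ((j == 0%N) && ((a == i) && (b == 0%N)))%:R.
  case: j => [|j]; first by rewrite -coef2_mon !expr0.
  by rewrite exprS mul0r mulr0 coef20.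
under eq_bigr do under eq_bigr do rewrite E.
have al : (a < (a + b).+1)%N by rewrite ltnS leq_addr.
rewrite (bigD1 (Ordinal al)) //= [X in _ + X]big1 ?addr0; last first.
  move=> i; rewrite -val_eqE /= eq_sym => /negPf ni; rewrite big1 // => j _.
  by rewrite ni andbF mulr0.
rewrite big_ord_recl /= !eqxx /= big1 ?addr0 => [|j _].
  by case: (b == 0%N); rewrite ?mulr1 ?mulr0.
by rewrite mulr0.
Qed.

Lemma lm_restrict (F : ser2 k) g c : lexpos g ->
  lm g g (subst2 X1 0 F) = Some c ->
  exists m : nat, c = g *+ m /\ lm (0, 1) (1, 0) F = Some (0, m%:Z).
Proof.
move=> gp /lmP [[a [b [ab cE]]] minc].
rewrite coef2_restrict in ab.
case: (eqVneq b 0%N) ab => [b0|_] ab; last by rewrite eqxx in ab.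
rewrite b0 mulr0n addr0 in cE; exists a; split=> //.
apply/lmP; split.
  by exists a, 0%N; rewrite !Z2mulrn; split=> //; congr pair => /=; lia.
move=> i j ij; rewrite !Z2mulrn lexleE /= !mul0r add0r !mul1r.
case: j ij => [|j] ij; last by [].
rewrite ltxx eqxx /=.
have := minc i 0%N; rewrite coef2_restrict => /(_ ij).
rewrite cE mulr0n addr0 => h; have ai : (a <= i)%N.
  by rewrite leqNgt; apply: contraTN h => /(vlt_muln gp).
lia.
Qed.

Lemma lm_restrict0 (F : ser2 k) (e : Z2) :
  subst2 X1 0 F = 0 -> lm (0, 1) (1, 0) F = Some e -> 0 < e.1.
Proof.
move=> F0 /lmP [[a [b [ab ->]]] _]; rewrite !Z2mulrn /= mul0r add0r mul1r.
case: b ab => // ab; have := coef2_restrict F a 0.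
by rewrite F0 coef20 eqxx => /esym Fa; rewrite Fa eqxx in ab.
Qed.

Lemma free_pair_std : free_pair (0, 1) (1, 0).
Proof. by move=> a b i j; rewrite !Z2mulrn => -[]; lia. Qed.

End Restriction.

Section PrincipalPrime.
Variables (k : fieldType) (K1 K2 : ser2 k).
Hypotheses (hK1 : ordge 1 K1) (hK2 : ordge 1 K2).
Notation H := (subst2 K1 K2).

(** Here [X1] is outside the prime kernel, so powers of [X1] can be stripped off inside it. A kernel
    element regular of least degree [d] divides all others: a nonzero remainder, stripped, would be
    regular of smaller degree. *)
Lemma principal_kernel_X1 : K1 != 0 -> (exists2 f, f != 0 & H f = 0) ->
  exists2 f0, f0 != 0 /\ H f0 = 0 & forall f, H f = 0 -> exists q, f = q * f0.
Proof.
move=> K10 [f1 f10 Hf1].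
have strip f : f != 0 -> H f = 0 ->
    exists n d F, [/\ f = X1 ^+ n * F, X2regular d F & H F = 0].
  move=> f_neq0 Hf; have [n [d [F [fE Freg]]]] := X2regular_ex f_neq0.
  exists n, d, F; split=> //; apply/eqP; move/eqP: Hf.
  by rewrite fE substM // substX // subst2_X1 // mulf_eq0 expf_eq0 (negPf K10) andbF.
pose Q d := `[< exists F, X2regular d F /\ H F = 0 >].
have exQ : exists d, Q d.
  have [n [d [F [_ Freg HF]]]] := strip f1 f10 Hf1.
  by exists d; apply/asboolP; exists F.
case: (ex_minnP exQ) => d /asboolP [F [Freg HF]] mind.
exists F.
  split=> //; apply: contraTneq Freg.2 => ->; by rewrite coef20 eqxx.
move=> f Hf; have [q [r [fE r0]]] := weierstrass_division f Freg.
exists q; rewrite fE; suff -> : r = 0 by rewrite addr0.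
apply/eqP; apply: contraT => r_neq0.
have Hr : H r = 0.
  by have := Hf; rewrite fE substD // substM // HF mulr0 add0r.
have [n [d' [R [rE Rreg HR]]]] := strip r r_neq0 Hr.
have dd : (d <= d')%N by apply: mind; apply/asboolP; exists R.
case/eqP: Rreg.2; have := r0 n d' dd.
by rewrite rE coef2_X1XM leqnn subnn.
Qed.

(** Modulo [X1], an [f] not divisible by [X1] is [X2 ^+ d] times a series [e] with nonzero constant
    term, and neither [K2 ^+ d] nor the image of [e] vanishes. *)
Lemma principal_kernel_X2 : K1 = 0 -> K2 != 0 ->
  forall f, H f = 0 -> exists q, f = q * X1.
Proof.
move=> K10 K20 f Hf.
have [->|f0] := eqVneq f 0; first by exists 0; rewrite mul0r.
have [[|n] [d [F [fE Freg]]]] := X2regular_ex f0; last first.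
  by exists (X1 ^+ n * F); rewrite fE exprSr mulrAC.
rewrite expr0 mul1r in fE; rewrite -{}fE {F} in Freg.
have [flow fd] := Freg.
pose e : ser2 k := mkser2 (fun a b => if a == 0%N then coef2 f 0 (b + d) else 0).
pose q : ser2 k := mkser2 (fun a b => coef2 f a.+1 b).
have eE : f = X1 * q + X2 ^+ d * e.
  apply: ser2P => a b; rewrite coef2D coef2_X1M coef2_X2XM.
  case: a => [|a]; last first.
    rewrite -[coef2 q a b]/(coef2 f a.+1 b).
    by rewrite -[coef2 e _ _]/(0 : k) if_same addr0.
  rewrite add0r -[coef2 e 0 _]/(coef2 f 0 (b - d + d)).
  by case: leqP => [/subnK ->//|/flow].
have He : coef2 (H e) 0 0 = coef2 f 0 d.
  have : ordge 1 (e - cst2 (coef2 f 0 d)).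
    by move=> [|a] [|b] // _; rewrite coef2B coef2_cst mulr1n subrr.
  move=> /(ordge_subst hK1 hK2); rewrite substB // subst2_cst // => /(_ 0 0 isT)%N.
  by rewrite coef2B coef2_cst mulr1n => /eqP; rewrite subr_eq0 => /eqP.
move/eqP: Hf; rewrite eE substD // !substM // subst2_X1 // K10 mul0r add0r.
rewrite substX // subst2_X2 // mulf_eq0 expf_eq0 (negPf K20) andbF /= => /eqP He0.
by move: fd; rewrite -He K10 He0 coef20 eqxx.
Qed.

End PrincipalPrime.

(** * The infinite process *)

Section TailStage.
Variables (k : closedFieldType) (v : valuation k).
Hypotheses (hvg : value_group_Z2 v) (hring : ring_contains_series v)
  (hcenter : center_is_maximal v).
Variables (st : stage k) (g : Z2) (alpha : nat -> k).
Hypotheses (stc : chained v st) (gp : lexpos g) (g1 : g.1 = 0).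
Notation H f := (subst2 X1 (tail1 alpha) (subst2 (f1 st) (f2 st) f)).
Hypothesis val_H : forall f c, lm g g (H f) = Some c -> v (tofrac f) = Some c.
Hypothesis val_H0 : forall f c, H f = 0 -> v (tofrac f) = Some c -> 0 < c.1.
Variables (A1 A2 : Z2).
Hypotheses (E1 : v (tofrac X1) = Some A1) (E2 : v (tofrac X2) = Some A2)
  (A12 : A1.1 = 0 \/ A2.1 = 0).

(** [G1] and [G2] express the original variables in the pair [(y1, Y)]: [X2] now stands for the
    limit [Y], and [y2] is [X2 + tail1 alpha]. *)
Let G1 := subst2 X1 (X2 + tail1 alpha) (f1 st).
Let G2 := subst2 X1 (X2 + tail1 alpha) (f2 st).
Notation I f := (subst2 G1 G2 f).
Notation lmI f := (lm (0, 1) (1, 0) (I f)).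

Let hT : ordge 1 (tail1 alpha). Proof. exact: ordge_tail1. Qed.
Let hX1 : ordge 1 (X1 : ser2 k). Proof. exact: ordge_X1. Qed.
Let hX2T : ordge 1 (X2 + tail1 alpha).
Proof. by apply: ordgeD => //; apply: ordge_X2. Qed.
Let hf1 : ordge 1 (f1 st). Proof. exact: stage_ordge1 stc.2. Qed.
Let hf2 : ordge 1 (f2 st). Proof. exact: stage_ordge2 stc.2. Qed.
Let hG1 : ordge 1 G1. Proof. exact: ordge_subst. Qed.
Let hG2 : ordge 1 G2. Proof. exact: ordge_subst. Qed.

Lemma tail1_subst G : ordge 1 G -> subst2 X1 G (tail1 alpha) = tail1 alpha.
Proof. by apply: subst2_X1only => -[|a] [|b]. Qed.

Lemma tail_IE f : I f = subst2 X1 (X2 + tail1 alpha) (subst2 (f1 st) (f2 st) f).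
Proof. by symmetry; apply: subst2_comp. Qed.

(** Setting [Y = 0] in the expansion in [(y1, Y)] amounts to replacing [y2] by its tail. *)
Lemma tail_HE f : H f = subst2 X1 0 (I f).
Proof.
have h0 : ordge 1 (0 : ser2 k) by apply: ordge_zero.
rewrite tail_IE (subst2_comp _ hX1 h0 hX1 hX2T) (subst2_X1 hX1 h0).
by rewrite (substD hX1 h0) (subst2_X2 hX1 h0) add0r (tail1_subst h0).
Qed.

Lemma tail_I_inj f : I f = 0 -> f = 0.
Proof.
have [pm mp] := shift2K hT tail1_subst.
have h2 : ordge 1 (X2 - tail1 alpha).
  by apply: ordgeB => //; apply: ordge_X2.
by rewrite tail_IE => /(cancel_subst_inj hX1 h2 mp) /(stage_inj stc.2).
Qed.

Lemma tail_I_surj : surj_mod_units (fun f : ser2 k => I f).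
Proof.
have [pm mp] := shift2K hT tail1_subst.
have h2 : ordge 1 (X2 - tail1 alpha).
  by apply: ordgeB => //; apply: ordge_X2.
have S1 := cancel_subst_surj hX1 hX2T hX1 h2 pm.
have S := @surj_mod_units_comp (ser2 k) (ser2 k) (ser2 k) (substm hf1 hf2)
  (substm hX1 hX2T) (stage_inj stc.2) (cancel_subst_inj hX1 h2 mp)
  (stage_surj stc.2) S1.
move=> F F0; have [A [B [U [B0 Uu AE]]]] := S F F0.
exists A, B, U; split; [exact: B0|exact: Uu|].
exact: etrans (tail_IE A) (etrans AE (congr1 (fun x => F * U * x) (esym (tail_IE B)))).
Qed.

Let K1 := subst2 X1 (tail1 alpha) (f1 st).
Let K2 := subst2 X1 (tail1 alpha) (f2 st).
Let hK1 : ordge 1 K1. Proof. exact: ordge_subst. Qed.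
Let hK2 : ordge 1 K2. Proof. exact: ordge_subst. Qed.

Lemma tail_HK f : H f = subst2 K1 K2 f. Proof. exact: subst2_comp. Qed.

Lemma tail_H_val f : H f != 0 -> exists m : nat,
  v (tofrac f) = Some (g *+ m) /\ lmI f = Some (0, m%:Z).
Proof.
move=> Hf; have [c cE] := lm_neq0 gp gp Hf.
rewrite (val_H cE); have := cE; rewrite tail_HE => /(lm_restrict gp) [m [-> mE]].
by exists m.
Qed.

(* The centre of the rank one valuation coarser than [v] is principal. *)
Lemma tail_kernel_principal :
  exists2 f0, f0 != 0 /\ H f0 = 0 & forall f, H f = 0 -> exists q, f = q * f0.
Proof.
have nz : exists2 f, f != 0 & subst2 K1 K2 f = 0.
  apply: contrapT => nex; apply: (values_not_cyclic hvg (g := g)) => f f0.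
  have [|m [mE _]] := @tail_H_val f; last by exists m.
  by rewrite tail_HK; apply/eqP => Hf; apply: nex; exists f.
have [K10|K10] := eqVneq K1 0; last first.
  have [f0 [f00 Hf0] gen] := principal_kernel_X1 hK1 hK2 K10 nz.
  exists f0; first by split; [exact: f00|exact: etrans (tail_HK f0) Hf0].
  by move=> f Hf; apply: gen; exact: etrans (esym (tail_HK f)) Hf.
have HX1 : H X1 = 0 by rewrite tail_HK subst2_X1.
have K20 : K2 != 0.
  apply/eqP => K20; have HX2 : H X2 = 0 by rewrite tail_HK subst2_X2.
  have := val_H0 HX1 E1; have := val_H0 HX2 E2.
  by case: A12 => ->; rewrite ltxx.
exists X1.
  split; last exact: HX1.
  by apply/eqP => X10; move: E1; rewrite X10 tofrac0 val0.
move=> f Hf; apply: (principal_kernel_X2 hK1 hK2 K10 K20).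
exact: etrans (esym (tail_HK f)) Hf.
Qed.

(** Every nonzero series is a power of the generator [f0] times an [h] with [H h] nonzero, on which
    the two valuations match. They are therefore compared through the values of [f0] alone. *)
Lemma tail_stage_reduction : zero_dimensional v /\ reduces_to_monomial v.
Proof.
have [f0 [f00 Hf0] gen] := tail_kernel_principal.
have nz f : f != 0 -> exists c, v (tofrac f) = Some c.
  by move=> fn; apply: val_neq0; rewrite tofrac_eq0.
have [[a b] f0v] := nz f0 f00.
have a0 : 0 < a by have := val_H0 Hf0 f0v.
have p1 : lexpos (0, 1) by []. have p2 : lexpos (1, 0) by [].
have LM := lmM p1 p2 free_pair_std.
have lmI0 f : f != 0 -> exists c, lmI f = Some c.
  by move=> fn; apply: lm_neq0 => //; apply: contra_neq fn => /tail_I_inj.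
have [[e b'] f0w] := lmI0 f0 f00.
have e0 : 0 < e by apply: (lm_restrict0 _ f0w); rewrite -tail_HE.
(* Each division by [f0] lowers the first component of the value by [a > 0], and [hring] keeps it
   nonnegative, so the divisions stop. *)
have decomp f : f != 0 -> exists n h, f = f0 ^+ n * h /\ H h != 0.
  move=> fn; have [[c d] cE] := nz f fn.
  have [m] := ubnP `|c|%N; elim: m f c d fn cE => // m IH f c d fn cE cm.
  have [Hf|Hf] := eqVneq (H f) 0; last by exists 0%N, f; rewrite expr0 mul1r.
  have [q qE] := gen f Hf.
  have qn : q != 0 by apply: contra_neq fn => q0; rewrite qE q0 mul0r.
  have [[c' d'] qv] := nz q qn.
  have ce : c = c' + a.
    by have := cE; rewrite qE tofracM valM qv f0v => /(congr1 (odflt 0)) [].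
  have c'0 : 0 <= c'.
    by have := hring q; rewrite qv /= lexleE /=; lia.
  have [|n [h [qE' Hh]]] := IH q c' d' qn qv; first by lia.
  by exists n.+1, h; split=> //; rewrite qE qE' exprSr mulrAC.
have vals f : f != 0 -> exists n m : nat,
    v (tofrac f) = Some ((a, b) *+ n + g *+ m) /\
    lmI f = Some ((e, b') *+ n + (0, m%:Z)).
  move=> fn; have [n [h [fE Hh]]] := decomp f fn.
  have [m [hv hw]] := tail_H_val Hh; exists n, m; split.
    by rewrite fE tofracM tofracXn valM (valXn _ f0v) hv.
  rewrite fE (substM hG1 hG2) LM hw (substX hG1 hG2).
  have -> // : lm (0, 1) (1, 0) (I f0 ^+ n) = Some ((e, b') *+ n).
  elim: n {fE} => [|n IH]; first by have := lm_cst (0, 1) (1, 0) (oner_neq0 k); rewrite cst2_1.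
  by rewrite exprS LM f0w IH mulrS.
(* By [tail_I_surj], [X2], whose value is [(1, 0)], is up to a unit the image of
   an element of [k((X1,X2))]: there is no ramification. *)
have e1 : e = 1.
  have X20 : X2 != 0 :> ser2 k 
    by apply/eqP => X20; move: E2; rewrite X20 tofrac0 val0.
  have [A [B [U [B0 Uu AE]]]] := tail_I_surj X20.
  have [Bn [Bm [_ Bw]]] := vals B B0.
  have U0 : lm (0, 1) (1, 0) U = Some 0.
    have h : vadd (lm (0, 1) (1, 0) U) (lm (0, 1) (1, 0) U^-1) = Some 0.
      by rewrite -LM divrr // -cst2_1 lm_cst ?oner_neq0.
    have := lm_ge0 p1 p2 U; have := lm_ge0 p1 p2 U^-1.
    case: (lm _ _ U) h => [[u1 u2]|] //; case: (lm _ _ U^-1) => [[w1 w2]|] //.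
    move=> /(congr1 (odflt 0)) [/= s1 s2]; rewrite !lexleE /= => h1 h2.
    by congr (Some (_, _)); lia.
  have Aw : lmI A = Some ((1, 0) + 0 + ((e, b') *+ Bn + (0, Bm%:Z))).
    by rewrite AE !LM U0 Bw lm_X2.
  have A0 : A != 0.
    by apply/eqP => A0; rewrite A0 (subst0 hG1 hG2) lm0 in Aw.
  have [An [Am [_ Aw']]] := vals A A0.
  rewrite Aw' !Z2mulrn in Aw; move/(congr1 (odflt 0)): Aw => [/= h _].
  have {}h : e * (An%:Z - Bn%:Z) = 1 by rewrite mulrBr; lia.
  by have := congr1 absz h; rewrite abszM => /eqP; rewrite muln_eq1; lia.
have [c [gE c0]] : exists c, g = (0, c) /\ 0 < c.
  exists g.2; move: gp g1; rewrite lexposE; case: (g) => [g' c] /= h g'0.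
  by rewrite g'0; split=> //; lia.
have span x d : v x = Some d -> exists n m : int, d = (a * n, b * n + c * m).
  move=> xd; have [A [B [dA [dB [_ aE bE ->]]]]] := val_series_div xd.
  have n0 F dF : v (tofrac F) = Some dF -> F != 0.
    by move=> FE; apply/eqP => F0; rewrite F0 tofrac0 val0 in FE.
  have [n [m [nE _]]] := vals A (n0 _ _ aE).
  have [n' [m' [nE' _]]] := vals B (n0 _ _ bE).
  rewrite aE in nE; rewrite bE in nE'.
  have /= -> := congr1 (odflt 0) nE; have /= -> := congr1 (odflt 0) nE'.
  exists (n%:Z - n'%:Z), (m%:Z - m'%:Z).
  by rewrite gE /= !Z2mulrn; congr pair => /=; ring.
(* All values lie in the span of [(a, b)] and [(0, c)]; reaching [(1, 0)] and [(0, 1)] forces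
   [a = 1] and [c = 1]. *)
have a1 : a = 1.
  have [x /span [n [m [h _]]]] := hvg (1, 0).
  by have := congr1 absz h; rewrite abszM => /esym/eqP; rewrite muln_eq1; lia.
have c1 : c = 1.
  have [x /span [n [m [h1 h2]]]] := hvg (0, 1).
  have n0 : n = 0 by rewrite a1 in h1; lia.
  rewrite n0 mulr0 add0r in h2.
  by have := congr1 absz h2; rewrite abszM => /esym/eqP; rewrite muln_eq1; lia.
(* The values of [f0] are [(1, b)] under [v] and [(1, b')] under the monomial valuation, while
   [(0, 1)] is common to both; the shear by [b - b'] matches them. *)
apply: (@reduction_of_lexmin k v G1 G2 (0, 1) (1, 0) (shear (b - b'))) => //.
- exact: (ReachedInfinite2 alpha stc.1).
- exact: free_pair_std.
- exact: shear_auto.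
move=> f; have [->|fn] := eqVneq f 0.
  by rewrite tofrac0 val0 (subst0 hG1 hG2) lm0.
have [n [m [-> ->]]] := vals f fn.
rewrite gE a1 c1 e1 !Z2mulrn /=; congr (Some (_, _)) => /=; ring.
Qed.

End TailStage.

Lemma lexle_muln_unbounded (lam c : Z2) : lexpos lam ->
  (forall M, lexle (lam *+ M) c) -> 0 < c.1.
Proof.
move=> lp h; rewrite ltNge; apply/negP => c0.
have := h (Z2size c).+1; rewrite /Z2size lexleE Z2mulrn /=.
move: lp; rewrite lexposE => /orP [l1|/andP [/eqP -> l2]].
  have : 0 < lam.1 * (`|c.1| + `|c.2|)%N.+1%:Z by rewrite mulr_gt0.
  lia.
have : (`|c.1| + `|c.2|)%N.+1%:Z <= lam.2 * (`|c.1| + `|c.2|)%N.+1%:Z.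
  by rewrite ler_peMl //; lia.
by rewrite mul0r; lia.
Qed.

Lemma lexle_muln_unbounded1 (lam c : Z2) : 0 < lam.1 ->
  ~ (forall M, lexle (lam *+ M) c).
Proof.
move=> l1 h; have := h (Z2size c).+1; rewrite /Z2size lexleE Z2mulrn /=.
have : (`|c.1| + `|c.2|)%N.+1%:Z <= lam.1 * (`|c.1| + `|c.2|)%N.+1%:Z.
  by rewrite ler_peMl //; lia.
lia.
Qed.

Lemma commens_fst0 g h : commens h g -> g.1 = 0 -> h.1 = 0.
Proof.
move=> [i [j [i0 _ e]]] g0; have := congr1 fst e.
by rewrite !Z2mulrn /= g0 mul0r => /eqP; rewrite mulf_eq0 => /orP [/eqP //|]; lia.
Qed.

Theorem mainTheorem2 (k : closedFieldType) (v : valuation k)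
    (hvg : value_group_Z2 v)
    (hring : ring_contains_series v)
    (hcenter : center_is_maximal v) :
  zero_dimensional v /\ (is_monomial v \/ reduces_to_monomial v).
Proof.
(* The sequence of steps may be empty, so a monomial [v] also falls under the second alternative. *)
suff [hz hr] : zero_dimensional v /\ reduces_to_monomial v by split; [|right].
have [A1 p1 E1] := val_X1_ex hcenter; have [A2 p2 E2] := val_X2_ex hcenter.
(* The infinite process, shared by both cases; they differ in why each reachable value is
   commensurable with [g] or beyond its multiples. *)
have tail x0 y0 g0 : good v x0 y0 g0 -> bounded_ray v g0 ->
    (forall x y g z, good v x y g -> commens g g0 -> reaches v x z ->
      vlt (Some 0) (v z) -> (exists2 h, v z = Some h & commens h g) \/
      (forall n, vlt (Some (g *+ n)) (v z))) ->
    exists st g (alpha : nat -> k), let H f :=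
      subst2 X1 (tail1 alpha) (subst2 (f1 st) (f2 st) f) in
    [/\ chained v st, lexpos g, commens g g0,
      forall f c, lm g g (H f) = Some c -> v (tofrac f) = Some c &
      exists lam, [/\ lexpos lam, g.1 = 0 \/ 0 < lam.1 &
        forall f, H f = 0 -> forall M, vle (Some (lam *+ M)) (v (tofrac f))]].
  move=> good0 b0 dich.
  have [x [y [g [gxy gc gen]]]] := ray_generator_ex good0.
  have [rxy xg gp y0'] := gxy.
  have bg : bounded_ray v g.
    move=> B1 B2 /b0 h /h [g0z|]; last by right.
    by left; apply: commens_fst0 gc g0z.
  have [alpha Ha] := tail_ex hvg hring hcenter gxy bg gen
    (fun z => dich x y g z gxy gc).
  have [st [stc xE yE]] := rxy.
  subst x y; exists st, g, alpha; rewrite /=.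
  have [hS hN] := tail_values hring hcenter stc xg gp (vltW y0') bg Ha.
  by split.
have [/andP [A1p A2p]|nB] := boolP ((0 < A1.1) && (0 < A2.1)).
  (* Either some stage has incommensurable values and [v] is monomial there, or none has; the
     process then never stops and every value would be a multiple of [g]. *)
  have [[st [g [h [stc vg vh gp [hp nc]]]]]|none] := pselect (exists st g h,
      [/\ chained v st, v (y1 st) = Some g, v (y2 st) = Some h, lexpos g &
          lexpos h /\ ~ commens h g]).
    exact: (incommensurable_stage hvg hring stc vg vh gp hp nc E1 E2).
  have good0 : good v (tofrac X1) (tofrac X2) A1.
    by split=> //; [apply: reaches0|rewrite E2].
  have [|x y g z [_ xg gp _] _ [st [stc xE zE]] z0|st [g [alpha]]] :=
    tail _ _ _ good0.
  - by move=> B1 B2; rewrite E1 E2 => -[<-] [<-]; right.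
  - case zh: (v z) => [h|]; last by right.
    left; exists h => //; apply: contrapT => nc; apply: none.
    exists st, g, h; rewrite xE zE; split=> //; split=> //.
    by rewrite /lexpos -zh.
  move=> [stc gp gA hS [lam [lp lam1 hN]]]; exfalso.
  have {lam1} lam1 : 0 < lam.1.
    case: lam1 => // g0; have := commens_fst0 (commens_sym gA) g0 => A10.
    by rewrite A10 ltxx in A1p.
  apply: (values_not_cyclic hvg (g := g)) => f f0.
  set Hf := subst2 X1 (tail1 alpha) (subst2 (f1 st) (f2 st) f).
  have [c fc] : exists c, v (tofrac f) = Some c.
    by apply: val_neq0; rewrite tofrac_eq0.
  case E: (lm g g Hf) => [d|].
    have /lmP [[a [b [_ dE]]] _] := E; exists (a + b)%N.
    by rewrite (hS _ _ E) dE mulrnDr.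
  (* A series vanishing on the limit curve would have value above all multiples of [lam], impossible
     for a finite value since [0 < lam.1]. *)
  move/(lm_None gp gp): E => Hf0; case: (@lexle_muln_unbounded1 lam c lam1) => M.
  by have := hN f Hf0 M; rewrite fc.
have A12 : A1.1 = 0 \/ A2.1 = 0.
  by move: p1 p2; rewrite !lexposE; move: nB; lia.
have [x0 [y0 [g0 [good0 g00]]]] : exists x0 y0 g0, good v x0 y0 g0 /\ g0.1 = 0.
  have r0 := reaches0 v.
  case: A12 => A0.
    by exists (tofrac X1), (tofrac X2), A1; split=> //; split=> //; rewrite E2.
  (* The coordinate with value in [(0, _)] is put first, so that the ray of [g0] lies in the smaller
     convex subgroup. *)
  exists (tofrac X2), (- tofrac X1), A2; split=> //; split=> //.
    exact: reaches_swap.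
  by rewrite valN E1.
have [|x y g z [_ xg gp _] gc rz z0|st [g [alpha]]] := tail _ _ _ good0.
- by move=> B1 B2 _ _; left.
- have gz := commens_fst0 gc g00.
  case zh: (v z) z0 => [h|] z0; last by right.
  have hp : lexpos h by [].
  case: g h gp hp gz {xg gc zh z0} => [g1 g2] [h1 h2] gp hp /= g10.
  rewrite !lexposE /= in gp hp.
  have [h10|h1p] : h1 = 0 \/ 0 < h1 by lia.
    (* Both values are positive multiples of [(0, 1)], so cross-multiplying by their second
       components shows them commensurable. *)
    left; exists (h1, h2) => //; exists `|g2|%N, `|h2|%N.
    rewrite !Z2mulrn g10 h10 /=; split; try lia.
    by congr pair; rewrite ?mul0r //; rewrite !gez0_abs; [ring|lia|lia].
  right=> n; rewrite vltNge /= lexleE Z2mulrn /= g10 mul0r; lia.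
move=> [stc gp gg0 hS [lam [lp lam1 hN]]].
apply: (tail_stage_reduction hvg hring stc gp (commens_fst0 gg0 g00) hS _ E1 E2 A12).
move=> f c Hf0 fc; apply: (lexle_muln_unbounded lp) => M.
by have := hN f Hf0 M; rewrite fc.
Qed.
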